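(* Let $p\in\mathbb{N}$ with $p\ge 2$ be given. For every $m\in\mathbb{N}$ with $p<m<2+p+2\sqrt{p}$ there exist infinitely many $p$-harmonic self-maps of the round unit sphere $\mathbb{S}^m$ of the rotationally symmetric form $(t,\varphi)\mapsto (r(t),\varphi)$ with $r(0)=0$ and $r(\pi)=k\pi$ for some $k\in\mathbb{Z}$.
   Context: For a smooth map $\phi:(M,g)\to(N,h)$ between closed Riemannian manifolds and an integer $p\ge 2$, let $E_p(\phi)=\frac1p\int_M|d\phi|^p\,dv_g$. The map $\phi$ is called $p$-harmonic if it is a critical point of $E_p$, i.e. $\operatorname{Tr}_g\nabla^{\phi^*TN}(|d\phi|^{p-2}d\phi)=0$. The sphere $\mathbb{S}^m$ with its standard round metric is parametrized by $(t,\varphi)$, where $0\le t\le\pi$ is the colatitude and $\varphi\in\mathbb{S}^{m-1}$ is a point on the equator. For a map $\phi:\mathbb{S}^m\to\mathbb{S}^m$, $(t,\varphi)\mapsto(r(t),\varphi)$, the energy is, up to a constant factor, $$E_p(\phi)=\frac1p\int_0^\pi\Big(\dot r^2(t)+(m-1)\frac{\sin^2 r(t)}{\sin^2 t}\Big)^{p/2}\sin^{m-1}t\,dt,$$ and each solution $r$ of the Euler-Lagrange equation $$\ddot r+(m-1)\cot t\,\dot r-(m-1)\frac{\sin 2r}{2\sin^2t}+(p-2)\dot r\,\frac{\dot r\ddot r+(m-1)\dot r\frac{\sin 2r}{2\sin^2t}-(m-1)\frac{\sin^2 r}{\sin^2t}\cot t}{\dot r^2+(m-1)\frac{\sin^2r}{\sin^2t}}=0$$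 on $(0,\pi)$ with $r(0)=0$, $r(\pi)=k\pi$, $k\in\mathbb{Z}$, provides a $p$-harmonic self-map of $\mathbb{S}^m$. *)

(* Defs.v *)
From HB Require Import structures.
From mathcomp Require Import all_boot all_order all_algebra.
From mathcomp Require Import all_classical all_reals all_analysis.

Set Implicit Arguments.
Unset Strict Implicit.
Unset Printing Implicit Defensive.

Import Order.TTheory GRing.Theory Num.Theory.
Import numFieldNormedType.Exports.

Local Open Scope classical_set_scope.
Local Open Scope ring_scope.

(* The library norm `|x| on row vectors is the sup norm, so the Euclidean
   structure is spelled out. *)
Definition dot (R : realType) (n : nat) (x y : 'rV[R]_n) : R :=
  \sum_(i < n) x 0 i * y 0 i.

Definition enorm (R : realType) (n : nat) (x : 'rV[R]_n) : R :=
  Num.sqrt (dot x x).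

(* The unit sphere of R^n, i.e. S^(n-1); thus S^m is usphere R m.+1. *)
Definition usphere (R : realType) (n : nat) : Type :=
  {x : 'rV[R]_n | dot x x == 1}.

Definition partial (R : realType) (n k : nat) (i : 'I_n.+1)
    (F : 'rV[R]_n.+1 -> 'rV[R]_k.+1) : 'rV[R]_n.+1 -> 'rV[R]_k.+1 :=
  fun x => 'D_(delta_mx 0 i : 'rV[R]_n.+1) F x.

Fixpoint Ck_on (R : realType) (n k : nat) (U : set 'rV[R]_n.+1) (l : nat)
    (F : 'rV[R]_n.+1 -> 'rV[R]_k.+1) {struct l} : Prop :=
  (forall x, U x -> {for x, continuous F}) /\
  (if l is l'.+1 then
     forall i : 'I_n.+1,
       (forall x, U x -> derivable F x (delta_mx 0 i : 'rV[R]_n.+1)) /\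
       Ck_on U l' (partial i F)
   else True).

Definition smooth_on (R : realType) (n k : nat) (U : set 'rV[R]_n.+1)
    (F : 'rV[R]_n.+1 -> 'rV[R]_k.+1) : Prop :=
  forall l : nat, Ck_on U l F.

(* x |-> phi (x / |x|), the extension of phi to R^(n+1) \ {0} which is constant
   along rays (with the irrelevant value 0 at the origin). *)
Definition radial_ext (R : realType) (n k : nat)
    (phi : usphere R n.+1 -> usphere R k.+1) :
    'rV[R]_n.+1 -> 'rV[R]_k.+1 :=
  fun x => oapp (fun u : usphere R n.+1 => val (phi u)) 0
                (insub ((enorm x)^-1 *: x)).

Definition smooth_map (R : realType) (n k : nat)
    (phi : usphere R n.+1 -> usphere R k.+1) : Prop :=
  smooth_on [set x | x != 0] (radial_ext phi).

Definition hs_norm_diff (R : realType) (n k : nat)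
    (F : 'rV[R]_n.+1 -> 'rV[R]_k.+1) (x : 'rV[R]_n.+1) : R :=
  Num.sqrt (\sum_(i < n.+1) dot (partial i F x) (partial i F x)).

(* Orthogonal projection of R^n onto the tangent space of the sphere at y. *)
Definition tproj (R : realType) (n : nat) (y : usphere R n) (v : 'rV[R]_n) :
    'rV[R]_n := v - dot v (val y) *: val y.

(* Tr_g nabla (|d phi|^(p-2) d phi) at u, for round spheres.
   Let F be the radial extension of phi.  At a point u of the sphere dF
   vanishes in the normal direction and agrees with d phi on the tangent space,
   so |dF| = |d phi|.  Likewise the Cartesian divergence of |dF|^(p-2) dF at u
   is the divergence along the sphere: dF is zero on radial vectors, hence the
   normal term of the trace and the second fundamental form of the domain
   contribute nothing.  The connection of the target sphere, pulled back by
   phi, is the tangential projection of the flat derivative.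
   For smooth phi and p >= 2 the field |dF|^(p-2) dF is C^1 even where dF = 0
   (the natural power |dF|^0 is 1), so the total derivative operator is only
   applied where the derivative exists. *)
Definition p_tension (R : realType) (p n k : nat)
    (phi : usphere R n.+1 -> usphere R k.+1) (u : usphere R n.+1) :
    'rV[R]_k.+1 :=
  let F := radial_ext phi in
  tproj (phi u)
    (\sum_(i < n.+1)
       partial i (fun x => hs_norm_diff F x ^+ (p - 2) *: partial i F x)
         (val u)).

Definition p_harmonic (R : realType) (p n k : nat)
    (phi : usphere R n.+1 -> usphere R k.+1) : Prop :=
  smooth_map phi /\ forall u, p_tension p phi u = 0.

Lemma polar_subproof (R : realType) (m : nat) (t : R) (w : usphere R m) :
  dot (row_mx (cos t)%:M (sin t *: val w) : 'rV[R]_(1 + m))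
      (row_mx (cos t)%:M (sin t *: val w)) == 1.
Proof.
rewrite /dot big_split_ord /= big_ord1 row_mxEl mxE eqxx mulr1n.
under eq_bigr => i _ do rewrite row_mxEr mxE mulrACA.
have /eqP := valP w; rewrite /dot => hw.
rewrite -mulr_sumr hw mulr1 -!expr2.
by rewrite cos2Dsin2.
Qed.

(* The point (t, w), with colatitude t and w on the equator S^(m-1).  All real
   t are allowed, since the profile r below need not stay within [0, pi]. *)
Definition polar (R : realType) (m : nat) (t : R) (w : usphere R m) :
    usphere R m.+1 :=
  exist _ (row_mx (cos t)%:M (sin t *: val w) : 'rV[R]_(1 + m))
    (polar_subproof t w).

(* phi is (t, w) |-> (r(t), w) with r(0) = 0 and r(pi) = k pi.  Continuity
   makes r unique, as a lift of an angle; when phi is smooth so is r. *)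
Definition rot_sym (R : realType) (m : nat)
    (phi : usphere R m.+1 -> usphere R m.+1) : Prop :=
  exists (r : R -> R) (k : int),
    [/\ {within `[0, pi]%classic, continuous r},
        r 0 = 0,
        r pi = k%:~R * pi &
        forall (t : R) (w : usphere R m), 0 <= t <= pi ->
          phi (polar t w) = polar (r t) w].

(* Main.v *)
Require Import Defs.
From HB Require Import structures.
From mathcomp Require Import all_boot all_order all_algebra.
From mathcomp Require Import all_classical all_reals all_analysis.
From mathcomp Require Import ring lra.

Import Order.TTheory GRing.Theory Num.Theory.
Import numFieldNormedType.Exports.

Local Open Scope classical_set_scope.
Local Open Scope ring_scope.

(** Put [cos t = - tanh x] and [tan (r / 2) = e^u]. With [al = m - 1] and
    [be = p - 1] the Euler-Lagrange equation becomes [u' = v] and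
    [v' = q(v) (- (al - be v^2) tanh u + (al - be) (tanh x) v)], where
    [q(v) = (al + v^2) / (al + be v^2)].  The solutions that are regular at the
    pole [x = -oo] form a one-parameter family: after the shift
    [x = y + ln e / 2], they are normalised by [u - y -> 0] at [-oo], and [e]
    enters only through the friction coefficient [tanh x], which is the constant
    [-1] at [e = 0].  The family is continuous up to [e = 0], where the condition
    [(al - be)^2 < 4 al], that is [m < 2 + p + 2 sqrt p], makes the origin a focus,
    so that the polar angle of [(u, v)] is unbounded.  This angle can cross the
    nodes [u = 0] in one direction only, so for small [e > 0] it has turned
    arbitrarily far when [y] reaches the equator [y = - ln e / 2], and the
    intermediate value theorem in [e] gives arbitrarily small [e] with [u = 0] at
    the equator.  For these, [u] is odd in [x] by uniqueness, hence regular at the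
    other pole too, and [r (pi) = pi].  The resulting maps are distinct because
    [r' (0) = e^(-1/2)]. *)

(** * Calculus on the real line *)

(** Three obstacles shape the proof. First, the initial point $x=-\infty$ is singular, so the flow
    cannot be started there. In the variable $s=e^{2y}$, with $u=y+\ln g$ and $v=1+sw$, regularity
    becomes continuity through $s=0$ of a solution of $g'=gw/2$, $sw'+\nu w=b(s,g,w)$, where
    $\nu=(al+3)/2$. The operator $s\,d/ds+\nu$ has a bounded inverse on both sides of 0, and $b$
    depends on $w$ only through $sw$ and $sw^2$, which makes Picard iteration converge for small
    $s$. Secondly, the vector field is not globally Lipschitz. So $v$ is truncated at
    $\pm\sqrt{al/be}$, where $al-be\,v^2$ vanishes: only friction acts there, and before the equator
    it points inwards, so the truncation is never felt. Thirdly, the map must be smooth at the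
    poles. Small negative $s$ corresponds to $c=\cos t$ slightly above 1, so smoothness across $s=0$
    makes $\cos r$ and $\sin r/\sin t$ smooth functions of $c$ near $[-1,1]$. The map is then a
    smooth expression in the coordinates of $x/|x|$, and no quotient by $\sin t$ has to be
    controlled. *)

Section DerivativeRules.
Context {R : realType} {V : normedModType R}.
Implicit Types (f g : V -> R) (x v : V) (a b : R).

Lemma der_eq f x v a b : is_derive x v f a -> a = b -> is_derive x v f b.
Proof. by move=> h <-. Qed.

Lemma der_cst c x v : is_derive x v (fun _ : V => c : R) 0.
Proof. exact: is_derive_cst. Qed.

Lemma derD f g x v a b : is_derive x v f a -> is_derive x v g b ->
  is_derive x v (fun y => f y + g y) (a + b).
Proof. by move=> hf hg; apply: is_deriveD. Qed.

Lemma derN f x v a : is_derive x v f a -> is_derive x v (fun y => - f y) (- a).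
Proof. by move=> hf; apply: is_deriveN. Qed.

Lemma derB f g x v a b : is_derive x v f a -> is_derive x v g b ->
  is_derive x v (fun y => f y - g y) (a - b).
Proof. by move=> hf hg; apply: is_deriveB. Qed.

Lemma derM f g x v a b : is_derive x v f a -> is_derive x v g b ->
  is_derive x v (fun y => f y * g y) (a * g x + f x * b).
Proof.
move=> hf hg; apply: (der_eq _ _ _ _ _ (is_deriveM hf hg)).
by rewrite /GRing.scale /=; ring.
Qed.

Lemma derV f x v a : f x != 0 -> is_derive x v f a ->
  is_derive x v (fun y => (f y)^-1) (- a / f x ^+ 2).
Proof.
move=> fx [df <-]; apply: DeriveDef; first exact: derivableV.
by rewrite (deriveV fx df) /GRing.scale /= mulNr mulrC mulNr.
Qed.

Lemma derX n f x v a : is_derive x v f a ->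
  is_derive x v (fun y => f y ^+ n) (n%:R * f x ^+ n.-1 * a).
Proof.
elim: n => [|n IH] hf.
  rewrite mul0r mul0r; apply: der_eq (der_cst 1 _ _) _; by [].
rewrite (_ : (fun y => _) = (fun y => f y * f y ^+ n)); last first.
  by apply/funext => y; rewrite exprS.
apply: der_eq (derM _ _ _ _ _ _ hf (IH hf)) _.
case: n {IH} => [|n]; first by rewrite /= !mul0r mulr0 addr0 expr0; ring.
by rewrite /= exprS !mulrS; ring.
Qed.

Lemma derive1_line f x v :
  derive1 (fun k : R => f (k *: v + x)) 0 = 'D_v f x.
Proof.
rewrite /derive1 /derive; congr (lim (_ @ 0^')); apply/funext => k /=.
by rewrite addr0 scale0r add0r.
Qed.

(** Restricting [f] to the line through [x] in direction [v] reduces this to one variable, so the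
    inner function needs only a directional derivative. *)
Lemma der_chain (h : R -> R) f x v a b : is_derive x v f a ->
  is_derive (f x) 1 h b -> is_derive x v (fun y => h (f y)) (b * a).
Proof.
move=> [/derivable1P df fa] [dh hb].
set F := fun k : R => f (k *: v + x) in df.
have F0 : F 0 = f x by rewrite /F scale0r add0r.
have dh' : derivable h (F 0) 1 := eq_ind_r (fun z => derivable h z 1) dh F0.
have dhF : derivable (h \o F) 0 1.
  by apply: (derivable1_diffP _ _).2; apply: differentiable_comp;
    [exact: (derivable1_diffP F 0).1 | exact: (derivable1_diffP h (F 0)).1].
apply: DeriveDef; first exact/derivable1P.
have := derive1_comp df dh'; rewrite derive1_line F0 [derive1 h _]derive1E hb fa => <-.
by rewrite -derive1_line.
Qed.

Lemma der_exp f x v a : is_derive x v f a ->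
  is_derive x v (fun y => expR (f y)) (expR (f x) * a).
Proof. by move=> hf; apply: der_chain => //; apply: is_derive_expR. Qed.

End DerivativeRules.

Section RealFunctions.
Context {R : realType}.
Implicit Types (f g : R -> R) (x y a b : R).

Lemma der_id x : is_derive x 1 (fun y : R => y) 1.
Proof. exact: is_derive_id. Qed.

Lemma der_cont f x d : is_derive x 1 f d -> {for x, continuous f}.
Proof. by move=> [h _]; apply/differentiable_continuous/derivable1_diffP. Qed.

Lemma der_unique f x d e : is_derive x 1 f d -> is_derive x 1 f e -> d = e.
Proof. by move=> [_ <-] [_ <-]. Qed.

Lemma der_withincont f a b : (forall x, a <= x <= b -> {for x, continuous f}) ->
  {within `[a, b], continuous f}.
Proof.
move=> h; apply: continuous_in_subspaceT => x; rewrite inE /= in_itv /=.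
exact: h.
Qed.

Lemma mean_value f df a b : a < b ->
  (forall x, a <= x <= b -> is_derive x 1 f (df x)) ->
  exists2 c, a < c < b & f b - f a = df c * (b - a).
Proof.
move=> ab hf; have [||c] := MVT ab (f := f) (df := df).
- by move=> x; rewrite in_itv /= => /andP[h1 h2]; apply: hf; rewrite !ltW.
- by apply: der_withincont => x xab; apply: (der_cont _ _ _ (hf x xab)).
by rewrite in_itv /= => h1 h2; exists c.
Qed.

Lemma der_le_mono f df a b : a <= b ->
  (forall x, a <= x <= b -> is_derive x 1 f (df x)) ->
  (forall x, a < x < b -> 0 <= df x) -> f a <= f b.
Proof.
rewrite le_eqVlt => /predU1P[-> //|ab] hf h0.
have [c hc e] := mean_value _ _ _ _ ab hf.
by rewrite -subr_ge0 e mulr_ge0 ?h0 // subr_ge0 ltW.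
Qed.

Lemma der_bound f g df dg a b : a <= b ->
  (forall x, a <= x <= b -> is_derive x 1 f (df x)) ->
  (forall x, a <= x <= b -> is_derive x 1 g (dg x)) ->
  (forall x, a < x < b -> `|df x| <= dg x) ->
  `|f b - f a| <= g b - g a.
Proof.
move=> ab hf hg h; rewrite ler_norml; apply/andP; split.
  have: f a + g a <= f b + g b.
    apply: (der_le_mono (fun x => f x + g x) (fun x => df x + dg x)) => // x hx.
      by apply: derD; [apply: hf|apply: hg].
    by have := h x hx; rewrite ler_norml => /andP[h1 _]; lra.
  lra.
have: g a - f a <= g b - f b.
  apply: (der_le_mono (fun x => g x - f x) (fun x => dg x - df x)) => // x hx.
    by apply: derB; [apply: hg|apply: hf].
  by have := h x hx; rewrite ler_norml => /andP[_ h1]; lra.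
lra.
Qed.

Lemma der_lip f df M a b : a <= b ->
  (forall x, a <= x <= b -> is_derive x 1 f (df x)) ->
  (forall x, a < x < b -> `|df x| <= M) -> `|f b - f a| <= M * (b - a).
Proof.
move=> ab hf h; have := der_bound f (fun x => M * x) df (fun _ => M) a b ab hf.
rewrite mulrBr; apply=> // x _.
by apply: der_eq (derM _ _ _ _ _ _ (der_cst _ _ _) (der_id _)) _; ring.
Qed.

Lemma der_zero_cst f : (forall x, is_derive x 1 f 0) -> forall x y, f x = f y.
Proof.
move=> h; suff H x y : x <= y -> f x = f y.
  by move=> x y; case: (leP x y) => [|/ltW] /H.
move=> xy; have: `|f y - f x| <= 0 * (y - x).
  by apply: (der_lip f (fun _ => 0)) => // z _; rewrite normr0.
by rewrite mul0r normr_le0 subr_eq0 => /eqP.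
Qed.

Lemma integrable_cont_seg f a b : continuous f ->
  (@lebesgue_measure R).-integrable `[a, b] (EFin \o f).
Proof.
move=> cf; apply: continuous_compact_integrable; first exact: segment_compact.
exact: continuous_subspaceT.
Qed.

Lemma primitive_right f a : continuous f ->
  exists F, forall x, a < x -> is_derive x 1 F (f x).
Proof.
move=> cf; eexists => x ax.
have xx1 : x < x + 1 by rewrite ltrDl.
have [h1 h2] := continuous_FTC1_closed xx1 (integrable_cont_seg _ _ _ cf) ax (cf x).
by apply: DeriveDef; [exact: h1 | rewrite -derive1E].
Qed.

End RealFunctions.

Section Calculus.
Context {R : realType}.
Implicit Types (f g : R -> R) (x y a b : R).

Lemma comp_oppr_cont f : continuous f -> continuous (fun x => f (- x)).
Proof.
move=> cf x; apply: (@continuous_comp _ _ _ (@GRing.opp R) f); first exact: opp_continuous.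
exact: cf.
Qed.

Lemma der_oppr f x d : is_derive (- x) 1 f d -> is_derive x 1 (fun y => f (- y)) (- d).
Proof.
move=> h; apply: der_eq (der_chain f (fun y => - y) _ _ _ _ (derN _ _ _ _ (der_id x)) h) _.
by rewrite mulrN1.
Qed.

Lemma der_near f g x d : (\near x, f x = g x) -> is_derive x 1 f d -> is_derive x 1 g d.
Proof. exact: near_eq_is_derive. Qed.

Lemma near_ed x (P : R -> Prop) :
  (exists2 d, 0 < d & forall y, `|y - x| < d -> P y) <-> \forall y \near x, P y.
Proof.
split=> [[d d0 h]|/nbhs_ballP[d /= d0 h]].
  by apply/nbhs_ballP; exists d => //= y; rewrite /ball /= distrC => /h.
by exists d => // y yx; apply: h; rewrite /ball /= distrC.
Qed.

Lemma cont_ed f x : {for x, continuous f} <->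
  forall e, 0 < e -> exists2 d, 0 < d & forall y, `|y - x| < d -> `|f y - f x| < e.
Proof.
split=> [/cvgrPdist_lt h e e0|h].
  by have /near_ed[d d0 hd] := h e e0; exists d => // y /hd; rewrite distrC.
apply/cvgrPdist_lt => e e0; apply/near_ed; have [d d0 hd] := h e e0.
by exists d => // y /hd; rewrite distrC.
Qed.

Lemma der_ed f x d : is_derive x 1 f d -> forall e, 0 < e ->
  exists2 r, 0 < r & forall h, `|h| < r -> `|f (x + h) - f x - d * h| <= e * `|h|.
Proof.
move=> [df <-] e e0.
have /cvgrPdist_le /(_ e e0) /nbhs_ballP[r /= r0 hr] : 
    h^-1 *: ((f \o shift x) (h *: (1 : R)) - f x) @[h --> 0^'] --> 'D_1 f x by exact: df.
exists r => // h hh.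
have [->|h0] := eqVneq h 0; first by rewrite addr0 subrr sub0r mulr0 oppr0 normr0 mulr0.
have := hr h; rewrite /ball /= sub0r normrN => /(_ hh h0).
have -> : h *: (1 : R) + x = x + h by rewrite [h *: _]mulr1 addrC.
rewrite -(ler_pM2r (_ : 0 < `|h|)) ?normr_gt0 // -normrM => H.
rewrite distrC; apply: le_trans H; rewrite le_eqVlt; apply/orP; left; apply/eqP; congr `|_|.
by rewrite /GRing.scale /=; field.
Qed.

Lemma near_gt a x : a < x -> \forall y \near x, a < y.
Proof.
by move=> h; apply/near_ed; exists (x - a); [lra|move=> y]; rewrite ltr_norml; lra.
Qed.

Lemma near_lt a x : x < a -> \forall y \near x, y < a.
Proof.
by move=> h; apply/near_ed; exists (a - x); [lra|move=> y]; rewrite ltr_norml; lra.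
Qed.

Lemma near_pos f x : {for x, continuous f} -> 0 < f x ->
  exists2 d, 0 < d & forall y, `|y - x| < d -> 0 < f y.
Proof.
move=> /cont_ed cf fx; have [d d0 h] := cf _ fx.
by exists d => // y /h; rewrite ltr_norml; lra.
Qed.

Lemma near_neg f x : {for x, continuous f} -> f x < 0 ->
  exists2 d, 0 < d & forall y, `|y - x| < d -> f y < 0.
Proof.
move=> /cont_ed cf fx; have [|d d0 h] := cf (- f x); first by lra.
by exists d => // y /h; rewrite ltr_norml; lra.
Qed.

(** The fundamental theorem gives a primitive to the right of a base point only. [F] serves $x>-1$,
    and [G], obtained from the reflected function, serves $x<1$. On the overlap they differ by a
    constant, so once normalised at 0 they can be glued. *)
Lemma primitive f : continuous f -> exists F, forall x, is_derive x 1 F (f x).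
Proof.
move=> cf.
have [F hF] := primitive_right f (-1) cf.
have [G0 hG0] := primitive_right (fun x => f (- x)) (-1) (comp_oppr_cont f cf).
pose G := fun x => - G0 (- x).
have hG x : x < 1 -> is_derive x 1 G (f x).
  move=> x1; rewrite -[f x]opprK; apply: derN.
  by apply: der_oppr; rewrite -{2}[x]opprK; apply: hG0; rewrite ltrN2.
exists (fun x => if 0 <= x then F x - F 0 else G x - G 0) => x.
have FG y : -1 < y -> y < 1 -> F y - F 0 = G y - G 0.
  move=> y1 y2.
  have H a b : -1 < a -> a <= b -> b < 1 -> F a - G a = F b - G b.
    move=> h1 h2 h3.
    have: `|(F b - G b) - (F a - G a)| <= 0 * (b - a).
      apply: (der_lip (fun x => F x - G x) (fun _ => 0)) => // z hz; last by rewrite normr0.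
      have [h4 h5] : -1 < z /\ z < 1 by split; lra.
      by apply: der_eq (derB _ _ _ _ _ _ (hF z h4) (hG z h5)) _; rewrite subrr.
    by rewrite mul0r normr_le0 subr_eq0 => /eqP.
  case: (leP 0 y) => h; [have := H 0 y | have := H y 0]; lra.
case: (ltP (-1) x) => hx.
  apply: (der_near (fun y => F y - F 0)); last first.
    by apply: der_eq (derB _ _ _ _ _ _ (hF x hx) (der_cst _ _ _)) _; rewrite subr0.
  near=> y; case: ifP => // /negbT; rewrite -ltNge => y0.
  have y1 : -1 < y by near: y; apply: near_gt.
  by apply: FG => //; lra.
apply: (der_near (fun y => G y - G 0)); last first.
  have hx1 : x < 1 by lra.
  by apply: der_eq (derB _ _ _ _ _ _ (hG x hx1) (der_cst _ _ _)) _; rewrite subr0.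
near=> y; case: ifP => // y0.
have : y < 0 by near: y; apply: near_lt; lra.
lra.
Unshelve. all: by end_near. Qed.

(* The last point where [f <= 0] would be followed by an interval on which
   [f] is positive and nonincreasing. *)
Lemma barrier_le f df a b : a <= b ->
  (forall x, a <= x <= b -> is_derive x 1 f (df x)) ->
  (forall x, a < x < b -> 0 < f x -> df x <= 0) -> f a <= 0 -> f b <= 0.
Proof.
move=> ab hf h fa; rewrite leNgt; apply/negP => fb.
pose S := [set x | a <= x <= b /\ f x <= 0].
have S0 : S a by split=> //; rewrite lexx.
have Sb : has_sup S by split; [exists a|exists b => x [/andP[]]].
pose c := sup S.
have ac : a <= c by apply: sup_upper_bound.
have cb : c <= b by apply: sup_le_ub => //; [exists a|move=> x [/andP[]]].
have cc : {for c, continuous f} by apply: der_cont (hf c _); rewrite ac cb.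
have fc : f c <= 0.
  rewrite leNgt; apply/negP => fc.
  have [|e e0 he] := near_pos f c cc; first by lra.
  have [y [yab fy] yc] := sup_adherent e0 Sb.
  have yc' : y <= c by apply: sup_upper_bound => //; split.
  have : 0 < f y by apply: he; rewrite ltr_norml; rewrite -/c in yc; lra.
  lra.
have cltb : c < b by rewrite lt_neqAle cb andbT; apply/eqP => E; move: fc; rewrite E; lra.
have : - f c <= - f b.
  apply: (der_le_mono (fun x => - f x) (fun x => - df x)) => // x hx.
    by apply: derN; apply: hf; lra.
  have fx : 0 < f x.
    rewrite ltNge; apply/negP => fx.
    have : x <= c by apply: sup_upper_bound => //; split=> //; lra.
    lra.
  by have := h x _ fx; lra.
lra.
Qed.

(** At the first point where $f\ge0$, continuity gives $f=0$; the negative derivative there makes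
    $f$ positive just before, against the choice of the point. *)
Lemma barrier_lt f df a b : a <= b ->
  (forall x, a <= x <= b -> is_derive x 1 f (df x)) ->
  (forall x, a < x <= b -> f x = 0 -> df x < 0) -> f a < 0 -> f b < 0.
Proof.
move=> ab hf h fa; rewrite ltNge; apply/negP => fb.
pose S := [set x | a <= x <= b /\ 0 <= f x].
have Sb0 : S b by split=> //; rewrite lexx ab.
have Si : has_inf S by split; [exists b|exists a => x [/andP[]]].
pose c := inf S.
have ac : a <= c by apply: lb_le_inf; [exists b | move=> x [/andP[]]].
have cb : c <= b by apply: inf_lbound => //; exists a => x [/andP[]].
have cab : a <= c <= b by rewrite ac cb.
have cc : {for c, continuous f} by apply: der_cont (hf c cab).
have lb x : a <= x < c -> f x < 0.
  move=> hx; rewrite ltNge; apply/negP => fx.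
  have : c <= x by apply: inf_lbound; [exists a => z [/andP[]] | split=> //; lra].
  lra.
have fc : 0 <= f c.
  rewrite leNgt; apply/negP => fc.
  have [|e e0 he] := near_neg f c cc; first by lra.
  have [y [yab fy] yc] := inf_adherent e0 Si.
  have yc' : c <= y by apply: inf_lbound => //; exists a => z [/andP[]].
  have : f y < 0 by apply: he; rewrite ltr_norml; rewrite -/c in yc; lra.
  lra.
have altc : a < c by rewrite lt_neqAle ac andbT; apply/eqP => E; move: fc; rewrite -E; lra.
have fc0 : f c = 0.
  apply/eqP; rewrite eq_le fc andbT leNgt; apply/negP => fc'.
  have [e e0 he] := near_pos f c cc fc'.
  pose y := Num.max a (c - e / 2).
  have ya : a <= y by rewrite le_max lexx.
  have yb : c - e / 2 <= y by rewrite le_max lexx orbT.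
  have yc : y < c by rewrite gt_max altc /=; lra.
  have : f y < 0 by apply: lb; rewrite ya.
  have : 0 < f y by apply: he; rewrite ltr_norml; lra.
  lra.
have dc : df c < 0 by apply: h => //; rewrite altc cb.
have [|r r0 hr] := der_ed f c _ (hf c cab) (- df c / 2); first by lra.
pose y := Num.max a (c - r / 2).
have ya : a <= y by rewrite le_max lexx.
have yb : c - r / 2 <= y by rewrite le_max lexx orbT.
have yc : y < c by rewrite gt_max altc /=; lra.
have fy : f y < 0 by apply: lb; rewrite ya.
have := hr (y - c); rewrite [`|y - c|]ltr0_norm; last by lra.
rewrite (addrC c) subrK fc0 ler_norml => /(_ _) /andP[|h1 _]; first by lra.
nra.
Qed.

End Calculus.

(** * The singular equation [s k' + nu k = f] *)

Section Singular.
Context {R : realType}.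
Implicit Types (f g k : R -> R) (x y a b s : R).

Lemma der_sqrt s : 0 < s -> is_derive s 1 (@Num.sqrt R) (2 * Num.sqrt s)^-1.
Proof. exact: is_derive1_sqrt. Qed.

Lemma pow_seg_bound n (P : R -> R) (q : R -> R) M r : 0 <= r ->
  (forall x, is_derive x 1 P (x ^+ n * q x)) ->
  (forall x, 0 <= x <= r -> `|q x| <= M) -> `|P r - P 0| <= M / n.+1%:R * r ^+ n.+1.
Proof.
move=> r0 hP hq.
have H := der_bound P (fun x => M / n.+1%:R * x ^+ n.+1) (fun x => x ^+ n * q x)
   (fun x => M * x ^+ n) 0 r r0.
rewrite expr0n /= mulr0 subr0 in H; apply: H.
- move=> x _; apply: der_eq (derM _ _ _ _ _ _ (der_cst _ _ _) (derX n.+1 _ _ _ _ (der_id x))) _.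
  by rewrite /=; field; rewrite nat1r pnatr_eq0.
- move=> x /andP[x0 xr]; rewrite normrM (ger0_norm (exprn_ge0 n (ltW x0))) [leLHS]mulrC.
  by apply: ler_wpM2r; [rewrite exprn_ge0 // ltW | apply: hq; rewrite !ltW].
Qed.

Lemma sing_right n f : continuous f -> exists k,
  (forall s, 0 < s -> is_derive s 1 k ((f s - n.+1%:R / 2 * k s) / s)) /\
  (forall e, 0 < e -> exists2 d, 0 < d &
     forall s, 0 < s < d -> `|k s - 2 * f 0 / n.+1%:R| <= e).
Proof.
move=> cf.
have csq : continuous (fun x : R => f (x ^+ 2)).
  move=> x; apply: (@continuous_comp _ _ _ (fun x : R => x ^+ 2) f); last exact: cf.
  exact: exprn_continuous.
have cpow : continuous (fun x : R => x ^+ n * f (x ^+ 2)).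
  by move=> x; apply: cvgM; [exact: exprn_continuous | exact: csq].
have [P hP] := primitive _ cpow.
pose k s := 2 * (P (Num.sqrt s) - P 0) * (Num.sqrt s ^+ n.+1)^-1.
exists k; split=> [s s0|e e0].
  have r0 : 0 < Num.sqrt s by rewrite sqrtr_gt0.
  have hr := der_sqrt s s0.
  have rs : s = Num.sqrt s ^+ 2 by rewrite sqr_sqrtr // ltW.
  have rn0 : Num.sqrt s ^+ n.+1 != 0 by rewrite expf_neq0 // gt_eqF.
  have d1 := derV (fun y => Num.sqrt y ^+ n.+1) _ _ _ rn0 (derX n.+1 _ _ _ _ hr).
  have d2 := derB _ _ _ _ _ _ (der_chain P _ _ _ _ _ hr (hP _)) (der_cst (P 0) _ _).
  apply: der_eq (derM _ _ _ _ _ _ (derM _ _ _ _ _ _ (der_cst 2 _ _) d2) d1) _.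
  have -> : (f s - n.+1%:R / 2 * k s) / s =
    (f (Num.sqrt s ^+ 2) - n.+1%:R / 2 * k s) / Num.sqrt s ^+ 2 by rewrite -rs.
  rewrite /k; move: rn0 r0 {hr rs d1 d2}; set r := Num.sqrt s => rn0 r0.
  rewrite [r ^+ n.+1]exprS /= in rn0 *.
  have rn : r ^+ n != 0 by rewrite expf_neq0 // gt_eqF.
  by field; rewrite rn gt_eqF.
have /cont_ed /(_ (e / 2)) [|d d0 hd] := cf 0; first by lra.
exists d => // s /andP[s0 sd].
have r0 : 0 < Num.sqrt s by rewrite sqrtr_gt0.
have rs : s = Num.sqrt s ^+ 2 by rewrite sqr_sqrtr // ltW.
have := pow_seg_bound n (fun x => P x - f 0 / n.+1%:R * x ^+ n.+1)
  (fun x => f (x ^+ 2) - f 0) (e / 2) (Num.sqrt s) (ltW r0).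
rewrite expr0n /= mulr0 subr0 => H.
have {H} : `|P (Num.sqrt s) - f 0 / n.+1%:R * Num.sqrt s ^+ n.+1 - P 0| <=
     e / 2 / n.+1%:R * Num.sqrt s ^+ n.+1.
  apply: H => x.
    apply: der_eq (derB _ _ _ _ _ _ (hP x) (derM _ _ _ _ _ _ (der_cst _ _ _)
       (derX n.+1 _ _ _ _ (der_id x)))) _.
    by rewrite /=; field; rewrite nat1r pnatr_eq0.
  move=> /andP[x0 xr]; apply/ltW/hd; rewrite subr0 ger0_norm ?sqr_ge0 //.
  by apply: le_lt_trans sd; rewrite [leRHS]rs ler_sqr ?nnegrE // ltW.
set r := Num.sqrt s in r0 rs *.
have rn : 0 < r ^+ n.+1 by rewrite exprn_gt0.
have nn : (1 : R) <= n.+1%:R by rewrite ler1n.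
move=> H; rewrite -(ler_pM2r rn) -{1}(gtr0_norm rn) -normrM.
have -> : (k s - 2 * f 0 / n.+1%:R) * r ^+ n.+1 =
   2 * (P r - f 0 / n.+1%:R * r ^+ n.+1 - P 0).
  rewrite /k -/r; move: (r ^+ n.+1) (gt_eqF rn) => w w0.
  by field; rewrite nat1r pnatr_eq0 w0.
rewrite normrM ger0_norm //; apply: (le_trans (ler_wpM2l _ H)) => //.
rewrite mulrA ler_pM2r // mulrA (_ : 2 * (e / 2) = e); last by field.
rewrite ler_pdivrMr; last by lra.
by nra.
Qed.

(** The operator $s\,d/ds$ is invariant under $s\mapsto-s$, so the left half is [sing_right] applied
    to $f(-s)$. Both halves have the limit $2f(0)/(n+1)$ at 0. *)
Lemma singular_primitive n f : continuous f -> exists k, [/\ continuous k,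
  (forall s, s != 0 -> is_derive s 1 k ((f s - n.+1%:R / 2 * k s) / s)) &
  n.+1%:R / 2 * k 0 = f 0].
Proof.
move=> cf.
have [k1 [d1 l1]] := sing_right n f cf.
have [k2 [d2 l2]] := sing_right n (fun s => f (- s)) (comp_oppr_cont f cf).
pose k s := if 0 < s then k1 s else if s < 0 then k2 (- s) else 2 * f 0 / n.+1%:R.
have k0 : k 0 = 2 * f 0 / n.+1%:R by rewrite /k ltxx.
have kp s : 0 < s -> k s = k1 s by rewrite /k => ->.
have kn s : s < 0 -> k s = k2 (- s).
  by rewrite /k => s0; rewrite s0; case: ltP => //; lra.
have dk s : s != 0 -> is_derive s 1 k ((f s - n.+1%:R / 2 * k s) / s).
  move=> s0; case: (ltgtP s 0) => // hs.
  - apply: (der_near (fun s => k2 (- s))).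
      by near=> y; rewrite kn //; near: y; apply: near_lt.
    have s1 : 0 < - s by lra.
    apply: der_eq (der_oppr _ _ _ (d2 _ s1)) _.
    by rewrite opprK kn //; field.
  - apply: (der_near k1).
      by near=> y; rewrite kp //; near: y; apply: near_gt.
    by apply: der_eq (d1 s hs) _; rewrite kp.
  - by rewrite hs eqxx in s0.
exists k; split=> // [s|]; last by rewrite k0; field; rewrite nat1r pnatr_eq0.
have [->|s0] := eqVneq s 0; last exact: der_cont (dk s s0).
apply/cont_ed => e e0; have e2 : 0 < e / 2 by lra.
have [r1 r10 h1] := l1 _ e2; have [r2 r20 h2] := l2 _ e2.
exists (Num.min r1 r2); first by rewrite lt_min r10 r20.
move=> y; rewrite subr0 lt_min => /andP[y1 y2]; rewrite k0.
case: (ltgtP y 0) => hy.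
- rewrite kn //; apply: le_lt_trans (_ : e / 2 < e); last by lra.
  by have := h2 (- y); rewrite oppr0; apply; rewrite ltr0_norm // in y2; lra.
- rewrite kp //; apply: le_lt_trans (_ : e / 2 < e); last by lra.
  by apply: h1; rewrite gtr0_norm // in y1; lra.
- by rewrite hy k0 subrr normr0.
Unshelve. all: by end_near. Qed.

(* Maximum principle: at a maximum point [c] of [k] one has [c * k' c >= 0]. *)
Lemma singular_max nu k f M s0 : 0 < nu -> 0 <= s0 ->
  {within `[- s0, s0], continuous k} ->
  (forall s, `|s| <= s0 -> s != 0 -> is_derive s 1 k ((f s - nu * k s) / s)) ->
  nu * k 0 = f 0 ->
  (forall s, `|s| <= s0 -> f s <= M) ->
  forall s, `|s| <= s0 -> nu * k s <= M.
Proof.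
move=> nu0 s00 ck dk k0 hM.
have ss : - s0 <= s0 by lra.
have [c /[!in_itv]/= cI hc] := EVT_max ss ck.
suff H : nu * k c <= M.
  move=> s hs; apply: le_trans H; rewrite ler_pM2l //; apply: hc.
  by rewrite in_itv /= -ler_norml.
have cI' : `|c| <= s0 by rewrite ler_norml.
have [c0|c0] := eqVneq c 0; first by rewrite c0 k0; apply: hM; rewrite normr0.
apply: le_trans (hM c cI'); rewrite leNgt; apply/negP => hlt.
set D := f c - nu * k c; have D0 : D < 0 by rewrite /D; lra.
have nc : 0 < `|c| by rewrite normr_gt0.
have [|r r0 hr] := der_ed k c _ (dk c cI' c0) (- D / (2 * `|c|)).
  by rewrite divr_gt0 //; lra.
(* The point $c-tc$ lies between 0 and $c$, hence in the interval, and within the radius where the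
   linear approximation holds. There [k] exceeds its maximum by about $-tD>0$. *)
pose t := Num.min 1 (r / (2 * `|c|)).
have rc : 0 < r / (2 * `|c|) by rewrite divr_gt0 //; lra.
have t0 : 0 < t by rewrite lt_min ltr01 rc.
have t1 : t <= 1 by rewrite ge_min lexx.
have t2 : t <= r / (2 * `|c|) by rewrite ge_min lexx orbT.
have tc : `|- (t * c)| = t * `|c| by rewrite normrN normrM gtr0_norm.
have htr : `|- (t * c)| < r.
  rewrite tc.
  apply: (le_lt_trans (ler_wpM2r (ltW nc) t2)).
  by rewrite (_ : r / (2 * `|c|) * `|c| = r / 2); [lra|field; rewrite gt_eqF].
have := hr _ htr; rewrite tc.
rewrite (_ : (f c - nu * k c) / c * - (t * c) = - (t * D)); last by rewrite -/D; field.
rewrite (_ : - D / (2 * `|c|) * (t * `|c|) = - D * t / 2); last by field; rewrite gt_eqF.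
rewrite ler_norml => /andP[h1 _].
have : k (c - t * c) <= k c.
  apply: hc; rewrite in_itv /= -ler_norml (_ : c - t * c = (1 - t) * c); last by ring.
  rewrite normrM ger0_norm; last by lra.
  by apply: le_trans cI'; rewrite ler_piMl // gerBl ltW.
nra.
Qed.

(** The inverse of $s\,d/ds+\nu$ has sup norm at most $1/\nu$, on every symmetric interval. *)
Lemma singular_bound nu k f M s0 : 0 < nu -> 0 <= s0 ->
  {within `[- s0, s0], continuous k} ->
  (forall s, `|s| <= s0 -> s != 0 -> is_derive s 1 k ((f s - nu * k s) / s)) ->
  nu * k 0 = f 0 ->
  (forall s, `|s| <= s0 -> `|f s| <= M) ->
  forall s, `|s| <= s0 -> nu * `|k s| <= M.
Proof.
move=> nu0 s00 ck dk k0 hM s hs; case: (lerP 0 (k s)) => h.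
  rewrite ger0_norm //; apply: (singular_max nu k f M s0) => // z hz.
  by have := hM z hz; rewrite ler_norml => /andP[].
rewrite ltr0_norm //; apply: (singular_max nu (fun s => - k s) (fun s => - f s) M s0) => //.
- by move=> x; apply: cvgN; exact: ck.
- move=> z hz z0; apply: der_eq (derN _ _ _ _ (dk z hz z0)) _.
  by field.
- by rewrite mulrN k0.
- by move=> z hz; have := hM z hz; rewrite ler_norml; lra.
Qed.

End Singular.

(** * Global solutions of bounded Lipschitz systems *)

Section Picard.
Context {R : realType}.
Implicit Types (f g u v : R -> R) (x y a b : R).

Lemma half_pow_small e : 0 < e -> exists n, (1 / 2 : R) ^+ n < e.
Proof.
move=> e0.
have : (fun n => (1 / 2 : R) ^+ n) @ \oo --> (0 : R).
  by apply: cvg_expr; rewrite ger0_norm; lra.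
move=> /cvgrPdist_lt /(_ e e0) [n _ hn]; exists n.
by have := hn n (leqnn n); rewrite sub0r normrN ger0_norm // exprn_ge0 //; lra.
Qed.

Lemma eq_of_half_pow a b M : (forall n, `|a - b| <= M * (1 / 2) ^+ n) -> a = b.
Proof.
move=> h; apply/eqP; rewrite -subr_eq0 -normr_le0 leNgt; apply/negP => h0.
have M0 : 0 < M by have := h 0%N; rewrite expr0 mulr1; lra.
have [|n hn] := half_pow_small (`|a - b| / M); first by rewrite divr_gt0.
have := h n; rewrite ltr_pdivlMr // mulrC in hn; lra.
Qed.

(** The intervals of centre $f_n(x)$ and radius $2B(x)2^{-n}$ are nested, and the limit is the
    supremum of their left ends. Letting [B] depend on the point admits iterates whose differences
    grow at infinity. *)
Lemma geometric_limit (f : nat -> R -> R) (B : R -> R) :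
  (forall n (x : R), `|f n.+1 x - f n x| <= B x * (1 / 2) ^+ n) ->
  exists F : R -> R, forall n (x : R), `|F x - f n x| <= 2 * B x * (1 / 2) ^+ n.
Proof.
move=> h; pose q n : R := (1 / 2) ^+ n.
have qS n : q n.+1 = q n / 2 by rewrite /q exprS mulrC mul1r.
have lo (x : R) n k : f n x - 2 * B x * q n <= f (n + k)%N x - 2 * B x * q (n + k)%N.
  elim: k => [|k IH]; first by rewrite addn0.
  rewrite addnS; apply: (le_trans IH); have := h (n + k)%N x.
  rewrite -/(q _) qS ler_norml; lra.
have hi (x : R) n k : f (n + k)%N x + 2 * B x * q (n + k)%N <= f n x + 2 * B x * q n.
  elim: k => [|k IH]; first by rewrite addn0.
  rewrite addnS; apply: (le_trans _ IH); have := h (n + k)%N x.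
  rewrite -/(q _) qS ler_norml; lra.
have B0 (x : R) n : 0 <= 2 * B x * q n.
  have q0 : 0 < q n by rewrite exprn_gt0 //; lra.
  have : 0 <= B x by have := h 0%N x; rewrite expr0 mulr1; exact: le_trans.
  by move=> ?; apply: mulr_ge0; [lra|exact: ltW].
have lohi (x : R) n k : f n x - 2 * B x * q n <= f k x + 2 * B x * q k.
  have h1 := lo x n (k - n)%N; have h2 := hi x k (n - k)%N.
  rewrite -maxnE in h1; rewrite -maxnE maxnC in h2.
  by have := B0 x (maxn n k); lra.
pose S (x : R) := [set f n x - 2 * B x * q n | n in [set: nat]].
have S0 (x : R) : has_sup (S x).
  by split; [exists (f 0%N x - 2 * B x * q 0%N), 0%N | exists (f 0%N x + 2 * B x * q 0%N) => _ [n _ <-]].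
exists (fun x => sup (S x)) => n x.
have h1 : f n x - 2 * B x * q n <= sup (S x).
  by apply: sup_upper_bound => //; exists n.
have h2 : sup (S x) <= f n x + 2 * B x * q n.
  by apply: sup_le_ub; [case: (S0 x) | move=> _ [k _ <-]].
by rewrite ler_norml -/(q n); lra.
Qed.

Lemma geometric_limit_cont (f : nat -> R -> R) F (B : R -> R) :
  (forall n x, `|F x - f n x| <= 2 * B x * (1 / 2) ^+ n) ->
  (forall n, continuous (f n)) ->
  (forall x, exists d M, 0 < d /\ forall y, `|y - x| < d -> B y <= M) ->
  continuous F.
Proof.
move=> h cf hB x; apply/cont_ed => e e0.
have [d [M [d0 hM]]] := hB x.
have [|n hn] := half_pow_small (e / (8 * (`|M| + 1))).
  by rewrite divr_gt0 //; have := normr_ge0 M; lra.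
set q := (1 / 2) ^+ n in hn.
have q0 : 0 < q by rewrite exprn_gt0 //; lra.
have M1 : 0 < 8 * (`|M| + 1) by have := normr_ge0 M; lra.
rewrite ltr_pdivlMr // in hn.
have hq y : `|y - x| < d -> `|F y - f n y| < e / 4.
  move=> /hM hy; apply: le_lt_trans (h n y) _; rewrite -/q.
  have : B y <= `|M| by apply: le_trans hy (ler_norm M).
  nra.
have e4 : 0 < e / 4 by lra.
have /cont_ed /(_ _ e4) [d' d'0 hd'] := cf n x.
exists (Num.min d d'); first by rewrite lt_min d0.
move=> y; rewrite lt_min => /andP[y1 y2].
have := hq y y1; have := hq x; rewrite subrr normr0 => /(_ d0); have := hd' y y2.
by rewrite !ltr_norml; lra.
Qed.

(** A total choice of primitive, so that Picard iteration is an [iter] of a function; discontinuous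
    arguments get the zero function. *)
Definition prim f : R -> R :=
  if pselect (continuous f) is left cf then projT1 (cid (primitive f cf)) else 0.

Lemma primP f : continuous f -> forall x, is_derive x 1 (prim f) (f x).
Proof. by move=> cf; rewrite /prim; case: pselect => // ?; case: cid. Qed.

Lemma prim_from a (y0 : R) f : continuous f ->
  forall x, is_derive x 1 (fun y => a + (prim f y - prim f y0)) (f x).
Proof.
move=> cf x; apply: der_eq (derD _ _ _ _ _ _ (der_cst a _ _)
  (derB _ _ _ _ _ _ (primP f cf x) (der_cst _ _ _))) _.
by rewrite subr0 add0r.
Qed.

(** Integration from [y0] has norm $1/l$ for the sup norm weighted by $e^{-l|x-y_0|}$. A large [l]
    makes Picard iteration contract on the whole line at once. *)
Lemma exp_weight_bound f (df : R -> R) (y0 l c : R) : 0 < l -> 0 <= c ->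
  (forall x, is_derive x 1 f (df x)) -> f y0 = 0 ->
  (forall x, `|df x| <= c * expR (l * `|x - y0|)) ->
  forall x, `|f x| <= c / l * expR (l * `|x - y0|).
Proof.
move=> l0 c0 hf f0 hd x.
have dl (k z : R) : is_derive z 1 (fun y => expR (k * (y - y0))) (expR (k * (z - y0)) * k).
  apply: der_eq (der_exp _ _ _ _ (derM _ _ _ _ _ _ (der_cst k _ _)
     (derB _ _ _ _ _ _ (der_id z) (der_cst y0 _ _)))) _.
  by ring.
have l1 : l != 0 by rewrite gt_eqF.
have cl : 0 <= c / l by rewrite divr_ge0 // ltW.
have hf' a b z (_ : a <= z <= b) : is_derive z 1 f (df z) by exact: hf.
case: (leP y0 x) => hx.
  have H2 z (_ : y0 <= z <= x) : is_derive z 1 (fun y => c / l * expR (l * (y - y0))) (c * expR (l * (z - y0))).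
    by apply: der_eq (derM _ _ _ _ _ _ (der_cst (c / l) _ _) (dl l z)) _; field.
  have H3 z : y0 < z < x -> `|df z| <= c * expR (l * (z - y0)).
    by move=> hz; have := hd z; rewrite (@ger0_norm _ (z - y0)) //; lra.
  have := der_bound _ _ _ _ _ _ hx (hf' _ _) H2 H3.
  by rewrite f0 subr0 subrr mulr0 expR0 mulr1 (@ger0_norm _ (x - y0)); lra.
have H2 z (_ : x <= z <= y0) : is_derive z 1 (fun y => - (c / l) * expR (- l * (y - y0))) (c * expR (- l * (z - y0))).
  by apply: der_eq (derM _ _ _ _ _ _ (der_cst (- (c / l)) _ _) (dl (- l) z)) _; field.
have H3 z : x < z < y0 -> `|df z| <= c * expR (- l * (z - y0)).
  by move=> hz; have := hd z; rewrite (@ltr0_norm _ (z - y0)) ?mulrN ?mulNr //; lra.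
have := der_bound _ _ _ _ _ _ (ltW hx) (hf' _ _) H2 H3.
rewrite f0 sub0r normrN subrr mulr0 expR0 mulr1 mulNr [l * _](_ : _ = - l * (x - y0)).
  by lra.
by rewrite (@ltr0_norm _ (x - y0)); [ring|lra].
Qed.

Lemma local_exp_bound (K l y0 x : R) : 0 <= K -> 0 < l ->
  exists d M, 0 < d /\ forall y, `|y - x| < d -> K * expR (l * `|y - y0|) <= M.
Proof.
move=> K0 l0; exists 1, (K * expR (l * (`|x - y0| + 1))); split=> // y hy.
apply: ler_wpM2l => //; rewrite ler_expR ler_pM2l //.
by have := ler_distD x y y0; lra.
Qed.

Theorem picard (F1 F2 : R -> R -> R -> R) (C M : R) : 1 <= C -> 0 <= M ->
  (forall u v, continuous u -> continuous v ->
     continuous (fun y => F1 y (u y) (v y)) /\ continuous (fun y => F2 y (u y) (v y))) ->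
  (forall y a b, `|F1 y a b| <= M /\ `|F2 y a b| <= M) ->
  (forall y a b a' b', `|F1 y a b - F1 y a' b'| <= C * (`|a - a'| + `|b - b'|) /\
     `|F2 y a b - F2 y a' b'| <= C * (`|a - a'| + `|b - b'|)) ->
  forall y0 a b, exists u v, [/\ u y0 = a, v y0 = b,
    (forall y, is_derive y 1 u (F1 y (u y) (v y))) &
    (forall y, is_derive y 1 v (F2 y (u y) (v y)))].
Proof.
move=> C1 M0 hc hM hL y0 a b.
pose T (X : (R -> R) * (R -> R)) : (R -> R) * (R -> R) :=
  (fun y => a + (prim (fun y => F1 y (X.1 y) (X.2 y)) y - prim (fun y => F1 y (X.1 y) (X.2 y)) y0),
   fun y => b + (prim (fun y => F2 y (X.1 y) (X.2 y)) y - prim (fun y => F2 y (X.1 y) (X.2 y)) y0)).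
pose X n := iter n T (fun _ => a, fun _ => b).
have cX n : continuous (X n).1 /\ continuous (X n).2.
  elim: n => [|n [c1 c2]]; first by split=> x; exact: cvg_cst.
  have [k1 k2] := hc _ _ c1 c2.
  by split=> x; [apply: der_cont (prim_from a y0 _ k1 x) | apply: der_cont (prim_from b y0 _ k2 x)].
have dX n y : is_derive y 1 (X n.+1).1 (F1 y ((X n).1 y) ((X n).2 y)) /\
              is_derive y 1 (X n.+1).2 (F2 y ((X n).1 y) ((X n).2 y)).
  have [c1 c2] := cX n; have [k1 k2] := hc _ _ c1 c2.
  by split; [exact: (prim_from a y0 _ k1 y) | exact: (prim_from b y0 _ k2 y)].
have X0 n : (X n).1 y0 = a /\ (X n).2 y0 = b.
  by case: n => [|n] //=; rewrite !subrr !addr0.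
(* Then $C/l=1/4$: each component's new error is a quarter of the sum of the two old ones, so both
   errors halve at every step. *)
pose l := 4 * C; have l0 : 0 < l by rewrite /l; lra.
have lC : C / l = 1 / 4 by rewrite /l; field; lra.
pose K := M / l; have K0 : 0 <= K by rewrite divr_ge0 // ltW.
pose E y := expR (l * `|y - y0|).
have E0 y : 0 < E y by exact: expR_gt0.
have E1 y : 1 <= E y.
  by apply: le_trans (expR_ge1Dx _); rewrite lerDl mulr_ge0 // ltW.
have step n : forall y, `|(X n.+1).1 y - (X n).1 y| <= K * E y * (1 / 2) ^+ n /\
                 `|(X n.+1).2 y - (X n).2 y| <= K * E y * (1 / 2) ^+ n.
  elim: n => [|n IH] y.
    have b0 (f : R -> R) (df : R -> R) c : (forall x, is_derive x 1 f (df x)) -> f y0 = c ->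
        (forall x, `|df x| <= M) -> `|f y - c| <= K * E y * (1 / 2) ^+ 0.
      move=> hf fc hd; rewrite expr0 mulr1.
      apply: (exp_weight_bound (fun y => f y - c) df) => // [x||x].
      - by apply: der_eq (derB _ _ _ _ _ _ (hf x) (der_cst _ _ _)) _; rewrite subr0.
      - by rewrite fc subrr.
      - by apply: le_trans (hd x) _; rewrite ler_peMr // E1.
    have [e1 e2] := X0 1%N.
    by split; [apply: b0 (fun x => (dX 0%N x).1) e1 _ => x; case: (hM x a b) |
               apply: b0 (fun x => (dX 0%N x).2) e2 _ => x; case: (hM x a b)].
  have q0 : 0 <= (1 / 2 : R) ^+ n by rewrite exprn_ge0 //; lra.
  have e2 : K * E y * (1 / 2) ^+ n.+1 = (2 * C * K * (1 / 2) ^+ n) / l * E y.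
    have -> : 2 * C * K * (1 / 2) ^+ n / l * E y = C / l * (2 * K * (1 / 2) ^+ n * E y) by ring.
    by rewrite lC exprS; field.
  have cc : 0 <= 2 * C * K * (1 / 2) ^+ n by apply: mulr_ge0 => //; apply: mulr_ge0 => //; lra.
  have [e3 e4] := X0 n.+2; have [e5 e6] := X0 n.+1.
  have hb x : C * (`|(X n.+1).1 x - (X n).1 x| + `|(X n.+1).2 x - (X n).2 x|) <=
      2 * C * K * (1 / 2) ^+ n * E x.
    have [i1 i2] := IH x.
    rewrite [leRHS](_ : _ = C * (2 * (K * E x * (1 / 2) ^+ n))); last by ring.
    by apply: ler_wpM2l; (clear -C1 F1 F2 T X l K E i1 i2; lra).
  rewrite e2; split.
    apply: (exp_weight_bound (fun y => (X n.+2).1 y - (X n.+1).1 y)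
      (fun x => F1 x ((X n.+1).1 x) ((X n.+1).2 x) - F1 x ((X n).1 x) ((X n).2 x))) => // [x||x].
    - exact: derB (dX n.+1 x).1 (dX n x).1.
    - by rewrite e3 e5 subrr.
    - exact: le_trans (hL _ _ _ _ _).1 (hb x).
  apply: (exp_weight_bound (fun y => (X n.+2).2 y - (X n.+1).2 y)
      (fun x => F2 x ((X n.+1).1 x) ((X n.+1).2 x) - F2 x ((X n).1 x) ((X n).2 x))) => // [x||x].
  - exact: derB (dX n.+1 x).2 (dX n x).2.
  - by rewrite e4 e6 subrr.
  - exact: le_trans (hL _ _ _ _ _).2 (hb x).
have [u hu] := geometric_limit (fun n => (X n).1) (fun y => K * E y) (fun n y => (step n y).1).
have [v hv] := geometric_limit (fun n => (X n).2) (fun y => K * E y) (fun n y => (step n y).2).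
have cu : continuous u.
  apply: (geometric_limit_cont _ _ _ hu) => [n|x]; first by case: (cX n).
  exact: local_exp_bound.
have cv : continuous v.
  apply: (geometric_limit_cont _ _ _ hv) => [n|x]; first by case: (cX n).
  exact: local_exp_bound.
have [k1 k2] := hc _ _ cu cv.
have du := prim_from a y0 _ k1; have dv := prim_from b y0 _ k2.
have bnd n y : C * (`|u y - (X n).1 y| + `|v y - (X n).2 y|) <= 4 * C * K * (1 / 2) ^+ n * E y.
  have i1 := hu n y; have i2 := hv n y.
  rewrite [leRHS](_ : _ = C * (2 * (2 * (K * E y) * (1 / 2) ^+ n))); last by ring.
  by apply: ler_wpM2l; (clear -C1 F1 F2 T X l K E i1 i2; lra).
(* [w] is a component of the limit and [U] the same component of its Picard image. Both are within a
   multiple of $2^{-n}$ of the iterates, so they coincide and the limit is a fixed point. *)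
have lim (U w : R -> R) (Fi : R -> R -> R -> R) (Y : nat -> R -> R) c :
  (forall y, is_derive y 1 U (Fi y (u y) (v y))) -> U y0 = c ->
  (forall n y, is_derive y 1 (Y n.+1) (Fi y ((X n).1 y) ((X n).2 y))) ->
  (forall n, Y n y0 = c) ->
  (forall n y, `|w y - Y n y| <= 2 * (K * E y) * (1 / 2) ^+ n) ->
  (forall y a b a' b', `|Fi y a b - Fi y a' b'| <= C * (`|a - a'| + `|b - b'|)) -> U = w.
  move=> dU U0 dY Y0 hw hFi; apply/funext => y.
  apply: (eq_of_half_pow _ _ (2 * (K * E y))) => n.
  have q0 : 0 <= (1 / 2 : R) ^+ n by rewrite exprn_ge0 //; lra.
  have cc : 0 <= 4 * C * K * (1 / 2) ^+ n by apply: mulr_ge0 => //; apply: mulr_ge0 => //; lra.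
  have := exp_weight_bound (fun y => U y - Y n.+1 y)
      (fun x => Fi x (u x) (v x) - Fi x ((X n).1 x) ((X n).2 x)) y0 l _ l0 cc.
  move=> /(_ (fun x => derB _ _ _ _ _ _ (dU x) (dY n x))).
  rewrite U0 Y0 subrr => /(_ erefl (fun x => le_trans (hFi _ _ _ _ _) (bnd n x)) y).
  rewrite (_ : 4 * C * K * (1 / 2) ^+ n / l = K * (1 / 2) ^+ n); last first.
    by rewrite /l; field; lra.
  have := hw n.+1 y; rewrite exprS -/(E y) !ler_norml.
  rewrite (_ : 2 * (K * E y) * (1 / 2 * (1 / 2) ^+ n) = K * E y * (1 / 2) ^+ n); last by field.
  rewrite (_ : K * (1 / 2) ^+ n * E y = K * E y * (1 / 2) ^+ n); last by ring.
  rewrite -[2 * (K * E y) * _]mulrA; move: (K * E y * (1 / 2) ^+ n) => z; lra.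
have eu := lim _ u F1 (fun n => (X n).1) a du _ (fun n y => (dX n y).1) (fun n => (X0 n).1) hu (fun y a b a' b' => (hL y a b a' b').1).
have ev := lim _ v F2 (fun n => (X n).2) b dv _ (fun n y => (dX n y).2) (fun n => (X0 n).2) hv (fun y a b a' b' => (hL y a b a' b').2).
rewrite !subrr !addr0 in eu ev; exists u, v; split.
- by rewrite -(eu erefl) subrr addr0.
- by rewrite -(ev erefl) subrr addr0.
- by move=> y; move: (du y); rewrite (eu erefl).
- by move=> y; move: (dv y); rewrite (ev erefl).
Qed.

End Picard.

(** * Picard iteration through the singular point *)

Section SingularPicard.
Context {R : realType}.
Implicit Types (f g w : R -> R) (x y s z M C r e nu : R).

Definition clip M x := Num.max (- M) (Num.min M x).

Lemma clip_id M x : `|x| <= M -> clip M x = x.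
Proof. by rewrite ler_norml => /andP[h1 h2]; rewrite /clip min_r // max_r. Qed.

Lemma clip_bound M x : 0 <= M -> `|clip M x| <= M.
Proof.
move=> M0; rewrite /clip ler_norml le_max lexx /= ge_max ge_min lexx /= andbT; lra.
Qed.

Lemma clip_lip M x y : `|clip M x - clip M y| <= `|x - y|.
Proof.
have n0 := normr_ge0 (x - y); have h := lexx `|x - y|.
rewrite {1}ler_norml in h; move: h => /andP[h1 h2].
rewrite /clip /Num.max /Num.min ler_norml; do ![case: ifPn]; rewrite -?leNgt => *; lra.
Qed.

Lemma clip_cont M : continuous (clip M).
Proof.
move=> x; apply/cont_ed => e e0; exists e => // y hy.
exact: le_lt_trans (clip_lip M y x) hy.
Qed.

Lemma comp_clip_cont M f : continuous f -> continuous (fun s => f (clip M s)).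
Proof.
move=> cf x; apply: (@continuous_comp _ _ _ (clip M) f); [exact: clip_cont|exact: cf].
Qed.

Definition singp n f : R -> R :=
  if pselect (continuous f) is left cf then projT1 (cid (singular_primitive n f cf)) else 0.

Lemma singpP n f : continuous f -> [/\ continuous (singp n f),
  (forall s, s != 0 -> is_derive s 1 (singp n f) ((f s - n.+1%:R / 2 * singp n f s) / s)) &
  n.+1%:R / 2 * singp n f 0 = f 0].
Proof. by move=> cf; rewrite /singp; case: pselect => // ?; case: cid. Qed.

Lemma prim_close (G1 G2 f1 f2 : R -> R) r e : 
  (forall s, `|s| <= r -> is_derive s 1 G1 (f1 s)) ->
  (forall s, `|s| <= r -> is_derive s 1 G2 (f2 s)) -> G1 0 = G2 0 ->
  (forall s, `|s| <= r -> `|f1 s - f2 s| <= e) ->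
  forall s, `|s| <= r -> `|G1 s - G2 s| <= r * e.
Proof.
move=> h1 h2 h0 he s hs; have r0 : 0 <= r by exact: le_trans hs.
have e0 : 0 <= e by have := he 0; rewrite normr0 => /(_ r0); exact: le_trans.
have hd (z : R) : `|z| <= r -> is_derive z 1 (fun y => G1 y - G2 y) (f1 z - f2 z).
  by move=> hz; apply: derB; [exact: h1|exact: h2].
move: (hs); rewrite ler_norml => /andP[s1 s2].
case: (leP 0 s) => s0.
  have ir (z : R) : 0 <= z <= s -> `|z| <= r by move=> hz; rewrite ger0_norm; lra.
  have ir' (z : R) : 0 < z < s -> `|z| <= r by move=> hz; rewrite ger0_norm; lra.
  have := der_lip _ _ e _ _ s0 (fun z hz => hd z (ir z hz)) (fun z hz => he z (ir' z hz)).
  rewrite h0 subrr !subr0 => H; apply: le_trans H _.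
  by rewrite mulrC; apply: ler_wpM2r.
have ir (z : R) : s <= z <= 0 -> `|z| <= r by move=> hz; rewrite ler0_norm; lra.
have ir' (z : R) : s < z < 0 -> `|z| <= r by move=> hz; rewrite ler0_norm; (clear -s1 hz; lra).
have := der_lip _ _ e _ _ (ltW s0) (fun z hz => hd z (ir z hz)) (fun z hz => he z (ir' z hz)).
rewrite h0 subrr sub0r normrN => H; apply: le_trans H _.
by rewrite mulrC; apply: ler_wpM2r => //; lra.
Qed.

(** In contrast with [prim_close], a short interval gains no small factor here. Contraction in $w$
    must come from a small Lipschitz constant of the right-hand side, the $1/4$ in
    [singular_picard]. *)
Lemma sing_close nu (W1 W2 f1 f2 : R -> R) r e : 1 <= nu -> 0 <= r ->
  (forall s, `|s| <= r -> {for s, continuous W1}) ->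
  (forall s, `|s| <= r -> {for s, continuous W2}) ->
  (forall s, `|s| <= r -> s != 0 -> is_derive s 1 W1 ((f1 s - nu * W1 s) / s)) ->
  (forall s, `|s| <= r -> s != 0 -> is_derive s 1 W2 ((f2 s - nu * W2 s) / s)) ->
  nu * W1 0 = f1 0 -> nu * W2 0 = f2 0 ->
  (forall s, `|s| <= r -> `|f1 s - f2 s| <= e) ->
  forall s, `|s| <= r -> `|W1 s - W2 s| <= e.
Proof.
move=> nu1 r0 c1 c2 d1 d2 e1 e2 he s hs.
apply: (@le_trans _ _ (nu * `|W1 s - W2 s|)); first by rewrite ler_peMl.
have nu0 : 0 < nu by lra.
apply: (singular_bound nu (fun s => W1 s - W2 s) (fun s => f1 s - f2 s) e r) => //.
- by apply: der_withincont => x xr; apply: cvgB; [apply: c1|apply: c2]; rewrite ler_norml.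
- move=> z hz z0; apply: der_eq (derB _ _ _ _ _ _ (d1 z hz z0) (d2 z hz z0)) _.
  by field.
- by rewrite mulrBr e1 e2.
Qed.

Definition sing_sol n (a b : R -> R -> R -> R) s0 g w := [/\
  (forall s, `|s| <= s0 -> {for s, continuous w}), g 0 = 1,
  (forall s, `|s| <= s0 -> is_derive s 1 g (a s (g s) (w s))),
  (forall s, `|s| <= s0 -> s != 0 ->
     is_derive s 1 w ((b s (g s) (w s) - n.+1%:R / 2 * w s) / s)) &
  n.+1%:R / 2 * w 0 = b 0 (g 0) (w 0)].

Theorem singular_picard n (a b : R -> R -> R -> R) s0 C M :
  (0 < n)%N -> 0 < s0 -> 1 <= C -> 0 <= M -> s0 * (16 * C ^+ 2) <= 1 ->
  (forall g w, continuous g -> continuous w ->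
     continuous (fun s => a s (g s) (w s)) /\ continuous (fun s => b s (g s) (w s))) ->
  (forall s x y, `|a s x y| <= M /\ `|b s x y| <= M) ->
  (forall s x y x' y', `|s| <= s0 ->
     `|a s x y - a s x' y'| <= C * (`|x - x'| + `|y - y'|) /\
     `|b s x y - b s x' y'| <= C * `|x - x'| + 1 / 4 * `|y - y'|) ->
  exists g w, sing_sol n a b s0 g w.
Proof.
move=> n0 s00 C1 M0 sC hc hM hL.
set nu := n.+1%:R / 2 : R.
have nu1 : 1 <= nu.
  have : (2 : R) <= n.+1%:R by rewrite ler_nat.
  by rewrite /nu; lra.
have CC : 1 <= C ^+ 2 by rewrite expr2; nra.
have s01 : s0 <= 1 by nra.
have sC1 : s0 * C <= 1 / 16 by nra.
(* The iterates live on the whole line, but the Lipschitz bounds hold only for $|s|\le s_0$;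
   outside, the arguments are frozen at the end points, and the equations are claimed only
   inside. *)
pose A (X : (R -> R) * (R -> R)) s := a s (X.1 (clip s0 s)) (X.2 (clip s0 s)).
pose B (X : (R -> R) * (R -> R)) s := b s (X.1 (clip s0 s)) (X.2 (clip s0 s)).
have hAB X : continuous X.1 -> continuous X.2 -> continuous (A X) /\ continuous (B X).
  by move=> c1 c2; apply: (hc (fun s => X.1 (clip s0 s)) (fun s => X.2 (clip s0 s)));
    exact: comp_clip_cont.
pose T X : (R -> R) * (R -> R) := (fun s => 1 + (prim (A X) s - prim (A X) 0), singp n (B X)).
pose X k := iter k T (fun _ => 1, fun _ => 0).
have TP Y : continuous Y.1 -> continuous Y.2 -> [/\ continuous (T Y).1, continuous (T Y).2,
    (T Y).1 0 = 1, forall s, is_derive s 1 (T Y).1 (A Y s) &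
    (forall s, s != 0 -> is_derive s 1 (T Y).2 ((B Y s - nu * (T Y).2 s) / s)) /\
    nu * (T Y).2 0 = B Y 0].
  move=> c1 c2; have [k1 k2] := hAB Y c1 c2; have [p1 p2 p3] := singpP n _ k2.
  split=> //; last exact: (prim_from 1 0 _ k1).
  - by move=> s; apply: der_cont (prim_from 1 0 _ k1 s).
  - by rewrite /= subrr addr0.
have cX k : continuous (X k).1 /\ continuous (X k).2.
  elim: k => [|k [c1 c2]]; first by split=> x; exact: cvg_cst.
  by case: (TP _ c1 c2).
have clip0 s : `|s| <= s0 -> clip s0 s = s by exact: clip_id.
(* The weights of the two components are 1 and $4C$. For $w$ the new error is $C+\frac14\cdot4C=2C$,
   half of $4C$; for $g$ it is $s_0(C+4C^2)\le1/2$ by the smallness of [s0]. *)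
have step k : forall s, `|s| <= s0 ->
   `|(X k.+1).1 s - (X k).1 s| <= M * (1 / 2) ^+ k /\
   `|(X k.+1).2 s - (X k).2 s| <= 4 * C * M * (1 / 2) ^+ k.
  elim: k => [|k IH] s hs.
    rewrite expr0 !mulr1.
    have [c1 c2] := cX 0%N; have [t1 t2 t3 t4 [t5 t6]] := TP _ c1 c2; split.
      apply: le_trans (_ : s0 * M <= M); last by rewrite ler_piMl.
      apply: (prim_close (T (X 0%N)).1 (fun _ => 1) (A (X 0%N)) (fun _ => 0)) hs => // z hz.
      by rewrite subr0; case: (hM z ((X 0%N).1 (clip s0 z)) ((X 0%N).2 (clip s0 z))).
    apply: le_trans (_ : M <= _); last by (clear -C1 M0; nra).
    apply: (sing_close nu (T (X 0%N)).2 (fun _ => 0) (B (X 0%N)) (fun _ => 0) s0) => //.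
    - exact: ltW.
    - by move=> z _; exact: t2.
    - by move=> z _; exact: cvg_cst.
    - by move=> z _ z0; apply: der_eq (der_cst _ _ _) _; rewrite mulr0 subr0 mul0r.
    - by rewrite mulr0.
    - by move=> z hz; rewrite subr0; case: (hM z ((X 0%N).1 (clip s0 z)) ((X 0%N).2 (clip s0 z))).
  have q0 : 0 <= (1 / 2 : R) ^+ k by rewrite exprn_ge0 //; lra.
  rewrite exprS; set q := (1 / 2) ^+ k in IH q0 *.
  have Mq : 0 <= M * q by exact: mulr_ge0.
  have [c1 c2] := cX k; have [t1 t2 t3 t4 [t5 t6]] := TP _ c1 c2.
  have [c1' c2'] := cX k.+1; have [t1' t2' t3' t4' [t5' t6']] := TP _ c1' c2'.
  split.
    apply: le_trans (_ : s0 * (C * (M * q + 4 * C * M * q)) <= _); last first.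
      rewrite [leLHS](_ : _ = (s0 * C + 4 * (s0 * C ^+ 2)) * (M * q)); last by ring.
      rewrite [leRHS](_ : _ = 1 / 2 * (M * q)); last by ring.
      by apply: ler_wpM2r => //; (clear -sC sC1; lra).
    apply: (prim_close (T (X k.+1)).1 (T (X k)).1 (A (X k.+1)) (A (X k))) hs => //.
      by rewrite t3.
    move=> z hz; apply: le_trans (hL _ _ _ _ _ hz).1 _; rewrite !clip0 //.
    have [i1 i2] := IH z hz; apply: ler_wpM2l; (clear -C1 A B T X i1 i2; lra).
  apply: (sing_close nu (T (X k.+1)).2 (T (X k)).2 (B (X k.+1)) (B (X k)) s0) => //.
  - exact: ltW.
  - by move=> z _; exact: t2'.
  - by move=> z _; exact: t2.
  - move=> z hz; apply: le_trans (hL _ _ _ _ _ hz).2 _; rewrite !clip0 //.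
    have [i1 i2] := IH z hz.
    have : C * `|(X k.+1).1 z - (X k).1 z| <= C * (M * q) by apply: ler_wpM2l => //; (clear -C1; lra).
    rewrite (_ : 4 * C * M * (1 / 2 * q) = 2 * (C * (M * q))); last by field.
    rewrite (_ : 4 * C * M * q = 4 * (C * (M * q))) in i2; last by field.
    by move: i2; move: (C * (M * q)) => c i2; (clear -A B T X i2; lra).
have clipn s : `|clip s0 s| <= s0 by apply: clip_bound; exact: ltW.
have [u hu] := geometric_limit (fun k s => (X k).1 (clip s0 s)) (fun _ => M) (fun k s => (step k _ (clipn s)).1).
have [v hv] := geometric_limit (fun k s => (X k).2 (clip s0 s)) (fun _ => 4 * C * M) (fun k s => (step k _ (clipn s)).2).
have lb (K x : R) : exists d M : R, 0 < d /\ forall y : R, `|y - x| < d -> K <= M by exists 1, K.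
have cu : continuous u.
  by apply: (geometric_limit_cont _ _ _ hu) => [k|x]; [apply: comp_clip_cont; case: (cX k) | exact: lb].
have cv : continuous v.
  by apply: (geometric_limit_cont _ _ _ hv) => [k|x]; [apply: comp_clip_cont; case: (cX k) | exact: lb].
have [t1 t2 t3 t4 [t5 t6]] := TP (u, v) cu cv.
have cu' k s : `|s| <= s0 -> `|u s - (X k).1 s| <= 2 * M * (1 / 2) ^+ k.
  by move=> hs; have := hu k s; rewrite clip0.
have cv' k s : `|s| <= s0 -> `|v s - (X k).2 s| <= 2 * (4 * C * M) * (1 / 2) ^+ k.
  by move=> hs; have := hv k s; rewrite clip0.
have eu s : `|s| <= s0 -> (T (u, v)).1 s = u s.
  move=> hs; apply: (eq_of_half_pow _ _ (s0 * (C * (2 * M + 2 * (4 * C * M))) + M)) => k.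
  have [c1 c2] := cX k; have [t1' t2' t3' t4' [t5' t6']] := TP _ c1 c2.
  apply: le_trans (ler_distD ((X k.+1).1 s) _ _) _; rewrite mulrDl; apply: lerD; last first.
    by rewrite distrC; apply: le_trans (cu' _ _ hs) _; rewrite exprS; have := normr_ge0 (u s - (X k.+1).1 s); (clear -A B T X; lra).
  rewrite -[leRHS]mulrA; apply: (prim_close (T (u, v)).1 (T (X k)).1 (A (u, v)) (A (X k))) hs => //.
    by rewrite t3.
  move=> z hz; apply: le_trans (hL _ _ _ _ _ hz).1 _; rewrite !clip0 //= -[leRHS]mulrA.
  by have := cu' k z hz; have := cv' k z hz; rewrite ler_pM2l; (clear -A B T X C1; lra).
have ev s : `|s| <= s0 -> (T (u, v)).2 s = v s.
  move=> hs; apply: (eq_of_half_pow _ _ (C * (2 * M) + 2 * C * M + 4 * C * M)) => k.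
  have [c1 c2] := cX k; have [t1' t2' t3' t4' [t5' t6']] := TP _ c1 c2.
  apply: le_trans (ler_distD ((X k.+1).2 s) _ _) _; rewrite mulrDl; apply: lerD; last first.
    by rewrite distrC; apply: le_trans (cv' _ _ hs) _; rewrite exprS; (clear -R; lra).
  apply: (sing_close nu (T (u, v)).2 (T (X k)).2 (B (u, v)) (B (X k)) s0) => //.
  - exact: ltW.
  - by move=> z _; exact: t2.
  - by move=> z _; exact: t2'.
  - move=> z hz; apply: le_trans (hL _ _ _ _ _ hz).2 _; rewrite !clip0 //=.
    have h2 := cv' k z hz.
    have h1 : C * `|u z - (X k).1 z| <= C * (2 * M * (1 / 2) ^+ k).
      by apply: ler_wpM2l; [(clear -C1; lra)|exact: cu'].
    by move: h1 h2; (clear -A B T X; lra).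
exists (T (u, v)).1, (T (u, v)).2; split=> //.
- by move=> s _; exact: t2.
- by move=> s hs; rewrite eu // ev //; move: (t4 s); rewrite /A /= clip0.
- by move=> s hs z0; rewrite eu // {1}ev //; move: (t5 s z0); rewrite /B /= clip0.
- have h0 : `|0 : R| <= s0 by rewrite normr0 ltW.
  by rewrite eu // [in RHS]ev // t6 /B /= clip0.
Qed.

(** The maximal differences [al] of $g$ and [be] of $w$ satisfy $al\le s_0C(al+be)$ and $be\le
    C\,al+be/4+e$. Eliminating [be] and absorbing [al] by the smallness of $s_0C^2$ bounds both by
    multiples of [e]. Only [b] is perturbed, because the family parameter enters only there. *)
Lemma sing_sol_close n (a b b' : R -> R -> R -> R) s0 C e g w g' w' :
  (0 < n)%N -> 0 < s0 -> 1 <= C -> s0 * (16 * C ^+ 2) <= 1 ->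
  (forall s x y x' y', `|s| <= s0 ->
     `|a s x y - a s x' y'| <= C * (`|x - x'| + `|y - y'|) /\
     `|b s x y - b s x' y'| <= C * `|x - x'| + 1 / 4 * `|y - y'|) ->
  (forall s x y, `|s| <= s0 -> `|b s x y - b' s x y| <= e) ->
  sing_sol n a b s0 g w -> sing_sol n a b' s0 g' w' ->
  forall s, `|s| <= s0 -> `|g s - g' s| <= e /\ `|w s - w' s| <= 2 * C * e.
Proof.
move=> n0 s00 C1 sC hL hb [cw g0 dg dw w0] [cw' g0' dg' dw' w0'].
set nu := n.+1%:R / 2 : R in dw dw' w0 w0'.
have nu1 : 1 <= nu.
  have : (2 : R) <= n.+1%:R by rewrite ler_nat.
  by rewrite /nu; lra.
have CC : 1 <= C ^+ 2 by rewrite expr2; nra.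
have sC1 : s0 * C <= 1 / 16 by (clear -C1 sC; nra).
have ss : - s0 <= s0 by (clear -s00; lra).
have cg s : `|s| <= s0 -> {for s, continuous g} by move=> hs; apply: der_cont (dg s hs).
have cg' s : `|s| <= s0 -> {for s, continuous g'} by move=> hs; apply: der_cont (dg' s hs).
have [c1 /[!in_itv]/= i1 m1] := EVT_max (f := fun s => `|g s - g' s|) ss
  (der_withincont _ _ _ (fun s hs => cvg_norm (cvgB (cg s (eq_ind_r is_true hs (ler_norml s s0))) (cg' s (eq_ind_r is_true hs (ler_norml s s0)))))).
have [c2 /[!in_itv]/= i2 m2] := EVT_max (f := fun s => `|w s - w' s|) ss
  (der_withincont _ _ _ (fun s hs => cvg_norm (cvgB (cw s (eq_ind_r is_true hs (ler_norml s s0))) (cw' s (eq_ind_r is_true hs (ler_norml s s0)))))).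
rewrite -ler_norml in i1; rewrite -ler_norml in i2.
set al := `|g c1 - g' c1|; set be := `|w c2 - w' c2|.
have ha z : `|z| <= s0 -> `|g z - g' z| <= al by move=> hz; apply: m1; rewrite in_itv /= -ler_norml.
have hbe z : `|z| <= s0 -> `|w z - w' z| <= be by move=> hz; apply: m2; rewrite in_itv /= -ler_norml.
have al0 : 0 <= al := normr_ge0 _; have be0 : 0 <= be := normr_ge0 _.
have e0 : 0 <= e by have := hb 0 0 0; rewrite normr0 => /(_ (ltW s00)); exact: le_trans.
have k1 : al <= s0 * (C * (al + be)).
  apply: (prim_close g g' (fun s => a s (g s) (w s)) (fun s => a s (g' s) (w' s)) s0 _ dg dg') => //.
    by rewrite g0.
  move=> z hz; apply: le_trans (hL _ _ _ _ _ hz).1 _; apply: ler_wpM2l; first by (clear -C1; lra).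
  by apply: lerD; [exact: ha|exact: hbe].
have k2 : be <= C * al + 1 / 4 * be + e.
  apply: (sing_close nu w w' (fun s => b s (g s) (w s)) (fun s => b' s (g' s) (w' s)) s0) => //.
    exact: ltW.
  move=> z hz; apply: le_trans (ler_distD (b z (g' z) (w' z)) _ _) _.
  apply: lerD; last exact: hb.
  apply: le_trans (hL _ _ _ _ _ hz).2 _; apply: lerD; last by apply: ler_wpM2l; [(clear -R; lra)|exact: hbe].
  by apply: ler_wpM2l; [(clear -C1; lra)|exact: ha].
have k3 : al <= e / 4.
  have : s0 * (C * (al + be)) <= s0 * C * (al + 4 / 3 * (C * al) + 4 / 3 * e).
    by rewrite mulrA; apply: ler_wpM2l; [apply: mulr_ge0; (clear -s00 C1; lra)|(clear -g' w' c1 c2 k2; lra)].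
  rewrite (_ : s0 * C * (_ + _) = (s0 * C) * (al + 4 / 3 * e) + 4 / 3 * (s0 * C ^+ 2 * al)); last by ring.
  have : (s0 * C) * (al + 4 / 3 * e) <= 1 / 16 * (al + 4 / 3 * e) by apply: ler_wpM2r; (clear -g' c1 al0 e0 sC1; lra).
  have : s0 * C ^+ 2 * al <= 1 / 16 * al by apply: ler_wpM2r; (clear -g' c1 al0 sC; lra).
  by (clear -g' w' c1 c2 al0 k1; lra).
move=> s hs; split; first by apply: le_trans (ha s hs) _; (clear -g' c1 al0 k3; lra).
apply: le_trans (hbe s hs) _.
have : C * al <= C * (e / 4) by apply: ler_wpM2l; (clear -C1 g' c1 k3; lra).
have : e <= C * e by rewrite ler_peMl.
(clear -g' w' c1 c2 be0 k2; lra).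
Qed.

End SingularPicard.

(** * Regular solutions at the pole *)

Section LocalSolution.
Context {R : realType}.
Implicit Types (e s g w x y M al be : R).

(* The factor [s0] in front of [`|y - y'|] is what makes the Picard map contract for small [s0]. *)
Definition tame (r : R) (f : R -> R -> R -> R -> R) := exists2 M, 0 <= M &
  (forall e s x y, 0 <= e <= 1 -> `|f e s x y| <= M) /\
  (forall s0 s e x y e' x' y', 0 < s0 <= r -> `|s| <= s0 -> 0 <= e <= 1 -> 0 <= e' <= 1 ->
     `|f e s x y - f e' s x' y'| <= M * (`|e - e'| + `|x - x'| + s0 * `|y - y'|)).

Let dist_ge0 s0 e x y e' x' y' : 0 < s0 -> 0 <= `|e - e'| + `|x - x'| + s0 * `|y - y'|.
Proof. by move=> s00; rewrite !addr_ge0 // mulr_ge0 // ltW. Qed.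

Lemma tame_cst r c : tame r (fun _ _ _ _ => c).
Proof.
exists `|c| => //; split=> // s0 s e x y e' x' y' /andP[s00 _] _ _ _.
by rewrite subrr normr0 mulr_ge0 // dist_ge0.
Qed.

Lemma tameD r f h : tame r f -> tame r h -> tame r (fun e s x y => f e s x y + h e s x y).
Proof.
move=> [M M0 [b l]] [N N0 [b' l']]; exists (M + N); first exact: addr_ge0.
split=> [e s x y he|s0 s e x y e' x' y' h0 hs he he'].
  by apply: le_trans (ler_normD _ _) _; apply: lerD; auto.
rewrite mulrDl opprD addrACA; apply: le_trans (ler_normD _ _) _; apply: lerD; auto.
Qed.

Lemma tameN r f : tame r f -> tame r (fun e s x y => - f e s x y).
Proof.
move=> [M M0 [b l]]; exists M => //; split=> [e s x y he|s0 s e x y e' x' y' h0 hs he he'].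
  by rewrite normrN; auto.
by rewrite -opprD normrN; auto.
Qed.

Lemma tameM r f h : tame r f -> tame r h -> tame r (fun e s x y => f e s x y * h e s x y).
Proof.
move=> [M M0 [b l]] [N N0 [b' l']]; exists (2 * (M * N)); first by rewrite !mulr_ge0.
have MN : 0 <= M * N by exact: mulr_ge0.
split=> [e s x y he|s0 s e x y e' x' y' h0 hs he he'].
  by rewrite normrM; apply: le_trans (ler_pM _ _ (b e s x y he) (b' e s x y he)) _ => //; lra.
rewrite (_ : _ - _ = f e s x y * (h e s x y - h e' s x' y') + h e' s x' y' * (f e s x y - f e' s x' y')); last by ring.
have [s00 _] := andP h0.
have d0 := dist_ge0 s0 e x y e' x' y' s00.
apply: le_trans (ler_normD _ _) _; rewrite !normrM.
have h1 := ler_pM (normr_ge0 _) (normr_ge0 _) (b e s x y he) (l' _ _ _ x y _ x' y' h0 hs he he').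
have h2 := ler_pM (normr_ge0 _) (normr_ge0 _) (b' e' s x' y' he') (l _ _ _ x y _ x' y' h0 hs he he').
apply: le_trans (lerD h1 h2) _; rewrite le_eqVlt; apply/orP; left; apply/eqP; ring.
Qed.

Lemma tameV r m f : 0 < m -> (forall e s x y, 0 <= e <= 1 -> m <= f e s x y) ->
  tame r f -> tame r (fun e s x y => (f e s x y)^-1).
Proof.
move=> m0 hm [M M0 [b l]].
have im : 0 < m^-1 by rewrite invr_gt0.
exists (m^-1 + M * (m^-1 * m^-1)); first by rewrite addr_ge0 ?mulr_ge0 // ltW.
have fp e s x y : 0 <= e <= 1 -> 0 < f e s x y by move=> he; apply: lt_le_trans m0 (hm _ _ _ _ he).
have fi e s x y : 0 <= e <= 1 -> (f e s x y)^-1 <= m^-1.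
  by move=> he; rewrite lef_pV2 ?posrE // ?hm // fp.
have M1 : 0 <= M * (m^-1 * m^-1) by rewrite !mulr_ge0 // ltW.
split=> [e s x y he|s0 s e x y e' x' y' h0 hs he he'].
  rewrite ger0_norm; last by rewrite invr_ge0 ltW // fp.
  by apply: le_trans (fi _ _ _ _ he) _; lra.
have [s00 _] := andP h0.
have d0 := dist_ge0 s0 e x y e' x' y' s00.
have p1 := fp e s x y he; have p2 := fp e' s x' y' he'.
rewrite (_ : _ - _ = - (f e s x y - f e' s x' y') * ((f e s x y)^-1 * (f e' s x' y')^-1)); last first.
  by field; rewrite !gt_eqF.
rewrite normrM normrN [`|_ * _^-1|]ger0_norm; last by rewrite mulr_ge0 // invr_ge0 ltW.
have h2 : (f e s x y)^-1 * (f e' s x' y')^-1 <= m^-1 * m^-1.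
  by apply: ler_pM; [rewrite invr_ge0 ltW|rewrite invr_ge0 ltW|exact: fi|exact: fi].
have i0 : 0 <= (f e s x y)^-1 * (f e' s x' y')^-1 by rewrite mulr_ge0 // invr_ge0 ltW.
have := ler_pM (normr_ge0 _) i0 (l _ _ _ x y _ x' y' h0 hs he he') h2.
move=> /le_trans; apply; rewrite mulrDl mulrAC -[leLHS]add0r.
by apply: lerD => //; rewrite mulr_ge0 // ltW.
Qed.

Lemma tame_eps r : tame r (fun e _ _ _ => e).
Proof.
exists 1 => //; split=> [e s x y /andP[e0 e1]|s0 s e x y e' x' y' /andP[s00 _] _ _ _].
  by rewrite ger0_norm.
rewrite mul1r -addrA lerDl addr_ge0 // mulr_ge0 // ltW //.
Qed.

Lemma tame_s r : 0 <= r -> tame r (fun _ s _ _ => clip r s).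
Proof.
move=> r0; exists r => //; split=> [e s x y _|s0 s e x y e' x' y' /andP[s00 _] _ _ _].
  exact: clip_bound.
by rewrite subrr normr0 mulr_ge0 // dist_ge0.
Qed.

Definition gclip (x : R) : R := 1 + clip (1 / 2) (x - 1).

Lemma gclip_bound x : 1 / 2 <= gclip x <= 3 / 2.
Proof.
by have := clip_bound (1 / 2) (x - 1); rewrite ler_norml /gclip => /(_ _) h; have := h ltac:(lra); lra.
Qed.

Lemma tame_g r : tame r (fun _ _ x _ => gclip x).
Proof.
exists 2 => //; split=> [e s x y _|s0 s e x y e' x' y' /andP[s00 _] _ _ _].
  by have := gclip_bound x; move=> ?; rewrite ger0_norm; lra.
rewrite /gclip opprD addrACA subrr add0r; apply: le_trans (clip_lip _ _ _) _.
rewrite opprD addrACA addrN addr0.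
have : 0 <= s0 * `|y - y'| by rewrite mulr_ge0 // ltW.
by have := normr_ge0 (x - x'); have := normr_ge0 (e - e'); lra.
Qed.

Lemma clip_small r s0 s : 0 < s0 <= r -> `|s| <= s0 -> clip r s = s.
Proof. by move=> /andP[_ h] h'; apply: clip_id; apply: le_trans h' h. Qed.

(** In the right-hand side [y] occurs only through $sy$ and $sy^2$. This lemma and [tame_sww] turn
    that factor $s$ into a Lipschitz constant proportional to [s0]. *)
Lemma tame_sw r B : 0 <= r -> 0 <= B -> tame r (fun _ s _ y => clip r s * clip B y).
Proof.
move=> r0 B0; exists (1 + r * B); first by rewrite addr_ge0 // mulr_ge0.
have rB : 0 <= r * B by exact: mulr_ge0.
split=> [e s x y _|s0 s e x y e' x' y' h0 hs _ _].
  rewrite normrM; apply: le_trans (ler_pM (normr_ge0 _) (normr_ge0 _) (clip_bound _ s r0) (clip_bound _ y B0)) _; lra.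
rewrite (clip_small _ _ _ h0 hs) -mulrBr normrM; have /andP[s00 _] := h0.
apply: le_trans (ler_pM (normr_ge0 _) (normr_ge0 _) hs (clip_lip B y y')) _.
have := normr_ge0 (x - x'); have := normr_ge0 (e - e').
have : 0 <= s0 * `|y - y'| by rewrite mulr_ge0 // ltW.
by nra.
Qed.

Lemma tame_sww r B : 0 <= r -> 0 <= B -> tame r (fun _ s _ y => clip r s * (clip B y * clip B y)).
Proof.
move=> r0 B0; exists (2 * B + r * (B * B)); first by rewrite addr_ge0 // !mulr_ge0.
have rB : 0 <= r * (B * B) by rewrite !mulr_ge0.
split=> [e s x y _|s0 s e x y e' x' y' h0 hs _ _].
  have cb := clip_bound _ y B0.
  rewrite !normrM; apply: le_trans (ler_pM (normr_ge0 _) _ (clip_bound _ s r0) (ler_pM (normr_ge0 _) (normr_ge0 _) cb cb)) _; last lra.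
  by rewrite mulr_ge0.
rewrite (clip_small _ _ _ h0 hs) -mulrBr normrM; have /andP[s00 _] := h0.
have -> : clip B y * clip B y - clip B y' * clip B y' = (clip B y + clip B y') * (clip B y - clip B y') by ring.
have h2 : `|clip B y + clip B y'| <= 2 * B.
  apply: le_trans (ler_normD _ _) _; have := clip_bound _ y B0; have := clip_bound _ y' B0; lra.
rewrite normrM.
have h3 := ler_pM (normr_ge0 _) (normr_ge0 _) h2 (clip_lip B y y').
have h4 := ler_pM (normr_ge0 _) (mulr_ge0 (normr_ge0 _) (normr_ge0 _)) hs h3.
apply: (le_trans h4).
have := normr_ge0 (x - x'); have := normr_ge0 (e - e').
have : 0 <= s0 * `|y - y'| by rewrite mulr_ge0 // ltW.
set d := `|y - y'|; set d1 := `|x - x'|; set d2 := `|e - e'| => k1 k2 k3.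
rewrite (_ : s0 * (2 * B * d) = 2 * B * (s0 * d)); last by ring.
have : 0 <= B * (d2 + d1) by apply: mulr_ge0 => //; lra.
have : 0 <= r * (B * B) * (d2 + d1 + s0 * d) by apply: mulr_ge0 => //; lra.
lra.
Qed.

(* [w] is the difference quotient [(v - 1) / s], where [v] is the logarithmic
   derivative of [tan (r / 2)] and [s] the rescaled square of [tan (t / 2)]. *)
Definition singular_rhs al be e s g w :=
  let v := 1 + s * w in
  - (1 / 2) * (s * (w * w)) * ((be * (v * v) - al * (be - 1) * v + al) * (al + be * (v * v))^-1) +
  (al + v * v) * (al + be * (v * v))^-1 *
  (- ((al - be * (v * v)) * (g * g) * (1 + s * (g * g))^-1) +
   (al - be) * v * e * (1 + e * s)^-1).

(** Self-consistent level: with $w$ truncated at [sr_bound] and $s$ at [sr_radius], the right-hand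
    side is again at most [sr_bound]. By [singular_bound] with $\nu\ge1$ so is $|w|$, and the
    truncation disappears. The radius makes $|sw|$ and $|sw^2|$ at most $1/8$, which keeps the
    denominators away from 0. *)
Definition sr_bound al be := 3 + be + 21 * al.
Definition sr_radius al be := (8 * sr_bound al be ^+ 2)^-1.

Section PoleEstimates.
Context (al be : R).

Let B := sr_bound al be.
Let r := sr_radius al be.

Lemma sr_bound_ge : 1 <= be -> be < al -> 24 <= B. Proof. by rewrite /B /sr_bound => *; lra. Qed.

Lemma sr_radius_facts (be1 : 1 <= be) (albe : be < al) : [/\ 0 < r, r <= 1 / 8, r * B <= 1 / 8 & r * (B * B) <= 1 / 8].
Proof.
have B24 := sr_bound_ge be1 albe.
have B2 : 0 < 8 * B ^+ 2 by rewrite mulr_gt0 // exprn_gt0 //; lra.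
have r0 : 0 < r by rewrite invr_gt0.
have e : r * (B * B) = 1 / 8.
  by rewrite /r /sr_radius -/B; field; lra.
by split=> //; nra.
Qed.

Definition trunc_rhs e s x y := singular_rhs al be e (clip r s) (gclip x) (clip B y).

Let v (s y : R) : R := 1 + clip r s * clip B y.

Lemma trunc_v s y (be1 : 1 <= be) (albe : be < al) : 7 / 8 <= v s y <= 9 / 8.
Proof.
have [r0 r1 r2 r3] := sr_radius_facts be1 albe; have B24 := sr_bound_ge be1 albe.
have : `|clip r s * clip B y| <= r * B.
  by rewrite normrM; apply: ler_pM => //; apply: clip_bound; lra.
by rewrite ler_norml /v; lra.
Qed.

Lemma trunc_D s y (be1 : 1 <= be) (albe : be < al) : al <= al + be * (v s y * v s y).
Proof. by rewrite lerDl mulr_ge0 ?sqr_ge0 //; lra. Qed.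

Lemma trunc_den1 s x (be1 : 1 <= be) (albe : be < al) : 1 / 2 <= 1 + clip r s * (gclip x * gclip x).
Proof.
have [r0 r1 _ _] := sr_radius_facts be1 albe; have hg := gclip_bound x.
have : `|clip r s * (gclip x * gclip x)| <= 1 / 8 * (9 / 4).
  rewrite normrM; apply: ler_pM => //; last by rewrite ger0_norm; nra.
  by apply: le_trans (clip_bound _ _ _) _ => //; lra.
by rewrite ler_norml; lra.
Qed.

Lemma trunc_den2 e s (be1 : 1 <= be) (albe : be < al) : 0 <= e <= 1 -> 1 / 2 <= 1 + e * clip r s.
Proof.
have [r0 r1 _ _] := sr_radius_facts be1 albe => he.
have : `|clip r s| <= r by apply: clip_bound; lra.
rewrite ler_norml; nra.
Qed.

Lemma trunc_tame (be1 : 1 <= be) (albe : be < al) : tame r trunc_rhs.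
Proof.
have [r0 r1 r2 r3] := sr_radius_facts be1 albe; have B24 := sr_bound_ge be1 albe.
have r0' := ltW r0; have B0 : 0 <= B by lra.
have tv : tame r (fun _ s _ y => v s y) by apply: tameD; [exact: tame_cst|exact: tame_sw].
have tvv : tame r (fun _ s _ y => v s y * v s y) by exact: tameM.
have tg := tame_g r.
have tgg : tame r (fun _ _ x _ => gclip x * gclip x) by exact: (tameM _ _ _ tg tg).
have c c0 : tame r (fun _ _ _ _ => c0) by exact: tame_cst.
have tD : tame r (fun _ s _ y => (al + be * (v s y * v s y))^-1).
  apply: (tameV r al) => [|e s x y _|]; [by lra|exact: trunc_D|].
  exact: (tameD _ _ _ (c _) (tameM _ _ _ (c _) tvv)).
have ts := tame_s r r0'.
have t1 : tame r (fun _ s x _ => (1 + clip r s * (gclip x * gclip x))^-1).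
  apply: (tameV r (1 / 2)) => [|e s x y _|]; [by lra|exact: trunc_den1|].
  exact: (tameD _ _ _ (c _) (tameM _ _ _ ts tgg)).
have t2 : tame r (fun e s _ _ => (1 + e * clip r s)^-1).
  apply: (tameV r (1 / 2)) => [|e s x y he|]; [by lra|exact: trunc_den2|].
  exact: (tameD _ _ _ (c _) (tameM _ _ _ (tame_eps r) ts)).
have tJ : tame r (fun _ s _ y => be * (v s y * v s y) - al * (be - 1) * v s y + al).
  exact: (tameD _ _ _ (tameD _ _ _ (tameM _ _ _ (c _) tvv) (tameN _ _ (tameM _ _ _ (c _) tv))) (c _)).
apply: tameD.
  exact: (tameM _ _ _ (tameM _ _ _ (c _) (tame_sww r B r0' B0)) (tameM _ _ _ tJ tD)).
apply: tameM; first exact: (tameM _ _ _ (tameD _ _ _ (c _) tvv) tD).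
apply: tameD.
  apply: tameN; apply: (tameM _ _ _ _ t1); apply: (tameM _ _ _ _ tgg).
  exact: (tameD _ _ _ (c _) (tameN _ _ (tameM _ _ _ (c _) tvv))).
apply: (tameM _ _ _ _ t2); apply: (tameM _ _ _ _ (tame_eps r)); exact: (tameM _ _ _ (c _) tv).
Qed.

Lemma trunc_rhs_bound e s x y (be1 : 1 <= be) (albe : be < al) : 0 <= e <= 1 -> `|trunc_rhs e s x y| <= B.
Proof.
move=> he; have [r0 r1 r2 r3] := sr_radius_facts be1 albe; have B24 := sr_bound_ge be1 albe.
have hv := trunc_v s y be1 albe; have hD := trunc_D s y be1 albe; have h1 := trunc_den1 s x be1 albe.
have h2 := trunc_den2 e s be1 albe he; have hg := gclip_bound x.
have hw : `|clip r s * (clip B y * clip B y)| <= 1 / 8.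
  apply: le_trans r3; rewrite !normrM; apply: ler_pM => //.
    by apply: clip_bound; lra.
  by apply: ler_pM => //; apply: clip_bound; lra.
rewrite /trunc_rhs /singular_rhs -/(v s y).
move: (v s y) hv hD => V0 hv hD; move: (gclip x) h1 hg => g h1 hg.
move: (clip r s * (clip B y * clip B y)) hw => z hz.
set D1 := 1 + _ * (g * g) in h1 *; set D2 := 1 + e * _ in h2 *.
have vv : 3 / 4 <= V0 * V0 <= 4 / 3 by nra.
have i1 : 0 < D1^-1 <= 2.
  by rewrite invr_gt0 (lt_le_trans _ h1) // -(@invrK _ 2) lef_pV2 ?posrE ?invr_gt0 //; (clear -dist_ge0 al be B r v s g D1 h1; lra).
have i2 : 0 < D2^-1 <= 2.
  by rewrite invr_gt0 (lt_le_trans _ h2) // -(@invrK _ 2) lef_pV2 ?posrE ?invr_gt0 //; (clear -dist_ge0 al be B r v e s D2 h2; lra).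
have D0 : 0 < al + be * (V0 * V0) by lra.
apply: le_trans (ler_normD _ _) _.
have T1 : `|(be * (V0 * V0) - al * (be - 1) * V0 + al) / (al + be * (V0 * V0))| <= 5 + 2 * be.
  rewrite normrM normfV (gtr0_norm D0) ler_pdivrMr // ler_norml.
  have P0 : 0 <= al * (be - 1) * V0 by rewrite !mulr_ge0 //; (clear -dist_ge0 al be B r v be1 albe V0 hv; lra).
  have P1 : al * (be - 1) * V0 <= al * (be - 1) * (9 / 8) by apply: ler_wpM2l; [apply: mulr_ge0|]; (clear -dist_ge0 al be B r v be1 albe V0 hv; lra).
  have Y0 : 0 <= be * (V0 * V0) by apply: mulr_ge0; (clear -dist_ge0 al be B r v be1 V0 vv; lra).
  have Y1 : 0 <= be * (be * (V0 * V0)) by apply: mulr_ge0; (clear -dist_ge0 al be B r v be1 V0 hD; lra).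
  have X0 : 0 <= al * be by apply: mulr_ge0; (clear -dist_ge0 al be B r v be1 albe; lra).
  move: (be * (V0 * V0)) (al * (be - 1) * V0) P0 P1 Y0 Y1 => Y P P0 P1 Y0 Y1.
  rewrite (_ : (5 + 2 * be) * (al + Y) = 5 * al + 5 * Y + 2 * (al * be) + 2 * (be * Y)); last by ring.
  rewrite (_ : al * (be - 1) * _ = 9 / 8 * (al * be) - 9 / 8 * al) in P1; last by field.
  by move: (al * be) (be * Y) X0 Y1 P1 => X Z X0 Y1 P1; (clear -dist_ge0 al be B r v be1 albe Y P P0 Y0 X Z Y1 P1; lra).
have T2 : `|(al + V0 * V0) / (al + be * (V0 * V0))| <= 1.
  rewrite ger0_norm; first by rewrite ler_pdivrMr //; (clear -dist_ge0 al be B r v be1 V0; nra).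
  by rewrite divr_ge0 //; (clear -dist_ge0 al be B r v be1 albe V0; nra).
have T3 : `|- ((al - be * (V0 * V0)) * (g * g) * D1^-1)| <= 4 * al * (9 / 4) * 2.
  have Z1 : `|al - be * (V0 * V0)| <= 4 * al by rewrite ler_norml; (clear -dist_ge0 al be B r v be1 albe V0 vv; nra).
  have Z2 : `|g * g| <= 9 / 4 by rewrite ger0_norm; (clear -dist_ge0 al be B r v g hg; nra).
  have Z3 : `|D1^-1| <= 2 by rewrite gtr0_norm; (clear -dist_ge0 al be B r v s g D1 i1; lra).
  have Z4 := ler_pM (normr_ge0 _) (normr_ge0 _) Z1 Z2; rewrite -normrM in Z4.
  by have := ler_pM (normr_ge0 _) (normr_ge0 _) Z4 Z3; rewrite -normrM normrN.
have T4 : `|(al - be) * V0 * e * D2^-1| <= al * (9 / 8) * 1 * 2.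
  rewrite ger0_norm; last by rewrite !mulr_ge0 //; (clear -dist_ge0 al be B r v albe V0 hv e he s D2 i2; lra).
  apply: ler_pM; [by rewrite !mulr_ge0 //; (clear -dist_ge0 al be B r v albe V0 hv e he; lra)|(clear -dist_ge0 al be B r v e s D2 i2; lra)| |(clear -dist_ge0 al be B r v e s D2 i2; lra)].
  apply: ler_pM; [by rewrite !mulr_ge0 //; (clear -dist_ge0 al be B r v albe V0 hv; lra)|(clear -dist_ge0 al be B r v e he; lra)| |(clear -dist_ge0 al be B r v e he; lra)].
  by apply: ler_pM; (clear -dist_ge0 al be B r v albe V0 hv be1; lra).
have U1 : `|- (1 / 2) * z * ((be * (V0 * V0) - al * (be - 1) * V0 + al) / (al + be * (V0 * V0)))|
   <= 1 / 16 * (5 + 2 * be).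
  rewrite normrM; apply: ler_pM => //; rewrite mulNr normrN normrM (@ger0_norm _ (1 / 2)); (clear -dist_ge0 al be B r v z hz; lra).
have U2 := ler_pM (normr_ge0 _) (normr_ge0 _) T2 (le_trans (ler_normD _ _) (lerD T3 T4)).
rewrite -normrM in U2; apply: le_trans (lerD U1 U2) _.
rewrite /B /sr_bound; (clear -dist_ge0 al be B r v be1 albe; lra).
Qed.

End PoleEstimates.
End LocalSolution.

(** * Local existence with Lipschitz dependence on the parameter *)

Section LocalExistence.
Context {R : realType}.
Implicit Types (e s x y M al be : R) (f g w : R -> R).

Lemma contD f g : continuous f -> continuous g -> continuous (fun x => f x + g x).
Proof. by move=> cf cg x; apply: cvgD; [exact: cf|exact: cg]. Qed.

Lemma contN f : continuous f -> continuous (fun x => - f x).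
Proof. by move=> cf x; apply: cvgN; exact: cf. Qed.

Lemma contM f g : continuous f -> continuous g -> continuous (fun x => f x * g x).
Proof. by move=> cf cg x; apply: cvgM; [exact: cf|exact: cg]. Qed.

Lemma contV f : (forall x, 0 < f x) -> continuous f -> continuous (fun x => (f x)^-1).
Proof. by move=> f0 cf x; apply: cvgV; [rewrite gt_eqF|exact: cf]. Qed.

Lemma cont_cst (c : R) : continuous (fun _ : R => c).
Proof. by move=> x; exact: cvg_cst. Qed.

Lemma cont_comp f g : continuous f -> continuous g -> continuous (fun x => f (g x)).
Proof. by move=> cf cg x; apply: (@continuous_comp _ _ _ g f); [exact: cg|exact: cf]. Qed.

Lemma trunc_rhs_cont al be e g w : 1 <= be -> be < al -> 0 <= e <= 1 ->
  continuous g -> continuous w -> continuous (fun s => trunc_rhs al be e s (g s) (w s)).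
Proof.
move=> be1 albe he cg cw.
have cs := clip_cont (sr_radius al be).
have cG : continuous (fun s => gclip (g s)).
  apply: contD; first exact: cont_cst.
  apply: (cont_comp (clip (1 / 2)) (fun s => g s - 1)); first exact: clip_cont.
  by apply: contD => //; exact: cont_cst.
have cW : continuous (fun s => clip (sr_bound al be) (w s)).
  by apply: (cont_comp (clip (sr_bound al be)) w) => //; exact: clip_cont.
have c c0 := cont_cst c0.
have cv := contD _ _ (c 1) (contM _ _ cs cW).
have cvv := contM _ _ cv cv; have cgg := contM _ _ cG cG.
have cD := contD _ _ (c al) (contM _ _ (c be) cvv).
have iD := contV _ (fun s => lt_le_trans (lt_trans (lt_le_trans ltr01 be1) albe) (trunc_D al be s (w s) be1 albe)) cD.
have h2 : 0 < 1 / 2 :> R by lra.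
have i1 := contV _ (fun s => lt_le_trans h2 (trunc_den1 al be s (g s) be1 albe)) (contD _ _ (c 1) (contM _ _ cs cgg)).
have i2 := contV _ (fun s => lt_le_trans h2 (trunc_den2 al be e s be1 albe he)) (contD _ _ (c 1) (contM _ _ (c e) cs)).
apply: contD.
  apply: contM; first exact: (contM _ _ (c _) (contM _ _ cs (contM _ _ cW cW))).
  apply: (contM _ _ _ iD); apply: contD => //; apply: contD; first exact: contM.
  by apply: contN; exact: contM.
apply: contM; first by apply: (contM _ _ _ iD); exact: contD.
apply: contD.
  apply: contN; apply: (contM _ _ _ i1); apply: (contM _ _ _ cgg).
  by apply: contD => //; apply: contN; exact: contM.
by apply: (contM _ _ _ i2); apply: contM => //; exact: contM.
Qed.

Definition trunc_lhs al be (s x y : R) := 1 / 2 * (gclip x * clip (sr_bound al be) y).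

Lemma trunc_lhs_cont al be g w : continuous g -> continuous w ->
  continuous (fun s => trunc_lhs al be s (g s) (w s)).
Proof.
move=> cg cw; apply: contM; first exact: cont_cst; apply: contM.
  apply: contD; first exact: cont_cst.
  apply: (cont_comp (clip (1 / 2)) (fun s => g s - 1)); first exact: clip_cont.
  by apply: contD => //; exact: cont_cst.
by apply: (cont_comp (clip (sr_bound al be)) w) => //; exact: clip_cont.
Qed.

Lemma trunc_lhs_bound al be s x y : 0 <= sr_bound al be ->
  `|trunc_lhs al be s x y| <= 3 / 4 * sr_bound al be.
Proof.
move=> B0; have hg := gclip_bound x; have hw := clip_bound _ y B0.
rewrite /trunc_lhs normrM (@ger0_norm _ (1 / 2)); last by lra.
rewrite normrM (@ger0_norm _ (gclip x)); last by lra.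
rewrite (_ : 3 / 4 * _ = 1 / 2 * (3 / 2 * sr_bound al be)); last by field.
by apply: ler_wpM2l; [lra|apply: ler_pM => //; lra].
Qed.

Lemma trunc_lhs_lip al be s x y x' y' : 1 <= sr_bound al be ->
  `|trunc_lhs al be s x y - trunc_lhs al be s x' y'| <= sr_bound al be * (`|x - x'| + `|y - y'|).
Proof.
move=> B1; have B0 : 0 <= sr_bound al be by lra.
have hg := gclip_bound x; have hw := clip_bound _ y' B0.
set B := sr_bound al be in B1 B0 hw *.
rewrite /trunc_lhs (_ : _ - _ = 1 / 2 * (gclip x * (clip B y - clip B y') + clip B y' * (gclip x - gclip x'))); last by rewrite -/B; ring.
rewrite normrM (@ger0_norm _ (1 / 2)); last by lra.
have h1 : `|gclip x * (clip B y - clip B y')| <= 3 / 2 * `|y - y'|.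
  by rewrite normrM; apply: ler_pM => //; [rewrite ger0_norm; lra|exact: clip_lip].
have h2 : `|clip B y' * (gclip x - gclip x')| <= B * `|x - x'|.
  rewrite normrM; apply: ler_pM => //; rewrite /gclip opprD addrACA subrr add0r.
  by apply: le_trans (clip_lip _ _ _) _; rewrite opprD addrACA addrN addr0.
have h3 : `|y - y'| <= B * `|y - y'| by rewrite ler_peMl.
have h4 : 0 <= B * `|x - x'| by rewrite mulr_ge0.
have := ler_normD (gclip x * (clip B y - clip B y')) (clip B y' * (gclip x - gclip x')).
have := normr_ge0 (y - y').
by rewrite (mulrDr B `|x - x'|); lra.
Qed.

Theorem local_solution al be n : 1 <= be -> be < al -> (0 < n)%N -> n.+1%:R = al + 3 ->
  exists s0 K (g w : R -> R -> R), [/\ 0 < s0 <= 1 / 8, 0 <= K,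
   (forall e, 0 <= e <= 1 ->
      sing_sol n (fun s x y => 1 / 2 * (x * y)) (singular_rhs al be e) s0 (g e) (w e)),
   (forall e s, 0 <= e <= 1 -> `|s| <= s0 -> `|g e s - 1| <= 1 / 2 /\ `|w e s| <= K) &
   (forall e e' s, 0 <= e <= 1 -> 0 <= e' <= 1 -> `|s| <= s0 ->
      `|g e s - g e' s| <= K * `|e - e'| /\ `|w e s - w e' s| <= K * `|e - e'|)].
Proof.
move=> be1 albe n0 nE.
have [r0 r1 r2 r3] := sr_radius_facts al be be1 albe; have B24 := sr_bound_ge al be be1 albe.
set B := sr_bound al be in r0 r1 r2 r3 B24; set r := sr_radius al be in r0 r1 r2 r3.
have [M M0 [hb hl]] := trunc_tame al be be1 albe; rewrite -/r in hl.
pose C := M + B; have C1 : 1 <= C by rewrite /C; lra.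
have C2 : 0 < 16 * C ^+ 2 by rewrite mulr_gt0 // exprn_gt0 //; lra.
(* The first bound leaves the truncation of $s$ inactive. The second is the smallness required by
   [singular_picard], and it gives $Ms_0\le1/4$, the Lipschitz constant of the right-hand side in
   $w$. *)
pose s0 := Num.min r (16 * C ^+ 2)^-1.
have s00 : 0 < s0 by rewrite lt_min r0 invr_gt0.
have s0r : s0 <= r by rewrite ge_min lexx.
have s0C : s0 * (16 * C ^+ 2) <= 1.
  by rewrite -ler_pdivlMr // div1r ge_min lexx orbT.
have CC : C <= C ^+ 2 by rewrite expr2 ler_peMl //; lra.
have s0M : M * s0 <= 1 / 4.
  have : M * s0 <= C ^+ 2 * s0 by apply: ler_wpM2r; [exact: ltW|rewrite /C in CC *; lra].
  by lra.
have lipab e : 0 <= e <= 1 -> forall s x y x' y', `|s| <= s0 ->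
     `|trunc_lhs al be s x y - trunc_lhs al be s x' y'| <= C * (`|x - x'| + `|y - y'|) /\
     `|trunc_rhs al be e s x y - trunc_rhs al be e s x' y'| <= C * `|x - x'| + 1 / 4 * `|y - y'|.
  move=> he s x y x' y' hs; split.
    apply: le_trans (trunc_lhs_lip al be s x y x' y' _) _; first by rewrite -/B; lra.
    by apply: ler_wpM2r; [rewrite addr_ge0|rewrite /C -/B; lra].
  have s0' : 0 < s0 <= r by rewrite s00.
  apply: le_trans (hl s0 s e x y e x' y' s0' hs he he) _.
  rewrite subrr normr0 add0r mulrDr mulrA; apply: lerD; apply: ler_wpM2r => //.
  by rewrite /C; lra.
have ex e : 0 <= e <= 1 -> exists gw : (R -> R) * (R -> R),
    sing_sol n (trunc_lhs al be) (trunc_rhs al be e) s0 gw.1 gw.2.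
  move=> he; have [|||g [w h]] := singular_picard n (trunc_lhs al be) (trunc_rhs al be e) s0 C B n0 s00 C1 _ s0C _ _ (lipab e he).
  - by (clear -B B24; lra).
  - by move=> g w cg cw; split; [exact: trunc_lhs_cont|exact: trunc_rhs_cont].
  - move=> s x y; split; last exact: trunc_rhs_bound.
    by apply: le_trans (trunc_lhs_bound al be s x y _) _; rewrite -/B; (clear -B B24; lra).
  by exists (g, w).
pose sol e := if pselect (0 <= e <= 1) is left he then sval (cid (ex e he)) else (0, 0).
have solP e : 0 <= e <= 1 -> sing_sol n (trunc_lhs al be) (trunc_rhs al be e) s0 (sol e).1 (sol e).2.
  by move=> he; rewrite /sol; case: pselect => // he'; case: cid.
have nu0 : 1 <= n.+1%:R / 2 :> R by rewrite nE; (clear -be1 albe; lra).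
have bnd e s : 0 <= e <= 1 -> `|s| <= s0 -> `|(sol e).1 s - 1| <= 1 / 2 /\ `|(sol e).2 s| <= B.
  move=> he hs; have [cw g0 dg dw w0] := solP e he; split.
    apply: le_trans (_ : s0 * (3 / 4 * B) <= _).
      apply: (prim_close (sol e).1 (fun _ => 1) (fun s => trunc_lhs al be s ((sol e).1 s) ((sol e).2 s)) (fun _ => 0)) hs => //.
      by move=> z hz; rewrite subr0; apply: trunc_lhs_bound; rewrite -/B; (clear -B B24; lra).
    by (clear -B B24 r2 s0r; nra).
  apply: (@le_trans _ _ (n.+1%:R / 2 * `|(sol e).2 s|)); first by rewrite ler_peMl.
  apply: (singular_bound _ (sol e).2 (fun s => trunc_rhs al be e s ((sol e).1 s) ((sol e).2 s)) B s0) => //.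
  - by (clear -B s00; lra).
  - by apply: der_withincont => x; rewrite -ler_norml; exact: cw.
  - by move=> z _; exact: trunc_rhs_bound.
have unclip e s : 0 <= e <= 1 -> `|s| <= s0 ->
    trunc_lhs al be s ((sol e).1 s) ((sol e).2 s) = 1 / 2 * ((sol e).1 s * (sol e).2 s) /\
    trunc_rhs al be e s ((sol e).1 s) ((sol e).2 s) = singular_rhs al be e s ((sol e).1 s) ((sol e).2 s).
  move=> he hs; have [b1 b2] := bnd e s he hs.
  have e1 : gclip ((sol e).1 s) = (sol e).1 s by rewrite /gclip clip_id // addrC subrK.
  have e2 : clip B ((sol e).2 s) = (sol e).2 s by rewrite clip_id.
  have e3 : clip r s = s by rewrite clip_id //; (clear -B s0r hs; lra).
  by rewrite /trunc_lhs /trunc_rhs -/r -/B e1 e2 e3.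
exists s0, (2 * C * M + M + B), (fun e => (sol e).1), (fun e => (sol e).2).
have K0 : 0 <= 2 * C * M by rewrite !mulr_ge0 //; (clear -B C1; lra).
split.
- by rewrite s00 /=; (clear -B r1 s0r; lra).
- by rewrite !addr_ge0 //; (clear -be1 albe; lra).
- move=> e he; have [cw g0 dg dw w0] := solP e he; split=> //.
  + by move=> s hs; have [<- _] := unclip e s he hs; exact: dg.
  + by move=> s hs z0; have [_ <-] := unclip e s he hs; exact: dw.
  + by have [|_ <-] := unclip e 0 he; rewrite ?normr0 // ltW.
- move=> e s he hs; have [b1 b2] := bnd e s he hs; split=> //.
  by apply: le_trans b2 _; (clear -B M0 K0; lra).
- move=> e e' s he he' hs.
  have hbb z x y : `|z| <= s0 -> `|trunc_rhs al be e z x y - trunc_rhs al be e' z x y| <= M * `|e - e'|.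
    move=> hz; have s0' : 0 < s0 <= r by rewrite s00.
    have := hl s0 z e x y e' x y s0' hz he he'.
    by rewrite !subrr normr0 mulr0 !addr0.
  have [h1 h2] := sing_sol_close n _ _ _ s0 C _ _ _ _ _ n0 s00 C1 s0C (lipab e he) hbb (solP e he) (solP e' he') s hs.
  have d0 := normr_ge0 (e - e').
  have h3 : 0 <= M * `|e - e'| by rewrite mulr_ge0.
  have h4 : 0 <= 2 * C * M * `|e - e'| by rewrite mulr_ge0.
  have h5 : 0 <= B * `|e - e'| by rewrite mulr_ge0 //; (clear -B B24; lra).
  rewrite (mulrDl (2 * C * M + M)) (mulrDl (2 * C * M)).
  by clear -h1 h2 h3 h4 h5 d0; split; lra.
Qed.

End LocalExistence.

(** * The flow in logarithmic coordinates *)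

Section GlobalEquation.
Context {R : realType}.
Implicit Types (e s x y z a b M al be T V : R).

Definition th (x : R) : R := 1 - 2 / (expR (2 * x) + 1).

Lemma der_th x : is_derive x 1 th (1 - th x ^+ 2).
Proof.
have h : expR (2 * x) + 1 != 0 by rewrite gt_eqF.
have d1 := derD _ _ _ _ _ _ (der_exp _ _ _ _ (derM _ _ _ _ _ _ (der_cst 2 _ _) (der_id x))) (der_cst (1 : R) x 1).
have d2 := derV (fun y : R => expR (2 * y) + 1) _ _ _ h d1.
apply: der_eq (derB _ _ _ _ _ _ (der_cst 1 _ _) (derM _ _ _ _ _ _ (der_cst 2 _ _) d2)) _.
by rewrite /th; field.
Qed.

Lemma th_bound x : -1 < th x < 1.
Proof.
rewrite /th; have h := expR_gt0 (2 * x).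
have h1 : 0 < (expR (2 * x) + 1)^-1 by rewrite invr_gt0.
have h2 : (expR (2 * x) + 1)^-1 < 1 by rewrite invf_lt1 //; lra.
lra.
Qed.

Lemma th0 : th 0 = 0.
Proof. by rewrite /th mulr0 expR0; field. Qed.

Lemma thN x : th (- x) = - th x.
Proof.
have h : expR (2 * x) + 1 != 0 by rewrite gt_eqF.
have h0 : expR (2 * x) != 0 by rewrite gt_eqF // expR_gt0.
rewrite /th mulrN expRN; field.
by rewrite h h0.
Qed.

Lemma th_cont : continuous th.
Proof. by move=> x; apply: der_cont (der_th x). Qed.

Lemma th_lt x y : x < y -> th x < th y.
Proof.
move=> xy; rewrite /th ltrD2l ltrN2 ltr_pM2l // ltf_pV2 ?posrE // ltrD2r ltr_expR.
by rewrite ltr_pM2l.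
Qed.

Lemma th_le x y : x <= y -> th x <= th y.
Proof. by rewrite le_eqVlt => /predU1P[-> //|/th_lt/ltW]. Qed.

Lemma th_gt0 x : 0 < x -> 0 < th x.
Proof. by move=> /th_lt; rewrite th0. Qed.

Lemma th_lip x y : `|th x - th y| <= `|x - y|.
Proof.
suff H a b : a <= b -> `|th b - th a| <= b - a.
  case: (leP y x) => h; first by rewrite (ger0_norm (x := x - y)) ?subr_ge0 // H.
  by rewrite distrC (distrC x) (gtr0_norm (x := y - x)) ?subr_gt0 // H // ltW.
move=> ab; have := der_lip th (fun x => 1 - th x ^+ 2) 1 a b ab (fun x _ => der_th x).
rewrite mul1r; apply=> z _; have := th_bound z => h.
by rewrite ger0_norm; nra.
Qed.

Definition qf al be (v : R) := (al + v * v) * (al + be * (v * v))^-1.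

Lemma qf_pos al be (v : R) : 0 < al -> 0 < be -> 0 < qf al be v.
Proof.
move=> a0 b0; have v2 : 0 <= v * v by exact: sqr_ge0.
rewrite /qf mulr_gt0 //; first lra.
by rewrite invr_gt0 ltr_pwDl // mulr_ge0 // ltW.
Qed.

Lemma qf_le1 al be (v : R) : 0 < al -> 1 <= be -> qf al be v <= 1.
Proof.
move=> a0 b1; have v2 : 0 <= v * v by exact: sqr_ge0.
by rewrite /qf ler_pdivrMr; nra.
Qed.

Lemma qf_ge al be (v : R) : 0 < al -> 1 <= be -> be^-1 <= qf al be v.
Proof.
move=> a0 b1; have v2 : 0 <= v * v by exact: sqr_ge0.
rewrite /qf ler_pdivlMr; last by nra.
rewrite mulrC ler_pdivrMr; last by lra.
nra.
Qed.

Lemma qf_lip al be (v w : R) V : 1 <= be -> be < al -> `|v| <= V -> `|w| <= V ->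
  `|qf al be v - qf al be w| <= 2 * V * `|v - w|.
Proof.
move=> b1 ab hv hw; have v2 : 0 <= v * v by exact: sqr_ge0.
have w2 : 0 <= w * w by exact: sqr_ge0.
have D1 : al <= al + be * (v * v) by rewrite lerDl mulr_ge0 //; lra.
have D2 : al <= al + be * (w * w) by rewrite lerDl mulr_ge0 //; lra.
have a0 : 0 < al by lra.
rewrite (_ : qf al be v - qf al be w =
  (al * (be - 1) / ((al + be * (v * v)) * (al + be * (w * w)))) * ((w + v) * (w - v))); last first.
  by rewrite /qf; field; rewrite !gt_eqF //; lra.
have V0 : 0 <= V by exact: le_trans hv.
rewrite normrM -[leRHS]mul1r; apply: ler_pM => //.
  rewrite ger0_norm; last first.
    by apply: divr_ge0; apply: mulr_ge0; (clear -b1 ab D1 D2; lra).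
  rewrite ler_pdivrMr; last by apply: mulr_gt0; lra.
  have : al * al <= (al + be * (v * v)) * (al + be * (w * w)) by apply: ler_pM; (clear -b1 ab D1 D2; lra).
  have : al * (be - 1) <= al * al by apply: ler_wpM2l; lra.
  lra.
rewrite normrM (distrC v); apply: ler_wpM2r => //.
by apply: le_trans (ler_normD _ _) _; lra.
Qed.

Definition force al be T a (v : R) := qf al be v * (- ((al - be * (v * v)) * th a) + (al - be) * T * v).

(** The speed at which the coefficient $al-be\,v^2$ of $\tanh u$ vanishes. For $be<al$ it exceeds 1,
    the limit of $v$ at the pole. *)
Definition vmax al be := Num.sqrt (al / be).

Lemma vmax_sq al be : 0 < be -> 0 < al -> be * (vmax al be * vmax al be) = al.
Proof.
move=> b0 a0; rewrite /vmax -expr2 sqr_sqrtr; first by field; rewrite gt_eqF.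
by rewrite divr_ge0 // ltW.
Qed.

Lemma vmax_gt1 al be : 1 <= be -> be < al -> 1 < vmax al be.
Proof.
move=> b1 ab; have b0 : 0 < be by lra.
rewrite -[X in X < _]sqrtr1 ltr_sqrt; last by apply: divr_gt0; lra.
by rewrite ltr_pdivlMr // mul1r.
Qed.

Lemma vmax_le_al al be (v : R) : 1 <= be -> be < al -> `|v| <= vmax al be -> 0 <= al - be * (v * v) <= al.
Proof.
move=> b1 ab hv; have b0 : 0 < be by lra.
have := vmax_sq al be b0; have V1 := vmax_gt1 al be b1 ab.
set V := vmax al be in hv V1 *; rewrite ler_norml in hv => /(_ _) e.
have e1 := e ltac:(lra).
have : v * v <= V * V by nra.
have : 0 <= v * v by exact: sqr_ge0.
move=> h1 h2; have : be * (v * v) <= be * (V * V) by apply: ler_wpM2l; lra.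
have : 0 <= be * (v * v) by apply: mulr_ge0; lra.
lra.
Qed.

Lemma force_lip al be : 1 <= be -> be < al -> exists2 C, 1 <= C &
  forall T a (v : R) T' a' v', `|T| <= 1 -> `|T'| <= 1 -> `|v| <= vmax al be -> `|v'| <= vmax al be ->
   `|force al be T a v - force al be T' a' v'| <= C * (`|T - T'| + `|a - a'| + `|v - v'|).
Proof.
move=> b1 ab; have V1 := vmax_gt1 al be b1 ab; set V := vmax al be in V1.
have V0 : 0 <= V by lra.
have a0 : 0 < al by lra. have b0 : 0 < be by lra.
exists (4 * (V * al) + al * (2 * (V * V) + 1) + al * V + al).
  have : 0 <= V * al by apply: mulr_ge0; lra.
  have : 0 <= al * (2 * (V * V) + 1) by rewrite mulr_ge0 // ?addr_ge0 ?mulr_ge0 //; lra.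
  have : 0 <= al * V by rewrite mulr_ge0 //; lra.
  by lra.
move=> T a v T' a' v' hT hT' hv hv'.
have g1 := vmax_le_al al be v b1 ab hv; have g1' := vmax_le_al al be v' b1 ab hv'.
rewrite -/V in hv hv'.
have q1 : `|qf al be v| <= 1 by rewrite ger0_norm ?qf_le1 // ltW // qf_pos.
have q1' : `|qf al be v'| <= 1 by rewrite ger0_norm ?qf_le1 // ltW // qf_pos.
have ql := qf_lip al be v v' V b1 ab hv hv'.
have t1 : `|th a'| <= 1 by have := th_bound a'; rewrite ler_norml; (clear -a'; lra).
have tl := th_lip a a'.
have vv : `|v * v - v' * v'| <= 2 * V * `|v - v'|.
  rewrite (_ : _ - _ = (v + v') * (v - v')); last by ring.
  rewrite normrM; apply: ler_wpM2r => //; apply: le_trans (ler_normD _ _) _; (clear -hv hv'; lra).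
set q := qf al be v in q1 ql *; set q' := qf al be v' in q1' ql *.
set h := al - be * (v * v) in g1; set h' := al - be * (v' * v') in g1'.
have hh : `|h - h'| <= 2 * (V * al) * `|v - v'|.
  rewrite (_ : h - h' = - be * (v * v - v' * v')); last by rewrite /h /h'; ring.
  rewrite normrM normrN (gtr0_norm b0); apply: le_trans (ler_pM (ltW b0) (normr_ge0 _) (ltW ab) vv) _.
  by rewrite le_eqVlt; apply/orP; left; apply/eqP; ring.
have hn : `|h| <= al by rewrite ger0_norm; (clear -h g1; lra).
have hn' : `|h'| <= al by rewrite ger0_norm; (clear -h' g1'; lra).
have bound3 (x1 x2 x3 m1 m2 m3 : R) : `|x1| <= m1 -> `|x2| <= m2 -> `|x3| <= m3 -> `|x1 * x2 * x3| <= m1 * m2 * m3.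
  by move=> *; rewrite !normrM; apply: ler_pM => //; apply: ler_pM.
rewrite /force -/q -/q' -/h -/h'.
have -> : q * (- (h * th a) + (al - be) * T * v) - q' * (- (h' * th a') + (al - be) * T' * v') =
  - (q * h * (th a - th a') + q * (h - h') * th a' + (q - q') * h' * th a') +
  (al - be) * (q * v * (T - T') + q * (v - v') * T' + (q - q') * v' * T').
  ring.
set d := `|v - v'| in ql vv hh *; have d0 : 0 <= d by exact: normr_ge0.
have k1 := bound3 _ _ _ _ _ _ q1 hn tl.
have k2 := bound3 _ _ _ _ _ _ q1 hh t1.
have k3 := bound3 _ _ _ _ _ _ ql hn' t1.
have k4 := bound3 _ _ _ _ _ _ q1 hv (lexx `|T - T'|).
have k5 := bound3 _ _ _ _ _ _ q1 (lexx `|v - v'|) hT'.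
have k6 := bound3 _ _ _ _ _ _ ql hv' hT'.
rewrite -/d in k5.
apply: le_trans (ler_normD _ _) _; rewrite normrN.
have j1 := le_trans (ler_normD (q * h * (th a - th a') + q * (h - h') * th a') _)
   (lerD (le_trans (ler_normD _ _) (lerD k1 k2)) k3).
have j2 := le_trans (ler_normD (q * v * (T - T') + q * (v - v') * T') _)
   (lerD (le_trans (ler_normD _ _) (lerD k4 k5)) k6).
have abn : `|al - be| <= al by rewrite ger0_norm; (clear -b1 ab; lra).
have j3 := ler_pM (normr_ge0 _) (normr_ge0 _) abn j2; rewrite -normrM in j3.
apply: le_trans (lerD j1 j3) _.
have s1 := normr_ge0 (T - T'); have s2 := normr_ge0 (a - a').
set x1 := `|T - T'| in s1 *; set x2 := `|a - a'| in s2 *.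
have c0 : 0 <= V * al by rewrite mulr_ge0 // ltW.
have c1 : 0 <= al * (2 * (V * V) + 1) by rewrite mulr_ge0 // ?addr_ge0 ?mulr_ge0 //; (clear -b1 ab; lra).
have c2 : 0 <= al * V by rewrite mulrC.
rewrite (_ : _ + _ = al * x2 + (4 * (V * al) + al * (2 * (V * V) + 1)) * d + al * V * x1); last by ring.
set k := 4 * (V * al) + al * (2 * (V * V) + 1).
have kk : 0 <= k by rewrite /k; (clear -c0 c1; lra).
clear -kk c2 s1 s2 d0 a0.
have l1 : al * x2 <= (k + al * V + al) * x2 by apply: ler_wpM2r; lra.
have l2 : k * d <= (k + al * V + al) * d by apply: ler_wpM2r; lra.
have l3 : al * V * x1 <= (k + al * V + al) * x1 by apply: ler_wpM2r; lra.
by rewrite !(mulrDr (k + al * V + al)); lra.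
Qed.

(* The friction coefficient [tanh x] for [x = y + ln e / 2]. *)
Definition friction e y := 1 - 2 / (e * expR (2 * y) + 1).

Lemma friction0 y : friction 0 y = -1.
Proof. by rewrite /friction mul0r add0r; field. Qed.

Lemma friction_den e y : 0 <= e -> 1 <= e * expR (2 * y) + 1.
Proof. by move=> e0; rewrite lerDr mulr_ge0 // expR_ge0. Qed.

Lemma friction_bound e y : 0 <= e -> `|friction e y| <= 1.
Proof.
move=> e0; have h := friction_den e y e0.
have h1 : 0 < (e * expR (2 * y) + 1)^-1 by rewrite invr_gt0; lra.
have h2 : (e * expR (2 * y) + 1)^-1 <= 1 by rewrite invf_le1 //; lra.
by rewrite /friction ler_norml; lra.
Qed.

Lemma friction_lip e e' y : 0 <= e -> 0 <= e' ->
  `|friction e y - friction e' y| <= 2 * expR (2 * y) * `|e - e'|.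
Proof.
move=> e0 e0'; have h := friction_den e y e0; have h' := friction_den e' y e0'.
rewrite (_ : _ - _ = 2 * expR (2 * y) * ((e - e') / ((e * expR (2 * y) + 1) * (e' * expR (2 * y) + 1)))); last first.
  by rewrite /friction; field; rewrite !gt_eqF //; lra.
have E0 := expR_gt0 (2 * y).
rewrite normrM (@ger0_norm _ (2 * _)); last by lra.
apply: ler_wpM2l; first by lra.
rewrite normrM ler_piMr // normfV ger0_norm; last by apply: mulr_ge0; lra.
by rewrite invf_le1; nra.
Qed.

Lemma friction_cont e : 0 <= e -> continuous (friction e).
Proof.
move=> e0 y; have h : e * expR (2 * y) + 1 != 0 by rewrite gt_eqF //; have := friction_den e y e0; lra.
have d1 := derD _ _ _ _ _ _ (derM _ _ _ _ _ _ (der_cst e _ _) (der_exp _ _ _ _ (derM _ _ _ _ _ _ (der_cst 2 _ _) (der_id y)))) (der_cst (1 : R) y 1).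
have d2 := derV (fun y : R => e * expR (2 * y) + 1) _ _ _ h d1.
exact: der_cont (derB _ _ _ _ _ _ (der_cst (1 : R) y 1) (derM _ _ _ _ _ _ (der_cst 2 _ _) d2)).
Qed.

(** Clipping $v$ in both equations makes the field bounded and Lipschitz, so solutions are global.
    For the regular solutions [v_bound] shows that nothing is cut off up to the equator. *)
Definition flow al be e (u v : R -> R) :=
  (forall y, is_derive y 1 u (clip (vmax al be) (v y))) /\
  (forall y, is_derive y 1 v (force al be (friction e y) (u y) (clip (vmax al be) (v y)))).

Lemma force_bound al be T a (v : R) : 1 <= be -> be < al -> `|T| <= 1 -> `|v| <= vmax al be ->
  `|force al be T a v| <= al + al * vmax al be.
Proof.
move=> b1 ab hT hv; have g1 := vmax_le_al al be v b1 ab hv.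
have t1 : `|th a| <= 1 by have := th_bound a; rewrite ler_norml; lra.
have q1 : `|qf al be v| <= 1.
  by rewrite ger0_norm ?qf_le1 //; [lra|apply/ltW/qf_pos; lra].
rewrite /force normrM -[leRHS]mul1r; apply: ler_pM => //.
apply: le_trans (ler_normD _ _) _; rewrite normrN; apply: lerD.
  by rewrite normrM -[leRHS]mulr1; apply: ler_pM => //; rewrite ger0_norm; lra.
rewrite !normrM; apply: ler_pM => //.
by rewrite -[leRHS]mulr1; apply: ler_pM => //; rewrite ger0_norm; lra.
Qed.

Lemma force_cont al be e (u v : R -> R) : 1 <= be -> be < al -> 0 <= e ->
  continuous u -> continuous v ->
  continuous (fun y => force al be (friction e y) (u y) (clip (vmax al be) (v y))).
Proof.
move=> b1 ab e0 cu cv; set V := vmax al be; have a0 : 0 < al by lra.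
have c1 : continuous (fun y => clip V (v y)) by apply: (cont_comp (clip V) v) => //; exact: clip_cont.
have c11 := contM _ _ c1 c1; have cc c := cont_cst (c : R).
have iD : continuous (fun y => (al + be * (clip V (v y) * clip V (v y)))^-1).
  apply: contV => [y|]; last by apply: contD => //; exact: contM.
  by rewrite ltr_pwDl // mulr_ge0 ?sqr_ge0 //; lra.
apply: contM; first by apply: (contM _ _ _ iD); exact: contD.
apply: contD; first apply: contN; apply: contM => //.
- by apply: contD => //; apply: contN; exact: contM.
- exact: (cont_comp th u th_cont cu).
- by apply: contM => //; exact: friction_cont.
Qed.

Lemma flow_exists al be e y0 a b : 1 <= be -> be < al -> 0 <= e ->
  exists u v : R -> R, [/\ u y0 = a, v y0 = b & flow al be e u v].
Proof.
move=> b1 ab e0; have V1 := vmax_gt1 al be b1 ab; set V := vmax al be in V1.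
have [C C1 hC] := force_lip al be b1 ab.
have V0 : 0 <= V by lra.
have cb x : `|clip V x| <= V by exact: clip_bound.
have a0 : 0 < al by lra.
have hc (u v : R -> R) : continuous u -> continuous v -> continuous (fun y => clip V (v y)) /\
   continuous (fun y => force al be (friction e y) (u y) (clip V (v y))).
  move=> cu cv; split; last exact: force_cont.
  by apply: (cont_comp (clip V) v) => //; exact: clip_cont.
pose M := V + (al + al * V).
have M0 : 0 <= al + al * V by rewrite addr_ge0 ?mulr_ge0 //; (clear -b1 ab; lra).
have [|y a1 a2|y a1 a2 a3 a4|u [v [h1 h2 h3 h4]]] := picard (fun y a b => clip V b)
   (fun y a b => force al be (friction e y) a (clip V b)) C M C1 _ hc _ _ y0 a b.
- by rewrite /M; lra.
- split; first by apply: le_trans (cb _) _; rewrite /M; lra.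
  by apply: le_trans (force_bound al be _ _ _ b1 ab (friction_bound e y e0) (cb _)) _; rewrite /M -/V; lra.
- have d1 := normr_ge0 (a1 - a3); have d2 := clip_lip V a2 a4; split.
    apply: le_trans d2 _; have := normr_ge0 (a2 - a4); nra.
  have f0 := friction_bound e y e0.
  apply: le_trans (hC _ _ _ _ _ _ f0 f0 (cb _) (cb _)) _.
  by rewrite subrr normr0 add0r ler_wpM2l //; (clear -C1 a1 a2 a3 a4 d2; lra).
by exists u, v.
Qed.

(** Confined to $y\le Y$ because two friction coefficients are uniformly close only on such
    half-lines. Translation and reflection reduce both time directions to [key], where
    $e^{-kz}P(z)-mz$ is nonincreasing. *)
Lemma gronwall (S dS : R -> R) k m y0 Y : 0 <= k -> 0 <= m -> y0 <= Y ->
  (forall y, is_derive y 1 S (dS y)) -> (forall y, y <= Y -> `|dS y| <= k * S y + m) ->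
  forall y, y <= Y -> S y <= expR (k * `|y - y0|) * (S y0 + m * `|y - y0|).
Proof.
move=> k0 m0 y0Y hS hd y yY.
have key (P dP : R -> R) (r : R) : 0 <= r -> (forall z, is_derive z 1 P (dP z)) ->
   (forall z, 0 < z < r -> `|dP z| <= k * P z + m) -> P r <= expR (k * r) * (P 0 + m * r).
  move=> r0 hP hdP.
  have dE z : is_derive z 1 (fun z => expR (- k * z)) (- k * expR (- k * z)).
    apply: der_eq (der_exp _ _ _ _ (derM _ _ _ _ _ _ (der_cst (- k) _ _) (der_id z))) _; ring.
  have H : - (expR (- k * 0) * P 0 - m * 0) <= - (expR (- k * r) * P r - m * r).
    apply: (der_le_mono (fun z => - (expR (- k * z) * P z - m * z))
      (fun z => - ((- k * expR (- k * z)) * P z + expR (- k * z) * dP z - m))) => // z hz.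
      apply: derN; apply: derB; first exact: (derM _ _ _ _ _ _ (dE z) (hP z)).
      by apply: der_eq (derM _ _ _ _ _ _ (der_cst m _ _) (der_id z)) _; ring.
    have E0 := expR_gt0 (- k * z).
    have E1 : expR (- k * z) <= 1 by rewrite -expR0 ler_expR; nra.
    have := hdP z hz; rewrite ler_norml => /andP[_ h].
    have : expR (- k * z) * dP z <= expR (- k * z) * (k * P z + m) by apply: ler_wpM2l => //; exact: ltW.
    have : expR (- k * z) * m <= m by rewrite ler_piMl.
    by move: (expR (- k * z)) => E; lra.
  rewrite !mulr0 expR0 mul1r subr0 in H.
  have : expR (- k * r) * P r <= P 0 + m * r by lra.
  have E0 := expR_gt0 (k * r).
  by move=> h; rewrite -ler_pdivrMl // -expRN -mulNr.
case: (leP y0 y) => h.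
  have := key (fun z => S (z + y0)) (fun z => dS (z + y0)) (y - y0).
  rewrite subrK add0r ger0_norm ?subr_ge0 //; apply=> // z; last by move=> hz; apply: hd; lra.
  have dz := derD _ _ _ _ _ _ (der_id z) (der_cst y0 z 1).
  by apply: der_eq (der_chain S (fun z => z + y0) _ _ _ _ dz (hS _)) _; ring.
have := key (fun z => S (y0 - z)) (fun z => - dS (y0 - z)) (y0 - y).
rewrite subKr subr0 ltr0_norm ?subr_lt0 // opprB; apply=> //.
- by rewrite subr_ge0 ltW.
- move=> z; have dz := derB _ _ _ _ _ _ (der_cst y0 z 1) (der_id z).
  by apply: der_eq (der_chain S (fun z => y0 - z) _ _ _ _ dz (hS _)) _; ring.
- by move=> z hz; rewrite normrN; apply: hd; lra.
Qed.

Lemma flow_close al be : 1 <= be -> be < al -> exists2 K, 0 <= K &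
  forall e e' (u v u' v' : R -> R) y0 y Y m, 0 <= e -> 0 <= e' -> y0 <= Y -> y <= Y ->
  flow al be e u v -> flow al be e' u' v' ->
  (forall z, z <= Y -> `|friction e z - friction e' z| <= m) ->
  (u y - u' y) ^+ 2 + (v y - v' y) ^+ 2 <=
   expR (K * `|y - y0|) * ((u y0 - u' y0) ^+ 2 + (v y0 - v' y0) ^+ 2 + K * m ^+ 2 * `|y - y0|).
Proof.
move=> b1 ab; have V1 := vmax_gt1 al be b1 ab; set V := vmax al be in V1.
have [C C1 hC] := force_lip al be b1 ab.
have V0 : 0 <= V by lra.
have cb x : `|clip V x| <= V by exact: clip_bound.
exists (1 + 4 * C); first by lra.
move=> e e' u v u' v' y0 y Y m e0 e0' y0Y yY [du dv] [du' dv'] hm.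
pose dS z := 2 * (u z - u' z) * (clip V (v z) - clip V (v' z)) + 2 * (v z - v' z) *
  (force al be (friction e z) (u z) (clip V (v z)) - force al be (friction e' z) (u' z) (clip V (v' z))).
apply: (gronwall (fun z => (u z - u' z) ^+ 2 + (v z - v' z) ^+ 2) dS _ _ y0 Y) => //.
- by lra.
- by apply: mulr_ge0; [lra|exact: sqr_ge0].
- move=> z; have d1 := derX 2 _ _ _ _ (derB _ _ _ _ _ _ (du z) (du' z)).
  have d2 := derX 2 _ _ _ _ (derB _ _ _ _ _ _ (dv z) (dv' z)).
  by apply: der_eq (derD _ _ _ _ _ _ d1 d2) _; rewrite /dS /= !expr1.
move=> z zY; have f0 := friction_bound e z e0; have f0' := friction_bound e' z e0'.
have hF := hC _ (u z) _ _ (u' z) _ f0 f0' (cb (v z)) (cb (v' z)).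
have hv := clip_lip V (v z) (v' z); have hmz := hm z zY.
rewrite /dS; move: hF hv hmz; set F := _ - force _ _ _ _ _; set c := clip V _ - _ => hF hc hmz.
have a0' := normr_ge0 (u z - u' z); have b0 := normr_ge0 (v z - v' z).
rewrite -(real_normK (num_real (u z - u' z))) -(real_normK (num_real (v z - v' z))).
have m0 := normr_ge0 (friction e z - friction e' z).
apply: le_trans (ler_normD _ _) _; rewrite 4!normrM (@ger0_norm _ 2) //.
set a := `|u z - u' z| in hF a0' *; set b := `|v z - v' z| in hF hc b0 *.
set t := `|friction e z - _| in hF hmz m0; move: (`|F|) hF => F' hF; set c' := `|c| in hF hc *.
have h1 : 2 * a * c' <= 2 * a * b by apply: ler_wpM2l => //; (clear -a0'; lra).
have h2 : 2 * b * F' <= 2 * b * (C * (m + a + b)).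
  apply: ler_wpM2l; first (clear -b0; lra).
  apply: (le_trans hF); apply: ler_wpM2l; first (clear -C1; lra).
  by (clear -hmz c' hc; lra).
have h3 : 2 * a * b <= a ^+ 2 + b ^+ 2 by have := sqr_ge0 (a - b); (clear -R; lra).
have h4 : C * (2 * b * m) <= C * (b ^+ 2 + m ^+ 2).
  by apply: ler_wpM2l; [(clear -C1; lra)|have := sqr_ge0 (b - m); (clear -R; lra)].
have h5 : C * (2 * a * b) <= C * (a ^+ 2 + b ^+ 2) by apply: ler_wpM2l; (clear -C1 h3; lra).
have q1 : 0 <= C * a ^+ 2 by apply: mulr_ge0; [(clear -C1; lra)|exact: sqr_ge0].
have q2 : 0 <= C * m ^+ 2 by apply: mulr_ge0; [(clear -C1; lra)|exact: sqr_ge0].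
have q3 := sqr_ge0 m.
rewrite (_ : 2 * b * (C * (m + a + b)) = C * (2 * b * m) + C * (2 * a * b) + 2 * (C * b ^+ 2)) in h2; last by ring.
(clear -F' c' h1 h3 h4 h5 q1 q2 q3 h2; lra).
Qed.

End GlobalEquation.

(** * The family of regular solutions *)

Section Family.
Context {R : realType}.
Implicit Types (e s x y z a b al be : R).

Lemma der_of_ed (f : R -> R) (x d : R) :
  (forall e, 0 < e -> exists2 r, 0 < r & forall h, `|h| < r -> `|f (x + h) - f x - d * h| <= e * `|h|) ->
  is_derive x 1 f d.
Proof.
move=> H.
have L : h^-1 *: ((f \o shift x) (h *: (1 : R)) - f x) @[h --> 0^'] --> d.
  apply/cvgrPdist_le => e e0; have [r r0 hr] := H e e0.
  apply/nbhs_ballP; exists r => //= h; rewrite /ball /= sub0r normrN => hh h0.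
  have hr' := hr h hh.
  have -> : h *: (1 : R) + x = x + h by rewrite [h *: _]mulr1 addrC.
  rewrite -(ler_pM2r (_ : 0 < `|h|)) ?normr_gt0 // -normrM.
  apply: le_trans hr'; rewrite -normrN le_eqVlt; apply/orP; left; apply/eqP; congr `|_|.
  by rewrite /GRing.scale /=; field.
by apply: DeriveDef; [apply/cvg_ex; exists d | apply/cvg_lim].
Qed.

Lemma der_glue (f g : R -> R) (x d : R) : is_derive x 1 f d -> is_derive x 1 g d -> f x = g x ->
  is_derive x 1 (fun y => if y <= x then f y else g y) d.
Proof.
move=> hf hg fg; apply: der_of_ed => e e0.
have [r r0 hr] := der_ed f x d hf e e0; have [r' r'0 hr'] := der_ed g x d hg e e0.
exists (Num.min r r'); first by rewrite lt_min r0.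
move=> h; rewrite lt_min => /andP[h1 h2]; rewrite lexx.
by case: ifP => _; [exact: hr|rewrite fg; exact: hr'].
Qed.

Lemma glue_flow (f g df dg : R -> R) x0 :
  (forall y, y <= x0 -> is_derive y 1 f (df y)) ->
  (forall y, is_derive y 1 g (dg y)) -> f x0 = g x0 -> df x0 = dg x0 ->
  forall y, is_derive y 1 (fun y => if y <= x0 then f y else g y) (if y <= x0 then df y else dg y).
Proof.
move=> hf hg e0 e1 y; case: (ltgtP y x0) => h.
- apply: der_near (hf y (ltW h)); near=> z.
  by have -> : z <= x0 by apply/ltW; near: z; apply: near_lt.
- apply: der_near (hg y); near=> z.
  by case: ifP => // hz; have : x0 < z; [near: z; apply: near_gt | rewrite ltNge hz].
- rewrite h; apply: der_glue => //; first by apply: hf.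
  by rewrite e1; apply: hg.
Unshelve. all: by end_near. Qed.

Lemma der_ln (f : R -> R) x d : 0 < f x -> is_derive x 1 f d ->
  is_derive x 1 (fun y => ln (f y)) (d / f x).
Proof.
move=> f0 hf; rewrite mulrC.
exact: (der_chain (@ln R) f _ _ _ _ hf (is_derive1_ln f0)).
Qed.

Lemma ln_lip x y : 1 / 2 <= x -> 1 / 2 <= y -> `|ln x - ln y| <= 2 * `|x - y|.
Proof.
suff H a b : 1 / 2 <= a -> a <= b -> `|ln b - ln a| <= 2 * (b - a).
  move=> hx hy; case: (leP y x) => h; first by rewrite (@ger0_norm _ (x - y)) ?subr_ge0 // H.
  by rewrite distrC (distrC x) (@gtr0_norm _ (y - x)) ?subr_gt0 // H // ltW.
move=> ha ab; apply: (der_lip (@ln R) (fun x => x^-1)) => // z hz.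
  by apply: is_derive1_ln; lra.
by rewrite gtr0_norm ?invr_gt0; [rewrite -(@invrK _ 2) lef_pV2 ?posrE ?invr_gt0|]; lra.
Qed.

Definition local_u (g : R -> R) (y : R) := y + ln (g (expR (2 * y))).
Definition local_v (w : R -> R) (y : R) := 1 + expR (2 * y) * w (expR (2 * y)).

Lemma th_local g y : 0 < g (expR (2 * y)) ->
  th (local_u g y) = 1 - 2 / (expR (2 * y) * g (expR (2 * y)) ^+ 2 + 1).
Proof.
move=> g0; rewrite /th /local_u mulrDr expRD.
rewrite (_ : 2 * ln (g (expR (2 * y))) = ln (g (expR (2 * y))) + ln (g (expR (2 * y)))); last by ring.
by rewrite (expRD (ln _)) lnK ?posrE // expr2.
Qed.

(** The origin of $\nu=(al+3)/2$: with $d/dy=2s\,d/ds$ and $v=1+sw$ one has $v'=2s(w+sw')$, so the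
    identity says $sw'+\nu w=$ [singular_rhs]. The hypothesis on [th a] encodes $e^{2a}=sG^2$. *)
Lemma force_local al be e s a (G W : R) : 1 <= be -> be < al -> 0 < s -> 0 <= e -> 0 < G ->
  th a = 1 - 2 / (s * G ^+ 2 + 1) ->
  force al be (1 - 2 / (e * s + 1)) a (1 + s * W) =
  2 * s * (W + singular_rhs al be e s G W - (al + 3) / 2 * W).
Proof.
move=> b1 ab s0 e0 G0 ha; rewrite /force ha /qf /singular_rhs.
have D0 : 0 < al + be * ((1 + s * W) * (1 + s * W)).
  have vv : 0 <= (1 + s * W) * (1 + s * W) by exact: sqr_ge0.
  have : 0 <= be * ((1 + s * W) * (1 + s * W)) by apply: mulr_ge0 => //; lra.
  lra.
have D1 : 0 < 1 + s * (G * G).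
  have : 0 < s * (G * G) by rewrite !mulr_gt0.
  lra.
have D2 : 0 < 1 + e * s.
  have : 0 <= e * s by apply: mulr_ge0; lra.
  lra.
have D3 : 0 < s * G ^+ 2 + 1 by rewrite addrC expr2.
have D4 : 0 < e * s + 1 by rewrite addrC.
by field; rewrite !gt_eqF.
Qed.

Lemma local_flow al be n e s0 (g w : R -> R) y : 1 <= be -> be < al -> n.+1%:R = al + 3 ->
  0 <= e <= 1 -> sing_sol n (fun s x y => 1 / 2 * (x * y)) (singular_rhs al be e) s0 g w ->
  expR (2 * y) <= s0 -> `|g (expR (2 * y)) - 1| <= 1 / 2 ->
  `|expR (2 * y) * w (expR (2 * y))| <= vmax al be - 1 ->
  is_derive y 1 (local_u g) (clip (vmax al be) (local_v w y)) /\
  is_derive y 1 (local_v w) (force al be (friction e y) (local_u g y) (clip (vmax al be) (local_v w y))).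
Proof.
move=> b1 ab nE he [_ g0 dg dw w0] ys hg hw.
have s_gt0 := expR_gt0 (2 * y).
have de : is_derive y 1 (fun y : R => expR (2 * y)) (2 * expR (2 * y)).
  by apply: der_eq (der_exp _ _ _ _ (derM _ _ _ _ _ _ (der_cst 2 _ _) (der_id y))) _; ring.
have sa : `|expR (2 * y)| <= s0 by rewrite gtr0_norm.
have sn0 : expR (2 * y) != 0 by rewrite gt_eqF.
have dg' := der_chain _ _ _ _ _ _ de (dg _ sa).
have dw' := der_chain _ _ _ _ _ _ de (dw _ sa sn0).
have gp : 0 < g (expR (2 * y)) by move: hg; rewrite ler_norml; lra.
rewrite clip_id; last first.
  have : `|1 + expR (2 * y) * w (expR (2 * y))| <= 1 + (vmax al be - 1).
    by apply: le_trans (ler_normD _ _) _; rewrite normr1 lerD2l.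
  by move=> h; apply: (le_trans h); lra.
split.
  apply: der_eq (derD _ _ _ _ _ _ (der_id y) (der_ln _ _ _ gp dg')) _.
  by rewrite /local_v; field; rewrite gt_eqF.
apply: der_eq (derD _ _ _ _ _ _ (der_cst 1 _ _) (derM _ _ _ _ _ _ de dw')) _.
rewrite /friction /local_v (force_local al be e _ _ _ (w (expR (2 * y))) b1 ab s_gt0 _ gp (th_local _ _ gp)); last by lra.
by rewrite nE; field.
Qed.

(** The local solution in $s$ and the flow in $y$ are kept together: the first describes the pole,
    the second reaches the equator. In [fs_lip] the parameter 0 is allowed and the bound is uniform
    down to $y=-\infty$, so the limiting flow is comparable with its neighbours. *)
Record family_spec (al be : R) (n : nat) (s0 : R) (g w u v : R -> R -> R) : Prop := FamilySpec {
  fs_s0 : 0 < s0 <= 1 / 8;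
  fs_sing : forall e : R, 0 <= e <= 1 ->
    sing_sol n (fun s x y => 1 / 2 * (x * y)) (singular_rhs al be e) s0 (g e) (w e);
  fs_g : forall e s : R, 0 <= e <= 1 -> `|s| <= s0 -> `|g e s - 1| <= 1 / 2;
  fs_w : forall e s : R, 0 <= e <= 1 -> `|s| <= s0 -> `|s * w e s| <= vmax al be - 1;
  fs_flow : forall e : R, 0 <= e <= 1 -> flow al be e (u e) (v e);
  fs_local : forall e y : R, 0 <= e <= 1 -> expR (2 * y) <= s0 ->
    u e y = local_u (g e) y /\ v e y = local_v (w e) y;
  fs_lip : forall Y : R, exists2 c : R, 0 <= c & forall e e' y : R, 0 <= e <= 1 -> 0 <= e' <= 1 -> y <= Y ->
    (u e y - u e' y) ^+ 2 + (v e y - v e' y) ^+ 2 <= c * (e - e') ^+ 2 }.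

Theorem family_exists al be n : 1 <= be -> be < al -> (0 < n)%N -> n.+1%:R = al + 3 ->
  exists s0 g w u v, family_spec al be n s0 g w u v.
Proof.
move=> b1 ab n0 nE; have V1 := vmax_gt1 al be b1 ab; set V := vmax al be in V1.
have [s' [K [g [w [/andP[s'0 s'8] K0 hsol hbnd hlip]]]]] := local_solution al be n b1 ab n0 nE.
(* The second bound forces $|sw|\le V-1$, hence $|v|\le V$, so the local solution also solves the
   clipped equation. *)
pose s0 := Num.min s' ((V - 1) / (K + 1)).
have s00 : 0 < s0 by rewrite lt_min s'0 divr_gt0 //; lra.
have s0s' : s0 <= s' by rewrite ge_min lexx.
have s0K : s0 * (K + 1) <= V - 1 by rewrite -ler_pdivlMr; [rewrite ge_min lexx orbT|lra].
have hw e s : 0 <= e <= 1 -> `|s| <= s0 -> `|s * w e s| <= V - 1.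
  move=> he hs; have [_ h] := hbnd e s he (le_trans hs s0s').
  apply: le_trans s0K; rewrite normrM; apply: ler_pM => //; lra.
have hg e s : 0 <= e <= 1 -> `|s| <= s0 -> `|g e s - 1| <= 1 / 2.
  by move=> he hs; case: (hbnd e s he (le_trans hs s0s')).
pose y0 := ln s0 / 2.
have ey0 y : (expR (2 * y) <= s0) = (y <= y0).
  by rewrite -{1}(@lnK _ s0) ?posrE // ler_expR /y0 ler_pdivlMr // mulrC.
have ex e : exists uv : (R -> R) * (R -> R), 0 <= e <= 1 ->
    [/\ uv.1 y0 = local_u (g e) y0, uv.2 y0 = local_v (w e) y0 & flow al be e uv.1 uv.2].
  case: (boolP (0 <= e <= 1)) => he; last by exists (0, 0).
  have e0 : 0 <= e by lra.
  by have [u [v H]] := flow_exists al be e y0 (local_u (g e) y0) (local_v (w e) y0) b1 ab e0; exists (u, v).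
pose f e := sval (cid (ex e)).
have fP e : 0 <= e <= 1 -> [/\ (f e).1 y0 = local_u (g e) y0, (f e).2 y0 = local_v (w e) y0
   & flow al be e (f e).1 (f e).2] by exact: (svalP (cid (ex e))).
pose u e y := if y <= y0 then local_u (g e) y else (f e).1 y.
pose v e y := if y <= y0 then local_v (w e) y else (f e).2 y.
have hloc e y : 0 <= e <= 1 -> y <= y0 ->
    is_derive y 1 (local_u (g e)) (clip V (local_v (w e) y)) /\
    is_derive y 1 (local_v (w e)) (force al be (friction e y) (local_u (g e) y) (clip V (local_v (w e) y))).
  move=> he; rewrite -ey0 => hy.
  have sa : `|expR (2 * y)| <= s0 by rewrite gtr0_norm ?expR_gt0.
  apply: (local_flow al be n e s' (g e) (w e) y) => //; [exact: hsol|(clear -K s0s' hy; lra)|exact: hg|exact: hw].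
have hflow e : 0 <= e <= 1 -> flow al be e (u e) (v e).
  move=> he; have [u0 v0 [du dv]] := fP e he; split=> y.
    have := glue_flow _ _ _ _ y0 (fun y hy => (hloc e y he hy).1) du (esym u0).
    rewrite v0 => /(_ erefl y); rewrite -/(u e) /v; by case: ifP.
  have := glue_flow _ _ _ _ y0 (fun y hy => (hloc e y he hy).2) dv (esym v0).
  rewrite v0 u0 => /(_ erefl y); rewrite -/(v e) /u /v; by case: ifP.
have [K1 K10 hK1] := flow_close al be b1 ab.
(* The constant is $(2K)^2+K^2$: the logarithm is 2-Lipschitz on $[1/2,\infty)$, where $g$ takes its
   values, and $s\le1$. *)
have h0 e e' y : 0 <= e <= 1 -> 0 <= e' <= 1 -> y <= y0 ->
    (u e y - u e' y) ^+ 2 + (v e y - v e' y) ^+ 2 <= 5 * K ^+ 2 * (e - e') ^+ 2.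
  move=> he he' hy; have hs := hy; rewrite -ey0 in hs.
  have sa : `|expR (2 * y)| <= s0 by rewrite gtr0_norm ?expR_gt0.
  have [l1 l2] := hlip e e' _ he he' (le_trans sa s0s').
  have hg1 := hg e _ he sa; have hg2 := hg e' _ he' sa.
  rewrite !ler_norml in hg1 hg2.
  rewrite /u /v hy /local_u /local_v.
  set s := expR (2 * y) in sa l1 l2 hg1 hg2 *.
  have d0 := normr_ge0 (e - e').
  have k1 : `|(y + ln (g e s)) - (y + ln (g e' s))| <= 2 * (K * `|e - e'|).
    rewrite opprD addrACA subrr add0r; apply: le_trans (ln_lip _ _ _ _) _; [(clear -hg1; lra)|(clear -hg2; lra)|].
    by apply: ler_wpM2l.
  have k2 : `|(1 + s * w e s) - (1 + s * w e' s)| <= K * `|e - e'|.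
    rewrite opprD addrACA subrr add0r -mulrBr normrM; apply: le_trans l2.
    by rewrite ler_piMl //; (clear -K s'8 s0s' sa; lra).
  rewrite -(real_normK (num_real (y + _ - _))) -(real_normK (num_real (1 + _ - _))) -(real_normK (num_real (e - e'))).
  have := ler_pM (normr_ge0 _) (normr_ge0 _) k1 k1; have := ler_pM (normr_ge0 _) (normr_ge0 _) k2 k2.
  rewrite -!expr2; set A := _ ^+ 2; set A2 := _ ^+ 2; set A3 := _ ^+ 2; set A4 := _ ^+ 2.
  have -> : A2 = K ^+ 2 * `|e - e'| ^+ 2 by rewrite /A2; ring.
  have -> : A4 = 4 * (K ^+ 2 * `|e - e'| ^+ 2) by rewrite /A4; ring.
  move=> h1 h2; rewrite -mulrA; move: (K ^+ 2 * _) h1 h2 => X; (clear -A A3 X; lra).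
exists s0, g, w, u, v; split=> //.
- by rewrite s00 (le_trans s0s').
- move=> e he; have [c1 c2 c3 c4 c5] := hsol e he; split=> //.
  + by move=> s hs; apply: c1; apply: le_trans hs s0s'.
  + by move=> s hs; apply: c3; apply: le_trans hs s0s'.
  + by move=> s hs; apply: c4; apply: le_trans hs s0s'.
- by move=> e y he; rewrite ey0 /u /v => ->.
- move=> Y; pose Y' := Num.max y0 Y.
  have y0Y : y0 <= Y' by rewrite le_max lexx.
  have YY : Y <= Y' by rewrite le_max lexx orbT.
  pose m0 := 2 * expR (2 * Y').
  pose c := expR (K1 * (Y' - y0)) * (5 * K ^+ 2 + K1 * m0 ^+ 2 * (Y' - y0)).
  have K2 := sqr_ge0 K; have m2 := sqr_ge0 m0.
  have p1 : 0 <= K1 * m0 ^+ 2 by rewrite mulr_ge0.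
  have p2 : 0 <= K1 * m0 ^+ 2 * (Y' - y0) by rewrite mulr_ge0 // subr_ge0.
  have p3 : 1 <= expR (K1 * (Y' - y0)) by rewrite -expR0 ler_expR mulr_ge0 // subr_ge0.
  have p4 : 5 * K ^+ 2 <= c.
    rewrite /c -[leLHS]mul1r; apply: ler_pM => //; (clear -K K2 K1 m0 p2; lra).
  exists c; first by apply: le_trans p4; (clear -K K2; lra).
  move=> e e' y he he' yY.
  case: (leP y y0) => hy.
    by apply: le_trans (h0 e e' y he he' hy) _; apply: ler_wpM2r; [exact: sqr_ge0|].
  have yY' : y <= Y' by (clear -K YY yY; lra).
  have e0 : 0 <= e by (clear -he; lra). have e0' : 0 <= e' by (clear -he'; lra).
  have hm z : z <= Y' -> `|friction e z - friction e' z| <= m0 * `|e - e'|.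
    move=> hz; apply: le_trans (friction_lip e e' z e0 e0') _.
    by apply: ler_wpM2r => //; rewrite /m0 ler_pM2l // ler_expR ler_pM2l.
  apply: le_trans (hK1 e e' _ _ _ _ y0 y Y' _ e0 e0' y0Y yY' (hflow e he) (hflow e' he') hm) _.
  have hb := h0 e e' y0 he he' (lexx y0).
  rewrite /c -[leRHS]mulrA; apply: ler_pM.
  - exact: expR_ge0.
  - rewrite addr_ge0 ?addr_ge0 ?sqr_ge0 // !mulr_ge0 ?sqr_ge0 //.
  - by rewrite ler_expR; apply: ler_wpM2l => //; rewrite gtr0_norm; (clear -K YY yY hy; lra).
  - rewrite mulrDl; apply: lerD => //.
    rewrite exprMn real_normK ?num_real // gtr0_norm ?subr_gt0 //.
    rewrite -[leRHS]mulrA -[leLHS]mulrA mulrA [leLHS](_ : _ = K1 * m0 ^+ 2 * (e - e') ^+ 2 * (y - y0)); last by ring.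
    rewrite [leRHS](_ : _ = K1 * m0 ^+ 2 * (e - e') ^+ 2 * (Y' - y0)); last by ring.
    by apply: ler_wpM2l; [rewrite mulr_ge0 // sqr_ge0|(clear -K YY yY; lra)].
Qed.

End Family.

(** * Oscillation *)

Section Oscillation.
Context {R : realType}.
Implicit Types (e s x y z a b al be : R) (u v f df : R -> R).

Lemma flow_uniq al be e u v u' v' y0 : 1 <= be -> be < al -> 0 <= e ->
  flow al be e u v -> flow al be e u' v' -> u y0 = u' y0 -> v y0 = v' y0 ->
  forall y, u y = u' y /\ v y = v' y.
Proof.
move=> b1 ab e0 h h' eu ev y; have [K K0 hK] := flow_close al be b1 ab.
have := hK e e u v u' v' y0 y (Num.max y0 y) 0 e0 e0; rewrite !le_max !lexx orbT.
move=> /(_ isT isT h h') H; have {H} : (u y - u' y) ^+ 2 + (v y - v' y) ^+ 2 <= 0.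
  apply: le_trans (H _) _; first by move=> z _; rewrite subrr normr0.
  by rewrite eu ev !subrr expr0n /= !mulr0 !mul0r !addr0 mulr0.
have h1 := sqr_ge0 (u y - u' y); have h2 := sqr_ge0 (v y - v' y) => h3.
have /eqP : (u y - u' y) ^+ 2 = 0 by lra.
have /eqP : (v y - v' y) ^+ 2 = 0 by lra.
by rewrite !sqrf_eq0 !subr_eq0 => /eqP -> /eqP ->.
Qed.

Lemma flow_zero al be e u v y0 : 1 <= be -> be < al -> 0 <= e ->
  flow al be e u v -> u y0 = 0 -> v y0 = 0 -> forall y, u y = 0.
Proof.
move=> b1 ab e0 h eu ev y; have V1 := vmax_gt1 al be b1 ab.
have c0 : clip (vmax al be) 0 = 0 by rewrite clip_id // normr0; lra.
have h0 : flow al be e (fun _ => 0) (fun _ => 0).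
  split=> z; rewrite c0; first exact: der_cst.
  by apply: der_eq (der_cst _ _ _) _; rewrite /force th0 !mulr0 oppr0 addr0 mulr0.
by case: (flow_uniq al be e u v _ _ y0 b1 ab e0 h h0 eu ev y).
Qed.

Lemma force_vmax al be T a : 1 <= be -> be < al ->
  force al be T a (vmax al be) = qf al be (vmax al be) * ((al - be) * T * vmax al be) /\
  force al be T a (- vmax al be) = - (qf al be (vmax al be) * ((al - be) * T * vmax al be)).
Proof.
move=> b1 ab; have e : al - be * (vmax al be * vmax al be) = 0.
  by rewrite vmax_sq ?subrr //; lra.
by split; rewrite /force /qf ?mulrNN e mul0r oppr0 add0r ?mulrN.
Qed.

(** At $v=\pm$ [vmax] the restoring term vanishes and the force is pure friction. The condition
    $e\,e^{2y}\le1$ means that the equator is not passed; up to there friction is nonpositive and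
    pushes inwards. The local solution supplies the start. *)
Lemma v_bound al be n s0 (g w u v : R -> R -> R) e y : 1 <= be -> be < al ->
  family_spec al be n s0 g w u v -> 0 <= e <= 1 -> e * expR (2 * y) <= 1 ->
  `|v e y| <= vmax al be.
Proof.
move=> b1 ab F he hy; have V1 := vmax_gt1 al be b1 ab; set V := vmax al be in V1 *.
have [du dv] := fs_flow _ _ _ _ _ _ _ _ F e he.
have /andP[s00 _] := fs_s0 _ _ _ _ _ _ _ _ F.
pose y1 := Num.min y (ln s0 / 2).
have y1y : y1 <= y by rewrite ge_min lexx.
have hs : expR (2 * y1) <= s0.
  rewrite -[leRHS](@lnK _ s0) ?posrE // ler_expR mulrC -ler_pdivlMr //.
  by rewrite ge_min lexx orbT.
have [_ v1] := fs_local _ _ _ _ _ _ _ _ F e y1 he hs.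
have sa : `|expR (2 * y1)| <= s0 by rewrite gtr0_norm ?expR_gt0.
have := fs_w _ _ _ _ _ _ _ _ F e _ he sa; rewrite -/V ler_norml => /andP[w1 w2].
have hT z : z <= y -> friction e z <= 0.
  move=> zy; rewrite /friction subr_le0 ler_pdivlMr; last first.
    by have := friction_den e z ltac:(lra); lra.
  rewrite mul1r; have : e * expR (2 * z) <= e * expR (2 * y).
    by apply: ler_wpM2l; [(clear -he; lra)|rewrite ler_expR; (clear -zy; lra)].
  lra.
have a0 : 0 < al by lra.
have qV : 0 < qf al be V by apply: qf_pos; (clear -b1 ab; lra).
have sgn z : z <= y -> qf al be V * ((al - be) * friction e z * V) <= 0.
  move=> zy; rewrite pmulr_rle0 // mulr_le0_ge0 //; last by (clear -V1; lra).
  by rewrite mulr_ge0_le0 ?hT //; (clear -ab; lra).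
have clp z : V < v e z -> clip V (v e z) = V.
  by move=> h; have h1 := ltW h; rewrite /clip (min_l h1) max_r //; (clear -V1; lra).
have cln z : v e z < - V -> clip V (v e z) = - V.
  move=> h; have h1 : v e z <= V by (clear -V1 h; lra).
  by rewrite /clip (min_r h1) max_l // ltW.
rewrite ler_norml; apply/andP; split.
  suff : - V - v e y <= 0 by (clear -R; lra).
  apply: (barrier_le (fun z => - V - v e z) (fun z => - force al be (friction e z) (u e z) (clip V (v e z))) y1) => //.
  - by move=> z _; apply: der_eq (derB _ _ _ _ _ _ (der_cst (- V) _ _) (dv z)) _; rewrite sub0r.
  - move=> z hz h; rewrite cln; last by lra.
    by rewrite (force_vmax al be _ _ b1 ab).2 opprK; apply: sgn; (clear -hz; lra).
  - by rewrite v1 /local_v; (clear -w1; lra).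
suff : v e y - V <= 0 by (clear -R; lra).
apply: (barrier_le (fun z => v e z - V) (fun z => force al be (friction e z) (u e z) (clip V (v e z))) y1) => //.
- by move=> z _; apply: der_eq (derB _ _ _ _ _ _ (dv z) (der_cst V _ _)) _; rewrite subr0.
- move=> z hz h; rewrite clp; last by (clear -h; lra).
  by rewrite (force_vmax al be _ _ b1 ab).1; apply: sgn; (clear -hz; lra).
- by rewrite v1 /local_v; (clear -w2; lra).
Qed.

Lemma decr_unbounded f df y1 d c : 0 < d ->
  (forall y, y1 <= y -> is_derive y 1 f (df y)) -> (forall y, y1 <= y -> df y <= - d) ->
  exists2 y, y1 <= y & f y < c.
Proof.
move=> d0 hf hd.
pose y := y1 + (`|f y1 - c| + 1) / d.
have hy : y1 <= y by rewrite lerDl divr_ge0 ?addr_ge0 // ltW.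
exists y => //.
have : - f y1 - d * y1 <= - f y - d * y.
  apply: (der_le_mono (fun z => - f z - d * z) (fun z => - df z - d)) => // z hz.
    apply: derB; first by apply: derN; apply: hf; lra.
    by apply: der_eq (derM _ _ _ _ _ _ (der_cst d _ _) (der_id z)) _; ring.
  by have := hd z; lra.
rewrite (_ : d * y = d * y1 + (`|f y1 - c| + 1)); last by rewrite /y; field; rewrite gt_eqF.
by have := ler_norm (f y1 - c); lra.
Qed.

Lemma th_le_id x : 0 <= x -> th x <= x.
Proof.
move=> x0; have := th_lip x 0; rewrite th0 !subr0 (ger0_norm x0).
by apply: le_trans; exact: ler_norm.
Qed.

(** With $z=v/\tanh u$ and $T=\tanh^2u$ the right-hand side is $-z'$ along the limiting flow, so the
    claim is $(\arctan z)'\le-d$. For $T=0$, $q=1$ it expresses that $z^2+(al-be)z+al$ is positive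
    definite. Here [d] is a third of the relative discriminant gap: since $(1-d)(1-2d)\ge1-3d$, the
    gap pays for the left-hand side and for the terms with $T$. Values $q<1$ are harmless because
    $q\,al\ge al/be\ge1$. *)
Lemma riccati al be q T z : 1 <= be -> be < al -> (al - be) ^+ 2 < 4 * al ->
  let d := (1 - (al - be) ^+ 2 / (4 * al)) / 3 in
  be^-1 <= q <= 1 -> 0 <= T -> (1 + be) * T <= d ->
  d * (1 + z ^+ 2) <= z ^+ 2 * (1 - T) + q * ((al - be * (z ^+ 2 * T)) + (al - be) * z).
Proof.
move=> b1 ab disc d /andP[q1 q2] T0 Td.
have a0 : 0 < al by lra.
set c := al - be in disc d Td *.
have d3 : c ^+ 2 = 4 * al * (1 - 3 * d) by rewrite /d; field; rewrite gt_eqF.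
have d0 : 0 < d.
  rewrite /d divr_gt0 // subr_gt0 ltr_pdivrMr ?mul1r // mulr_gt0 //.
have d1 : d <= 1 / 3.
  by have := sqr_ge0 c; rewrite d3; nra.
have q0 : 0 < q by apply: lt_le_trans q1; rewrite invr_gt0; lra.
have z2 := sqr_ge0 z.
have k1 : q * (be * (z ^+ 2 * T)) <= be * T * z ^+ 2.
  rewrite (_ : be * (z ^+ 2 * T) = be * T * z ^+ 2); last by ring.
  by rewrite ler_piMl //; apply: mulr_ge0 => //; apply: mulr_ge0 => //; lra.
have k2 : (1 - 2 * d) * z ^+ 2 + c * z + al * (1 - d) >= 0.
  have h : 0 <= (2 * al * (1 - d) + c * z) ^+ 2 by exact: sqr_ge0.
  rewrite -(pmulr_rge0 _ (_ : 0 < 4 * al * (1 - d))); last by rewrite !mulr_gt0 //; lra.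
  rewrite [leRHS](_ : _ = (2 * al * (1 - d) + c * z) ^+ 2 + (4 * al * (1 - d) * (1 - 2 * d) - c ^+ 2) * z ^+ 2); last by ring.
  apply: addr_ge0 => //; apply: mulr_ge0 => //; rewrite d3.
  rewrite [leRHS](_ : _ = 8 * al * d ^+ 2); last by ring.
  by apply: mulr_ge0; [lra|exact: sqr_ge0].
have k3 : q * (c * z + al * (1 - d)) >= - ((1 - 2 * d) * z ^+ 2).
  have h1 : 0 <= (1 - 2 * d) * z ^+ 2 by apply: mulr_ge0 => //; lra.
  have : q * ((1 - 2 * d) * z ^+ 2) <= (1 - 2 * d) * z ^+ 2 by rewrite ler_piMl.
  have : 0 <= q * ((1 - 2 * d) * z ^+ 2 + c * z + al * (1 - d)) by rewrite mulr_ge0 // ltW.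
  by move: ((1 - 2 * d) * z ^+ 2) (c * z) (al * (1 - d)) => A B D; rewrite !mulrDr; (clear -A B D; lra).
have k4 : d <= q * (al * d).
  rewrite mulrA ler_peMl //; first exact: ltW.
  have : be * be^-1 <= al * q by apply: ler_pM; rewrite ?invr_ge0 //; (clear -b1 ab; lra).
  by rewrite divff ?gt_eqF //; [rewrite mulrC|(clear -b1; lra)].
have k5 : (1 + be) * T * z ^+ 2 <= d * z ^+ 2 by apply: ler_wpM2r.
rewrite (mulrDr q) (mulrBr q).
rewrite (mulrDr q) (mulrBr al) mulr1 (mulrBr q) in k3.
move: (q * al) (q * (be * (z ^+ 2 * T))) (q * (c * z)) (q * (al * d)) k1 k3 k4 => A1 A2 A3 A4 k1 k3 k4.
(clear -T d k5 A1 A2 A3 A4 k1 k3 k4; lra).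
Qed.

(** If $u$ stayed positive, $v$ would become and remain negative and $u$ would fall below every
    positive level. From then on [riccati] makes $\arctan(v/\tanh u)$ decrease at a fixed rate for
    ever, although it is bounded. The first two stages are needed because the discriminant condition
    controls the motion only near $u=0$. *)
Lemma no_positive_tail al be u v y1 : 1 <= be -> be < al -> (al - be) ^+ 2 < 4 * al ->
  (forall y, y1 <= y -> is_derive y 1 u (v y)) ->
  (forall y, y1 <= y -> is_derive y 1 v (force al be (-1) (u y) (v y))) ->
  (forall y, y1 <= y -> `|v y| <= vmax al be) ->
  ~ (forall y, y1 <= y -> 0 < u y).
Proof.
move=> b1 ab disc du dv hv up.
have V1 := vmax_gt1 al be b1 ab; set V := vmax al be in V1 hv.
have a0 : 0 < al by lra. have b0 : 0 < be by lra.
have VV : be * (V * V) = al by exact: vmax_sq.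
set c := al - be in disc; have c0 : 0 < c by rewrite /c; lra.
have fE y : force al be (-1) (u y) (v y) = - (qf al be (v y) * ((al - be * (v y * v y)) * th (u y) + c * v y)).
  by rewrite /force /c; ring.
have ib : 0 < be^-1 by rewrite invr_gt0.
have hh y : y1 <= y -> 0 <= al - be * (v y * v y) <= al.
  by move=> hy; apply: vmax_le_al => //; exact: hv.
have h34 y : `|v y| <= V / 2 -> 3 / 4 * al <= al - be * (v y * v y).
  move=> h; have : v y * v y <= V * V / 4 by rewrite ler_norml in h; nra.
  by move=> h'; have : be * (v y * v y) <= be * (V * V / 4) by [apply: ler_wpM2l => //; (clear -b1; lra)]; (clear -VV; lra).
(* A uniform bound from below on the bracket makes [v] decrease to [-oo]. *)
have decr y2 m : y1 <= y2 -> 0 < m ->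
    (forall y, y2 <= y -> m <= (al - be * (v y * v y)) * th (u y) + c * v y) -> False.
  move=> y12 m0 hm; have d0 : 0 < be^-1 * m by rewrite mulr_gt0.
  have [|y|y hy] := decr_unbounded v (fun y => force al be (-1) (u y) (v y)) y2 _ (- V) d0.
  - by move=> y hy; apply: dv; lra.
  - by move=> hy; rewrite fE lerN2; apply: ler_pM; rewrite ?hm ?qf_ge //; (clear -ib m0; lra).
  have /hv : y1 <= y by lra.
  by rewrite ler_norml; lra.
(* Otherwise $u$ stays above $u(y_1)$, and the bracket is bounded below by its restoring term where
   $v\le V/2$ and by its friction term where $v>V/2$. *)
have [y2 y12 v2] : exists2 y2, y1 <= y2 & v y2 < 0.
  apply: contrapT => H.
  have v0 y : y1 <= y -> 0 <= v y.
    by move=> hy; rewrite leNgt; apply/negP => ?; apply: H; exists y.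
  have u1 y : y1 <= y -> u y1 <= u y.
    by move=> hy; apply: (der_le_mono u v) => // z hz; [apply: du|apply: v0]; (clear -hz; lra).
  have t0 : 0 < th (u y1) by apply: th_gt0; apply: up.
  apply: (decr y1 (Num.min (3 / 4 * al * th (u y1)) (c * (V / 2)))) => //.
    by rewrite lt_min !mulr_gt0 //; (clear -V1; lra).
  move=> y hy; have hhy := hh y hy; have vy := v0 y hy; have uy := u1 y hy.
  have ty := th_le _ _ uy.
  case: (leP (v y) (V / 2)) => h.
    rewrite ge_min; apply/orP; left; have h' := h34 y; rewrite ger0_norm // in h'.
    have : 3 / 4 * al * th (u y1) <= (al - be * (v y * v y)) * th (u y).
      by apply: ler_pM => //; [(clear -b1 ab; lra)|(clear -t0; lra)|exact: h'].
    by have : 0 <= c * v y by [apply: mulr_ge0; (clear -c0 vy; lra)]; (clear -R; lra).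
  rewrite ge_min; apply/orP; right.
  have : c * (V / 2) <= c * v y by apply: ler_wpM2l; (clear -c0 h; lra).
  by have : 0 <= (al - be * (v y * v y)) * th (u y) by [apply: mulr_ge0; (clear -hhy t0 ty; lra)]; (clear -R; lra).
have vn y : y2 <= y -> v y < 0.
  move=> hy; apply: (barrier_lt v (fun y => force al be (-1) (u y) (v y)) y2) => // z hz.
    by apply: dv; lra.
  move=> vz; rewrite fE vz !mulr0 subr0 addr0 oppr_lt0 mulr_gt0 ?qf_pos // mulr_gt0 //.
  by apply: th_gt0; apply: up; (clear -y12 hz; lra).
have udec y y' : y2 <= y -> y <= y' -> u y' <= u y.
  move=> h1 h2; rewrite -lerN2; apply: (der_le_mono (fun z => - u z) (fun z => - v z)) => // z hz.
    by apply: derN; apply: du; (clear -y12 h1 hz; lra).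
  by have := vn z; (clear -h1 hz; lra).
have small eta : 0 < eta -> exists2 y3, y2 <= y3 & u y3 < eta.
  move=> eta0; apply: contrapT => H.
  have uge y : y2 <= y -> eta <= u y.
    by move=> hy; rewrite leNgt; apply/negP => ?; apply: H; exists y.
  have t0 := th_gt0 _ eta0; set t := th eta in t0.
  (* While $v>-\mu$ the restoring term is at least $3/4$ of $al\cdot t$ and friction removes at most
     $1/4$, so $v$ is driven down to $-\mu$ and stays there; then $u$ decreases linearly to 0. *)
  pose mu := Num.min (V / 2) (al * t / (4 * c)).
  have mu0 : 0 < mu by rewrite lt_min !divr_gt0 ?mulr_gt0 //; (clear -V1; lra).
  have mu1 : mu <= V / 2 by rewrite ge_min lexx.
  have mu2 : c * mu <= al * t / 4.
    have : mu <= al * t / (4 * c) by rewrite ge_min lexx orbT.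
    rewrite ler_pdivlMr; last by (clear -c0; lra).
    by (clear -R; lra).
  have brk y : y2 <= y -> - mu < v y -> al * t / 2 <= (al - be * (v y * v y)) * th (u y) + c * v y.
    move=> hy hm; have vy := vn y hy.
    have h' : 3 / 4 * al <= al - be * (v y * v y) by apply: h34; rewrite ler_norml; (clear -mu1 hm vy; lra).
    have : 3 / 4 * al * t <= (al - be * (v y * v y)) * th (u y).
      by apply: ler_pM => //; [(clear -b1 ab; lra)|(clear -t0; lra)|apply: th_le; exact: uge].
    have : c * - mu <= c * v y by apply: ler_wpM2l; (clear -c0 hm; lra).
    by have : 0 < al * t by [rewrite mulr_gt0]; (clear -mu2; lra).
  have [y3 y23 v3] : exists2 y3, y2 <= y3 & v y3 <= - mu.
    apply: contrapT => H'; apply: (decr y2 (al * t / 2)) => //.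
      by rewrite divr_gt0 // mulr_gt0.
    move=> y hy; apply: brk => //; rewrite ltNge; apply/negP => ?; apply: H'; by exists y.
  have vm y : y3 <= y -> v y <= - mu.
    move=> hy; suff : v y + mu <= 0 by (clear -R; lra).
    apply: (barrier_le (fun y => v y + mu) (fun y => force al be (-1) (u y) (v y)) y3) => //.
    - move=> z hz; have h0 := dv z ltac:(lra).
      by apply: der_eq (derD _ _ _ _ _ _ h0 (der_cst mu _ _)) _; rewrite addr0.
    - move=> z hz hm; rewrite fE oppr_le0 mulr_ge0 ?ltW ?qf_pos //.
      apply: lt_le_trans (brk z _ _); [by rewrite divr_gt0 // mulr_gt0|(clear -y23 hz; lra)|(clear -hm; lra)].
    - (clear -v3; lra).
  have [y hy uy] := decr_unbounded u v y3 mu 0 mu0 (fun y hy => du y (le_trans (le_trans y12 y23) hy)) vm.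
  by have := up y; (clear -y12 y23 hy uy; lra).
pose d := (1 - c ^+ 2 / (4 * al)) / 3.
have d0 : 0 < d.
  by rewrite /d divr_gt0 // subr_gt0 ltr_pdivrMr ?mul1r // mulr_gt0.
pose eta := Num.min 1 (d / (1 + be)).
have eta0 : 0 < eta by rewrite lt_min ltr01 divr_gt0 //; (clear -b1; lra).
have [y3 y23 u3] := small eta eta0.
have tp y : y3 <= y -> 0 < th (u y) by move=> hy; apply: th_gt0; apply: up; (clear -y12 y23 hy; lra).
have tT y : y3 <= y -> (1 + be) * th (u y) ^+ 2 <= d.
  move=> hy; have t0 := tp y hy.
  have uy : u y <= u y3 by apply: udec.
  have ty : th (u y) <= u y by apply: th_le_id; apply/ltW/up; (clear -y12 y23 hy; lra).
  have e1 : eta <= 1 by rewrite ge_min lexx.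
  have : eta <= d / (1 + be) by rewrite ge_min lexx orbT.
  rewrite ler_pdivlMr; last by (clear -b1; lra).
  have : th (u y) ^+ 2 <= eta by rewrite expr2; (clear -e1 u3 t0 uy ty; nra).
  move=> h h'; apply: le_trans h'; rewrite mulrC; apply: ler_wpM2r => //; (clear -b1; lra).
pose z y := v y / th (u y).
pose dz y := (force al be (-1) (u y) (v y) * th (u y) - v y * ((1 - th (u y) ^+ 2) * v y)) / th (u y) ^+ 2.
have hz y : y3 <= y -> is_derive y 1 z (dz y).
  move=> hy; have t0 := tp y hy; have y1y : y1 <= y by (clear -y12 y23 hy; lra).
  have tn : th (u y) != 0 by rewrite gt_eqF.
  have d1 := derV (fun y => th (u y)) _ _ _ tn (der_chain th u _ _ _ _ (du y y1y) (der_th (u y))).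
  apply: der_eq (derM _ _ _ _ _ _ (dv y y1y) d1) _.
  by rewrite /dz; field.
(* Any level at or below $-\pi/2$ would contradict the range of [atan]. *)
have [y hy] : exists2 y, y3 <= y & atan (z y) < - pi.
  apply: (decr_unbounded (fun y => atan (z y)) (fun y => (1 + z y ^+ 2)^-1 * dz y) y3 d) => // y hy.
    exact: (der_chain (@atan R) z _ _ _ _ (hz y hy) (is_derive1_atan (z y))).
  have z2 := sqr_ge0 (z y); have t0 := tp y hy.
  rewrite mulrC ler_pdivrMr; last by (clear -z2; lra).
  have -> : dz y = - (z y ^+ 2 * (1 - th (u y) ^+ 2) +
     qf al be (v y) * ((al - be * (z y ^+ 2 * th (u y) ^+ 2)) + c * z y)).
    by rewrite /dz fE /z; field; rewrite gt_eqF.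
  rewrite mulNr lerN2; apply: riccati => //.
  - by rewrite qf_ge ?qf_le1.
  - exact: sqr_ge0.
  - exact: tT.
have := atan_gtNpi2 (z y); have := pi_gt0 R; (clear -R; lra).
Qed.

End Oscillation.

(** * The polar angle of the phase curve *)

Section Angle.
Context {R : realType}.
Implicit Types (e x y z a b al be c : R).

Lemma der_sin (f : R -> R) x d : is_derive x 1 f d -> is_derive x 1 (fun y => sin (f y)) (cos (f x) * d).
Proof. by move=> h; apply: (der_chain (@sin R) f _ _ _ _ h); exact: is_derive_sin. Qed.

Lemma der_cos (f : R -> R) x d : is_derive x 1 f d -> is_derive x 1 (fun y => cos (f y)) (- sin (f x) * d).
Proof. by move=> h; apply: (der_chain (@cos R) f _ _ _ _ h); exact: is_derive_cos. Qed.

(** In the frame rotated by $t$ the pair $(u,v)$ has the component [N] along and, up to sign, [P]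
    across. The angular velocity is chosen so that [N], [P] and the length [r] all solve $f'=mf$.
    Hence [N / r] and [P / r] are constant, and the initial conditions make them 1 and 0. *)
Lemma polar_angle (u v du dv t : R -> R) y0 :
  (forall y, is_derive y 1 u (du y)) -> (forall y, is_derive y 1 v (dv y)) ->
  (forall y, 0 < u y ^+ 2 + v y ^+ 2) ->
  (forall y, is_derive y 1 t ((u y * dv y - du y * v y) / (u y ^+ 2 + v y ^+ 2))) ->
  u y0 * sin (t y0) - v y0 * cos (t y0) = 0 -> 0 < u y0 * cos (t y0) + v y0 * sin (t y0) ->
  forall y, u y = Num.sqrt (u y ^+ 2 + v y ^+ 2) * cos (t y).
Proof.
move=> hu hv k0 ht P0 N0 y.
pose k y := u y ^+ 2 + v y ^+ 2; pose r y := Num.sqrt (k y).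
have kr z : k z = r z ^+ 2 by rewrite sqr_sqrtr // ltW // k0.
have r0 z : 0 < r z by rewrite sqrtr_gt0 k0.
pose m y := (u y * du y + v y * dv y) / k y.
have dr z : is_derive z 1 r (m z * r z).
  have dk := derD _ _ _ _ _ _ (derX 2 _ _ _ _ (hu z)) (derX 2 _ _ _ _ (hv z)).
  apply: der_eq (der_chain (@Num.sqrt R) k _ _ _ _ dk (der_sqrt _ (k0 z))) _.
  rewrite -/(k z) -/(r z) /m kr /= !expr1; field; rewrite gt_eqF //; exact: r0.
pose P y := u y * sin (t y) - v y * cos (t y).
pose N y := u y * cos (t y) + v y * sin (t y).
have dP z : is_derive z 1 P (m z * P z).
  apply: der_eq (derB _ _ _ _ _ _ (derM _ _ _ _ _ _ (hu z) (der_sin _ _ _ (ht z)))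
    (derM _ _ _ _ _ _ (hv z) (der_cos _ _ _ (ht z)))) _.
  by rewrite /m /P /k; field; rewrite gt_eqF.
have dN z : is_derive z 1 N (m z * N z).
  apply: der_eq (derD _ _ _ _ _ _ (derM _ _ _ _ _ _ (hu z) (der_cos _ _ _ (ht z)))
    (derM _ _ _ _ _ _ (hv z) (der_sin _ _ _ (ht z)))) _.
  by rewrite /m /N /k; field; rewrite gt_eqF.
have cst (f : R -> R) : (forall z, is_derive z 1 f (m z * f z)) -> f y / r y = f y0 / r y0.
  move=> df; apply: (der_zero_cst (fun z => f z / r z)) => z.
  have rn : r z != 0 by rewrite gt_eqF.
  apply: der_eq (derM _ _ _ _ _ _ (df z) (derV r _ _ _ rn (dr z))) _.
  by field.
have P0' : P y0 = 0 := P0.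
have Py : P y = 0.
  have := cst P dP; rewrite P0' mul0r => /eqP; rewrite mulf_eq0 invr_eq0.
  by rewrite [r y == 0]gt_eqF // orbF => /eqP.
have cs z : cos (t z) ^+ 2 + sin (t z) ^+ 2 = 1 := cos2Dsin2 (t z).
have NP z : N z ^+ 2 + P z ^+ 2 = k z.
  rewrite (_ : _ + _ = k z * (cos (t z) ^+ 2 + sin (t z) ^+ 2)); last by rewrite /N /P /k; ring.
  by rewrite cs mulr1.
have Nr : N y0 = r y0.
  apply/eqP; rewrite -(eqrXn2 (n := 2)) //; last 2 first.
  - exact: ltW.
  - exact/ltW/r0.
  by rewrite -kr -NP P0' expr0n addr0.
have Ny : N y = r y.
  have ry := r0 y; have h := cst N dN; rewrite Nr divff ?gt_eqF // in h.
  have rV : (r y)^-1 != 0 by rewrite invr_neq0 // gt_eqF.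
  by apply: (mulIf rV); rewrite h divff // gt_eqF.
rewrite -/(k y) -/(r y) -Ny.
rewrite -[LHS]mulr1 -(cs y).
rewrite (_ : u y * _ = N y * cos (t y) + P y * sin (t y)); last by rewrite /N /P; ring.
by rewrite Py mul0r addr0.
Qed.

Lemma cos_shift k x : cos (x - k%:R * pi) = (-1) ^+ k * cos x :> R.
Proof.
elim: k => [|k IH]; first by rewrite mul0r subr0 expr0 mul1r.
have := cosDpi (x - k.+1%:R * pi); rewrite (_ : x - k.+1%:R * pi + pi = x - k%:R * pi); last first.
  by rewrite -natr1; ring.
by rewrite IH => h; rewrite exprS mulN1r mulNr h opprK.
Qed.


Lemma force_odd al be a b : force al be (-1) (- a) (- b) = - force al be (-1) a b :> R.
Proof. by rewrite /force /qf thN mulrNN; ring. Qed.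

(** The condition $2cd\le m$ keeps the perturbed denominator above $m/2$; the size of the quotient
    is needed at the reference point only. *)
Lemma quotient_close (n k n0 k0 d c M m : R) : 0 < m -> 0 <= d <= 1 -> 0 <= c -> 0 <= M ->
  m <= k0 -> 2 * c * d <= m -> `|n - n0| <= c * d -> `|k - k0| <= c * d -> `|n0| <= M * k0 ->
  `|n / k - n0 / k0| <= (1 + M) * (2 * c) / m * d.
Proof.
move=> m0 /andP[d0 d1] c0 M0 mk cm hn hk hM.
have k0p : 0 < k0 by lra.
have kp : m / 2 <= k by move: hk; rewrite ler_norml; lra.
have kp0 : 0 < k by lra.
rewrite (_ : _ - _ = ((n - n0) - n0 / k0 * (k - k0)) / k); last by field; rewrite !gt_eqF.
rewrite normrM normfV (gtr0_norm kp0) ler_pdivrMr //.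
have h1 : `|n0 / k0| <= M by rewrite normrM normfV (gtr0_norm k0p) ler_pdivrMr.
have cd : 0 <= c * d by rewrite mulr_ge0.
have h2 : `|n0 / k0 * (k - k0)| <= M * (c * d) by rewrite normrM; apply: ler_pM.
apply: le_trans (ler_normB _ _) _; apply: le_trans (lerD hn h2) _.
rewrite (_ : _ * d * k = (1 + M) * (c * d) * (2 * k / m)); last by field; rewrite gt_eqF.
have : 1 <= 2 * k / m by rewrite ler_pdivlMr // mul1r; lra.
have : 0 <= (1 + M) * (c * d) by apply: mulr_ge0; lra.
by move=> h3 h4; rewrite [leLHS](_ : _ = (1 + M) * (c * d) * 1); [apply: ler_wpM2l|ring].
Qed.

Section FamilyAngle.
Context (al be : R) (n : nat) (s0 : R) (g w u v : R -> R -> R).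

Local Notation V := (vmax al be).
Definition fam_force e y := force al be (friction e y) (u e y) (clip V (v e y)).
Definition fam_norm2 e y := u e y ^+ 2 + v e y ^+ 2.
Definition fam_wedge e y := u e y * fam_force e y - clip V (v e y) * v e y.
Local Notation F := fam_force.
Local Notation k := fam_norm2.
Local Notation num := fam_wedge.

(** Since $u-y=\ln g\le1/2$ near the pole, one base point serves all parameters. Having $u<0$ there
    gives a choice of initial angle that is continuous in [e]. *)
Lemma family_low : 1 <= be -> be < al -> family_spec al be n s0 g w u v ->
  exists y0, y0 <= -1 /\ forall e y, 0 <= e <= 1 -> y <= y0 -> u e y < 0.
Proof.
move=> b1 ab FS; have /andP[s00 _] := fs_s0 _ _ _ _ _ _ _ _ FS.
exists (Num.min (-1) (ln s0 / 2)); split; first by rewrite ge_min lexx.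
move=> e y he; rewrite le_min => /andP[y1 y2].
have hs : expR (2 * y) <= s0.
  by rewrite -[leRHS](@lnK _ s0) ?posrE // ler_expR mulrC -ler_pdivlMr.
have [-> _] := fs_local _ _ _ _ _ _ _ _ FS e y he hs.
have sa : `|expR (2 * y)| <= s0 by rewrite gtr0_norm ?expR_gt0.
have := fs_g _ _ _ _ _ _ _ _ FS e _ he sa; rewrite /local_u ler_norml.
set G := g e _ => hG.
have : ln (1 + (G - 1)) <= G - 1 by apply: le_ln1Dx; lra.
rewrite addrC subrK.
lra.
Qed.

(** A solution through the origin is constant by uniqueness, but $u<0$ far to the left. *)
Lemma family_k_gt0 e y : 1 <= be -> be < al -> family_spec al be n s0 g w u v ->
  0 <= e <= 1 -> 0 < k e y.
Proof.
move=> b1 ab FS he; rewrite lt_neqAle; apply/andP; split; last by rewrite addr_ge0 ?sqr_ge0.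
apply/eqP => /esym k0; have [y0 [_ hy0]] := family_low b1 ab FS.
have h1 := sqr_ge0 (u e y); have h2 := sqr_ge0 (v e y); rewrite /fam_norm2 in k0.
have /eqP : u e y ^+ 2 = 0 by lra.
have /eqP : v e y ^+ 2 = 0 by lra.
rewrite !sqrf_eq0 => /eqP v0 /eqP u0.
have e0 : 0 <= e by lra.
have := flow_zero al be e _ _ y b1 ab e0 (fs_flow _ _ _ _ _ _ _ _ FS e he) u0 v0 y0.
by have := hy0 e y0 he (lexx _); lra.
Qed.


Lemma clip_mul_gt0 (W x : R) : 0 < W -> x != 0 -> 0 < clip W x * x.
Proof.
move=> W0; rewrite neq_lt => /orP[x0|x0].
  rewrite nmulr_lgt0 // /clip.
  have x1 : x <= W by lra.
  by rewrite (min_r x1) gt_max x0 andbT; lra.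
by rewrite pmulr_lgt0 // /clip lt_max lt_min W0 x0 orbT.
Qed.

Lemma sq_le_norm (x y : R) : 0 <= y -> x ^+ 2 <= y ^+ 2 -> `|x| <= y.
Proof.
by move=> y0 h; rewrite -(ler_sqr (x := `|x|)) ?nnegrE // real_normK // num_real.
Qed.

(** On the compact interval the squared length at [e0] has a positive minimum, so [quotient_close]
    makes the angular velocity Lipschitz at [e0], uniformly in [y]. *)
Lemma num_close e0 y0 Y : 1 <= be -> be < al -> family_spec al be n s0 g w u v ->
  0 <= e0 <= 1 -> y0 <= Y -> exists C r, [/\ 0 <= C, 0 < r <= 1 &
    forall e y, 0 <= e <= 1 -> `|e - e0| < r -> y0 <= y <= Y ->
     [/\ `|u e y - u e0 y| <= C * `|e - e0|, `|v e y - v e0 y| <= C * `|e - e0| &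
     `|num e y / k e y - num e0 y / k e0 y| <= C * `|e - e0|]].
Proof.
move=> b1 ab FS he0 y0Y.
have [c c0 hc] := fs_lip _ _ _ _ _ _ _ _ FS Y.
have [CF CF1 hF] := force_lip al be b1 ab.
have V1 := vmax_gt1 al be b1 ab.
have a0 : 0 < al by lra.
have [du0 dv0] := fs_flow _ _ _ _ _ _ _ _ FS e0 he0.
have cu : continuous (u e0) by move=> y; exact: der_cont (du0 y).
have cv : continuous (v e0) by move=> y; exact: der_cont (dv0 y).
have [yu _ hu] := EVT_max y0Y (continuous_subspaceT (fun y => cvg_norm (cu y))).
have [yv _ hv] := EVT_max y0Y (continuous_subspaceT (fun y => cvg_norm (cv y))).
have ck : continuous (k e0).
  rewrite (_ : k e0 = fun y => u e0 y * u e0 y + v e0 y * v e0 y); last first.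
    by apply/funext => y; rewrite /fam_norm2 !expr2.
  by apply: contD; exact: contM.
have [yk _ hk] := EVT_min y0Y (continuous_subspaceT ck).
set m := k e0 yk in hk; have m0 : 0 < m by exact: (family_k_gt0 _ _ b1 ab FS he0).
set M := `|u e0 yu| + `|v e0 yv|.
have M0 : 0 <= M by rewrite addr_ge0.
pose c1 := c + 1; pose E := 2 * expR (2 * Y); pose c2 := CF * (E + 2 * c1).
pose MF := al + al * V.
have MF0 : 0 <= MF by rewrite addr_ge0 ?mulr_ge0 //; (clear -al be n s0 g w u v b1 ab V1; lra).
have E0 : 0 <= E by rewrite mulr_ge0 // expR_ge0.
have c10 : 0 <= c1 by rewrite /c1; lra.
have c20 : 0 <= c2 by rewrite /c2 mulr_ge0 //; (clear -al be n s0 g w u v CF CF1 Y c c1 E E0 c10; lra).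
pose C3 := (M + c1) * c2 + MF * c1 + (V * c1 + M * c1) + 2 * ((2 * M + c1) * c1).
have p1 : 0 <= (M + c1) * c2 by rewrite mulr_ge0 // addr_ge0.
have p2 : 0 <= MF * c1 by rewrite mulr_ge0.
have p3 : 0 <= V * c1 + M * c1 by rewrite addr_ge0 // mulr_ge0 //; (clear -al be n s0 g w u v V1; lra).
have p4 : 0 <= (2 * M + c1) * c1 by rewrite mulr_ge0 // addr_ge0 // mulr_ge0.
have C30 : 0 <= C3 by rewrite /C3; lra.
pose M' := (M * MF + V * M) / m.
have M'0 : 0 <= M' by rewrite divr_ge0 ?(ltW m0) // addr_ge0 // mulr_ge0 //; (clear -al be n s0 g w u v V1; lra).
pose C := c1 + (1 + M') * (2 * C3) / m.
have q0 : 0 <= (1 + M') * (2 * C3) / m.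
  by rewrite divr_ge0 ?(ltW m0) // mulr_ge0 //; (clear -al be n s0 g w u v e0 yu yv yk m M MF M' M'0 Y c CF c1 E c2 C3 C30; lra).
exists C, (Num.min 1 (m / (2 * (C3 + 1)))); split.
- by rewrite /C; (clear -al be n s0 g w u v e0 Y c CF yu yv yk m M c1 E c2 MF c10 C3 M' q0; lra).
- by rewrite lt_min ltr01 ge_min lexx /= andbT divr_gt0 //; (clear -al be n s0 g w u v e0 Y c CF yu yv M c1 E c2 MF C3 C30; lra).
move=> e y he; rewrite lt_min => /andP[d1 d2] hy.
set d := `|e - e0| in d1 d2 *; have d0 : 0 <= d by exact: normr_ge0.
have [_ yY] := andP hy.
have yin : y \in `[y0, Y] by rewrite in_itv.
have H := hc e e0 y he he0 yY.
have hd : `|e - e0| ^+ 2 = (e - e0) ^+ 2 by rewrite real_normK // num_real.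
have cc1 : c * d ^+ 2 <= (c1 * d) ^+ 2.
  by rewrite exprMn; apply: ler_wpM2r; [exact: sqr_ge0|rewrite /c1; (clear -al be n s0 g w u v c; nra)].
have hu1 : `|u e y - u e0 y| <= c1 * d.
  apply: sq_le_norm; first exact: mulr_ge0.
  by apply: le_trans cc1; rewrite /d hd; apply: le_trans H; rewrite lerDl sqr_ge0.
have hv1 : `|v e y - v e0 y| <= c1 * d.
  apply: sq_le_norm; first exact: mulr_ge0.
  by apply: le_trans cc1; rewrite /d hd; apply: le_trans H; rewrite lerDr sqr_ge0.
have W0 : 0 <= V by exact: le_trans ler01 (ltW V1).
have cl e' y' : `|clip V (v e' y')| <= V by exact: clip_bound.
have [e00 _] := andP he; have [e000 _] := andP he0.
have hcl : `|clip V (v e y) - clip V (v e0 y)| <= c1 * d by apply: le_trans (clip_lip _ _ _) hv1.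
have hF1 : `|F e y - F e0 y| <= c2 * d.
  apply: le_trans (hF _ _ _ _ _ _ (friction_bound e y e00) (friction_bound e0 y e000) (cl _ _) (cl _ _)) _.
  rewrite /c2 -mulrA; apply: ler_wpM2l; first by exact: le_trans ler01 CF1.
  have hT : `|friction e y - friction e0 y| <= E * d.
    apply: le_trans (friction_lip _ _ _ e00 e000) _; apply: ler_wpM2r => //.
    by rewrite /E ler_pM2l // ler_expR ler_pM2l.
  rewrite (_ : (E + 2 * c1) * d = E * d + c1 * d + c1 * d); last by ring.
  by apply: lerD => //; apply: lerD.
have Mu : `|u e0 y| <= M by apply: le_trans (hu y yin) _; rewrite lerDl.
have Mv : `|v e0 y| <= M by apply: le_trans (hv y yin) _; rewrite lerDr.
have MFb : `|F e0 y| <= MF by apply: force_bound => //; exact: friction_bound.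
have c1d : c1 * d <= c1 by rewrite ler_piMr // ltW.
have Mu' : `|u e y| <= M + c1.
  rewrite (_ : u e y = u e0 y + (u e y - u e0 y)); last by ring.
  by apply: le_trans (ler_normD _ _) _; clear -Mu hu1 c1d; lra.
have Mv' : `|v e y| <= M + c1.
  rewrite (_ : v e y = v e0 y + (v e y - v e0 y)); last by ring.
  by apply: le_trans (ler_normD _ _) _; clear -Mv hv1 c1d; lra.
have c1C : c1 <= C by rewrite /C; clear -q0; lra.
split; first by apply: le_trans hu1 _; exact: ler_wpM2r.
  by apply: le_trans hv1 _; exact: ler_wpM2r.
have k1 := ler_pM (normr_ge0 _) (normr_ge0 _) Mu' hF1.
have k2 := ler_pM (normr_ge0 _) (normr_ge0 _) MFb hu1.
have k3 := ler_pM (normr_ge0 _) (normr_ge0 _) (cl e y) hv1.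
have k4 := ler_pM (normr_ge0 _) (normr_ge0 _) Mv hcl.
rewrite -!normrM in k1 k2 k3 k4.
have S2 (a b : R) : `|a| <= M + c1 -> `|b| <= M -> `|a - b| <= c1 * d ->
    `|a ^+ 2 - b ^+ 2| <= (2 * M + c1) * c1 * d.
  move=> h1 h2 h3; rewrite subr_sqr normrM mulrC -mulrA; apply: ler_pM => //.
  by apply: le_trans (ler_normD _ _) _; clear -h1 h2; lra.
have k5 := S2 _ _ Mu' Mu hu1; have k6 := S2 _ _ Mv' Mv hv1.
have C3d : C3 * d = (M + c1) * (c2 * d) + MF * (c1 * d) + (V * (c1 * d) + M * (c1 * d)) +
   2 * ((2 * M + c1) * c1 * d) by rewrite /C3; ring.
have r1 : 0 <= (M + c1) * (c2 * d) by apply: mulr_ge0; [exact: addr_ge0|exact: mulr_ge0].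
have r2 : 0 <= MF * (c1 * d) by apply: mulr_ge0 => //; exact: mulr_ge0.
have r3 : 0 <= V * (c1 * d) + M * (c1 * d) by apply: addr_ge0; apply: mulr_ge0 => //; exact: mulr_ge0.
have r4 : 0 <= (2 * M + c1) * c1 * d by exact: mulr_ge0.
have hnum : `|num e y - num e0 y| <= C3 * d.
  rewrite (_ : _ - _ = u e y * (F e y - F e0 y) + F e0 y * (u e y - u e0 y) -
    (clip V (v e y) * (v e y - v e0 y) + v e0 y * (clip V (v e y) - clip V (v e0 y)))); last first.
    by rewrite /fam_wedge; ring.
  apply: le_trans (ler_normB _ _) _; rewrite C3d.
  have := ler_normD (u e y * (F e y - F e0 y)) (F e0 y * (u e y - u e0 y)).
  have := ler_normD (clip V (v e y) * (v e y - v e0 y)) (v e0 y * (clip V (v e y) - clip V (v e0 y))).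
  by clear -k1 k2 k3 k4 r4; lra.
have hkk : `|k e y - k e0 y| <= C3 * d.
  rewrite /fam_norm2 opprD addrACA C3d; apply: le_trans (ler_normD _ _) _.
  by clear -k5 k6 r1 r2 r3; lra.
have hM' : `|num e0 y| <= M' * k e0 y.
  apply: (@le_trans _ _ (M' * m)); last by apply: ler_wpM2l => //; exact: hk.
  rewrite /M' divfK ?gt_eqF //; apply: le_trans (ler_normB _ _) _.
  have n1 := ler_pM (normr_ge0 _) (normr_ge0 _) Mu MFb; rewrite -normrM in n1.
  have n2 := ler_pM (normr_ge0 _) (normr_ge0 _) (cl e0 y) Mv; rewrite -normrM in n2.
  exact: lerD.
have dle : 2 * C3 * d <= m.
  have h : 0 < 2 * (C3 + 1) by clear -C30; lra.
  by rewrite ltr_pdivlMr // in d2; clear -d2 d0; lra.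
have dd : 0 <= d <= 1 by rewrite d0 ltW.
apply: le_trans (quotient_close _ _ _ _ d C3 M' m m0 dd C30 M'0 (hk y yin) dle hnum hkk hM') _.
by apply: ler_wpM2r => //; rewrite /C; clear -c10; lra.
Qed.

Lemma angle_exists : 1 <= be -> be < al -> family_spec al be n s0 g w u v ->
  exists y0 (t : R -> R -> R),
  [/\ forall e y, 0 <= e <= 1 -> is_derive y 1 (t e) (num e y / k e y),
      forall e y, 0 <= e <= 1 -> u e y = Num.sqrt (k e y) * cos (t e y),
      forall e, 0 <= e <= 1 -> t e y0 < 3 / 2 * pi &
      forall e0 Y, 0 <= e0 <= 1 -> y0 <= Y -> exists C r, [/\ 0 <= C, 0 < r <= 1 &
        forall e y, 0 <= e <= 1 -> `|e - e0| < r -> y0 <= y <= Y -> `|t e y - t e0 y| <= C * `|e - e0|]].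
Proof.
move=> b1 ab FS; have [y0 [_ hy0]] := family_low b1 ab FS.
have hk e y : 0 <= e <= 1 -> 0 < k e y by move=> he; exact: family_k_gt0.
have fl e he := fs_flow _ _ _ _ _ _ _ _ FS e he.
have cQ e : 0 <= e <= 1 -> continuous (fun y => num e y / k e y).
  move=> he; have [du dv] := fl e he; have [e0 _] := andP he.
  have cu : continuous (u e) by move=> y; exact: der_cont (du y).
  have cv : continuous (v e) by move=> y; exact: der_cont (dv y).
  apply: contM.
    apply: contD; first by apply: contM => //; exact: force_cont.
    apply: contN; apply: contM => //; apply: (cont_comp (clip V) (v e)) => //; exact: clip_cont.
  apply: contV => [y|]; first exact: hk.
  rewrite (_ : k e = fun y => u e y * u e y + v e y * v e y); last first.
    by apply/funext => y; rewrite /fam_norm2 !expr2.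
  by apply: contD; exact: contM.
(* The branch of the angle for $u<0$: it lies below $3\pi/2$, the first of the nodes counted
   downwards. *)
pose t0 e := pi + atan (v e y0 / u e y0).
pose t e y := t0 e + (prim (fun y => num e y / k e y) y - prim (fun y => num e y / k e y) y0).
have tt e : t e y0 = t0 e by rewrite /t subrr addr0.
have dt e y : 0 <= e <= 1 -> is_derive y 1 (t e) (num e y / k e y).
  by move=> he; exact: (prim_from (t0 e) y0 _ (cQ e he) y).
have un e : 0 <= e <= 1 -> u e y0 < 0 by move=> he; apply: hy0.
exists y0, t; split=> //.
- move=> e y he; have [du dv] := fl e he.
  have u0 := un e he; set a := atan (v e y0 / u e y0).
  have ca : 0 < cos a by rewrite cos_atan invr_gt0 sqrtr_gt0; have := sqr_ge0 (v e y0 / u e y0); lra.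
  have sa : sin a = v e y0 / u e y0 * cos a.
    by rewrite -{1}(atanK (v e y0 / u e y0)) -/a /tan divfK // gt_eqF.
  have ct : cos (t0 e) = - cos a by rewrite /t0 addrC cosDpi.
  have st : sin (t0 e) = - (v e y0 / u e y0 * cos a) by rewrite /t0 addrC sinDpi sa.
  have un0 : u e y0 != 0 by rewrite lt_eqF.
  apply: (polar_angle (u e) (v e) (fun y => clip V (v e y)) (F e) (t e) y0 du dv
    (fun z => hk e z he) (fun z => dt e z he)).
  + by rewrite tt ct st; field.
  + rewrite tt ct st (_ : _ + _ = k e y0 * (cos a / - u e y0)); last by rewrite /fam_norm2; field.
    by rewrite mulr_gt0 ?hk // divr_gt0 //; lra.
- move=> e he; rewrite tt /t0; have := atan_ltpi2 (v e y0 / u e y0); lra.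
- move=> e0 Y he0 y0Y; have [C [r [C0 /andP[r0 r1] hC]]] := num_close e0 y0 Y b1 ab FS he0 y0Y.
  pose m := - u e0 y0; have m0 : 0 < m by have := un e0 he0; rewrite /m; lra.
  pose M := `|v e0 y0| / m; have M0 : 0 <= M by rewrite divr_ge0 // ltW.
  pose C1 := (1 + M) * (2 * C) / m.
  have C10 : 0 <= C1 by rewrite /C1 divr_ge0 ?(ltW m0) // mulr_ge0 //; lra.
  have yY0 : 0 <= Y - y0 by lra.
  exists (C1 + C * (Y - y0)), (Num.min r (m / (2 * (C + 1)))); split.
  + by rewrite addr_ge0 // mulr_ge0.
  + by rewrite lt_min r0 ge_min r1 /= andbT divr_gt0 //; lra.
  + move=> e y he; rewrite lt_min => /andP[d1 d2] hy.
    set d := `|e - e0| in d1 d2 *; have d0 : 0 <= d by exact: normr_ge0.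
    have dle : 2 * C * d <= m.
      have h : 0 < 2 * (C + 1) by lra.
      by rewrite ltr_pdivlMr // in d2; lra.
    have y00 : y0 <= y0 <= Y by rewrite lexx.
    have [hu hv _] := hC e y0 he d1 y00; rewrite -/d in hu hv.
    have hq : `|- v e y0 / - u e y0 - - v e0 y0 / - u e0 y0| <= C1 * d.
      apply: (quotient_close _ _ _ _ d C M m) => //.
      - by rewrite d0; (clear -al be n s0 g w u v e0 r r1 e d d1; lra).
      - by rewrite -opprD normrN.
      - by rewrite -opprD normrN.
      - by rewrite normrN -/m /M divfK // gt_eqF.
    have hat : `|t0 e - t0 e0| <= C1 * d.
      rewrite /t0 opprD addrACA subrr add0r; apply: le_trans hq.
      rewrite !mulNr !invrN !mulrN !opprK.
      move: (v e y0 / u e y0) (v e0 y0 / u e0 y0) => a b.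
      have L x z : x <= z -> `|atan z - atan x| <= z - x.
        move=> xz; rewrite -[leRHS]mul1r; apply: (der_lip (@atan R) (fun x => (1 + x ^+ 2)^-1)) => // q _.
        have q2 := sqr_ge0 q; rewrite gtr0_norm ?invr_gt0; last by (clear -al be n s0 g w u v q q2; lra).
        by rewrite invf_le1; (clear -al be n s0 g w u v q q2; lra).
      case: (leP b a) => h; first by rewrite (@ger0_norm _ (a - b)) ?subr_ge0 // L.
      by rewrite distrC (distrC a) (@gtr0_norm _ (b - a)) ?subr_gt0 // L // ltW.
    have [y0y yY] := andP hy.
    have := der_lip (fun z => t e z - t e0 z) (fun z => num e z / k e z - num e0 z / k e0 z) (C * d) y0 y y0y.
    rewrite !tt => H; have {H} H : `|t e y - t e0 y - (t0 e - t0 e0)| <= C * d * (y - y0).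
      apply: H => z hz; first by apply: derB; apply: dt.
      by have [|_ _ h] := hC e z he d1 _; [(clear -al be n s0 g w u v y0 Y y hy z hz; lra)|exact: h].
    rewrite (_ : t e y - t e0 y = (t0 e - t0 e0) + (t e y - t e0 y - (t0 e - t0 e0))); last by ring.
    apply: le_trans (ler_normD _ _) _; rewrite mulrDl; apply: lerD => //.
    apply: (le_trans H); rewrite mulrAC; apply: ler_wpM2r => //; apply: ler_wpM2l => //; (clear -al be n s0 g w u v y0 Y y hy; lra).
Qed.

End FamilyAngle.
End Angle.

(** * Zeros at the equator *)

Section Zeros.
Context {R : realType}.
Implicit Types (e x y z c : R).

Lemma cos_node j : cos (3 / 2 * pi - j%:R * pi) = 0 :> R.
Proof.
rewrite cos_shift (_ : 3 / 2 * pi = pi / 2 + pi); last by field.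
by rewrite cosDpi cos_pihalf oppr0 mulr0.
Qed.

Lemma cos_between j x : 3 / 2 * pi - j.+1%:R * pi < x < 3 / 2 * pi - j%:R * pi ->
  (-1) ^+ j * cos x < 0 :> R.
Proof.
rewrite -natr1 => h; have p0 := pi_gt0 R.
have := cos_shift j (x + j%:R * pi); rewrite addrK => ->.
rewrite mulrA -expr2 sqrr_sign mul1r.
rewrite (_ : x + j%:R * pi = (x + j%:R * pi - pi) + pi); last by ring.
by rewrite cosDpi oppr_lt0 cos_gt0_pihalf //; lra.
Qed.

Section FamilyZeros.
Context (al be : R) (n : nat) (s0 : R) (g w u v : R -> R -> R).
Context (y0 : R) (t : R -> R -> R).
Local Notation num := (fam_wedge al be u v).
Local Notation k := (fam_norm2 u v).

Lemma angle_barrier e c y1 y : 1 <= be -> be < al -> family_spec al be n s0 g w u v ->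
  (forall e y, 0 <= e <= 1 -> is_derive y 1 (t e) (num e y / k e y)) ->
  (forall e y, 0 <= e <= 1 -> u e y = Num.sqrt (k e y) * cos (t e y)) ->
  0 <= e <= 1 -> cos c = 0 -> y1 <= y -> t e y1 < c -> t e y < c.
Proof.
move=> b1 ab FS dt uE he cc y1y hc; rewrite -subr_lt0.
apply: (barrier_lt (fun z => t e z - c) (fun z => num e z / k e z) y1) => //; last by rewrite subr_lt0.
  by move=> z _; apply: der_eq (derB _ _ _ _ _ _ (dt e z he) (der_cst c _ _)) _; rewrite subr0.
move=> z _ /eqP; rewrite subr_eq0 => /eqP tz.
have kp : 0 < k e z by exact: family_k_gt0 b1 ab FS he.
have u0 : u e z = 0 by rewrite uE // tz cc mulr0.
have v0 : v e z != 0.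
  by apply/eqP => v0; move: kp; rewrite /fam_norm2 u0 v0 expr0n addr0 ltxx.
rewrite ltr_pdivrMr // mul0r /fam_wedge u0 mul0r sub0r oppr_lt0.
by apply: clip_mul_gt0 => //; apply: lt_trans (vmax_gt1 al be b1 ab).
Qed.

(** If the next node were never passed, the angle would stay strictly between two nodes, and $u$
    would have the constant sign given by the parity of [j]. For constant friction the force is odd
    in $(u,v)$, so [no_positive_tail] excludes both signs. *)
Lemma angle_limit j : 1 <= be -> be < al -> (al - be) ^+ 2 < 4 * al ->
  family_spec al be n s0 g w u v ->
  (forall e y, 0 <= e <= 1 -> is_derive y 1 (t e) (num e y / k e y)) ->
  (forall e y, 0 <= e <= 1 -> u e y = Num.sqrt (k e y) * cos (t e y)) ->
  t 0 y0 < 3 / 2 * pi -> exists2 y, y0 <= y & t 0 y < 3 / 2 * pi - j%:R * pi.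
Proof.
move=> b1 ab disc FS dt uE t0.
have h0 : 0 <= (0 : R) <= 1 by rewrite lexx ler01.
elim: j => [|j [y1 y01 IH]]; first by exists y0 => //; rewrite mul0r subr0.
apply: contrapT => H.
have below y : y1 <= y -> t 0 y < 3 / 2 * pi - j%:R * pi.
  by move=> hy; apply: angle_barrier b1 ab FS dt uE h0 (cos_node j) hy IH.
(* Touching the node already suffices: the angle moves below it at once and, by [angle_barrier], is
   still below at $y+1$. *)
have above y : y1 <= y -> 3 / 2 * pi - j.+1%:R * pi < t 0 y.
  move=> hy; rewrite ltNge; apply/negP => hle.
  have cn := cos_node j.+1; set c := _ - _ in hle cn H.
  have tz : t 0 y = c.
    apply/eqP; rewrite eq_le hle leNgt; apply/negP => hlt; apply: H; exists y => //; lra.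
  apply: H; exists (y + 1); first by lra.
  have D : is_derive y 1 (fun z => c - t 0 z) (- (num 0 y / k 0 y)).
    by apply: der_eq (derB _ _ _ _ _ _ (der_cst c _ _) (dt 0 y h0)) _; rewrite sub0r.
  have kp : 0 < k 0 y by exact: family_k_gt0 b1 ab FS h0.
  have u0 : u 0 y = 0 by rewrite uE // tz cn mulr0.
  have v0 : v 0 y != 0.
    by apply/eqP => v0; move: kp; rewrite /fam_norm2 u0 v0 expr0n addr0 ltxx.
  have dn : 0 < - (num 0 y / k 0 y).
    rewrite oppr_gt0 ltr_pdivrMr // mul0r /fam_wedge u0 mul0r sub0r oppr_lt0.
    by apply: clip_mul_gt0 => //; apply: lt_trans (vmax_gt1 al be b1 ab).
  have [|r r0 hr] := der_ed _ y _ D (- (num 0 y / k 0 y) / 2); first by lra.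
  pose h := Num.min (1 / 2) (r / 2).
  have hp : 0 < h by rewrite lt_min; apply/andP; split; (clear -al be n s0 g w u v y0 t r0; lra).
  have h1 : h <= 1 / 2 by rewrite ge_min lexx.
  have h2 : h <= r / 2 by rewrite ge_min lexx orbT.
  have hlt : t 0 (y + h) < c.
    have := hr h; rewrite gtr0_norm // => /(_ ltac:(lra)).
    rewrite ler_norml tz subrr subr0 => /andP[h3 _].
    by move: (- (num 0 y / k 0 y)) dn h3 => q dn h3; (clear -al be n s0 g w u v y0 t h hp dn h3; nra).
  by apply: (angle_barrier 0 c (y + h)) b1 ab FS dt uE h0 cn _ hlt; lra.
have [du dv] := fs_flow _ _ _ _ _ _ _ _ FS 0 h0.
have vb y : `|v 0 y| <= vmax al be.
  by apply: (v_bound al be n s0 g w u v) => //; rewrite mul0r ler01.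
have sg y : y1 <= y -> (-1) ^+ j * u 0 y < 0.
  move=> hy; rewrite uE // mulrCA pmulr_rlt0; last by rewrite sqrtr_gt0; exact: family_k_gt0 b1 ab FS h0.
  by apply: cos_between; rewrite above // below.
have du' y : is_derive y 1 (u 0) (v 0 y) by move: (du y); rewrite clip_id.
have dv' y : is_derive y 1 (v 0) (force al be (-1) (u 0 y) (v 0 y)).
  by move: (dv y); rewrite clip_id // friction0.
case jo : (odd j).
  apply: (no_positive_tail al be (u 0) (v 0) y1) => // y hy.
  by have := sg y hy; rewrite -signr_odd jo expr1; lra.
apply: (no_positive_tail al be (fun y => - u 0 y) (fun y => - v 0 y) y1) => //.
- by move=> y _; rewrite force_odd; apply: derN.
- by move=> y _; rewrite normrN.
- by move=> y hy; have := sg y hy; rewrite -signr_odd jo expr0; lra.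
Qed.
End FamilyZeros.

Theorem zeros_exist al be n s0 g w u v e1 : 1 <= be -> be < al -> (al - be) ^+ 2 < 4 * al ->
  family_spec al be n s0 g w u v -> 0 < e1 < 1 ->
  exists e, 0 < e <= e1 /\ u e (- ln e / 2) = 0.
Proof.
move=> b1 ab disc FS /andP[e10 e11].
have [y0 [t [dt uE tlt tc]]] := angle_exists _ _ _ _ _ _ _ _ b1 ab FS.
pose L e := - ln e / 2 : R.
have h0 : 0 <= (0 : R) <= 1 by rewrite lexx ler01.
(* Restrict to parameters for which [L e] lies to the right of the base point [y0]. *)
pose e2 := Num.min e1 (expR (- 2 * y0) / 2).
have e20 : 0 < e2 by rewrite lt_min e10 divr_gt0 // expR_gt0.
have e21 : e2 <= e1 by rewrite ge_min lexx.
have L_gt e y : 0 < e -> e < expR (- 2 * y) -> y < L e.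
  move=> e0 he; have : ln e < - 2 * y by rewrite -ltr_expR lnK ?posrE.
  by rewrite /L; lra.
have Ly0 e : 0 < e <= e2 -> y0 < L e.
  move=> /andP[e0 he]; apply: L_gt => //; apply: (le_lt_trans he).
  have E := expR_gt0 (- 2 * y0); apply: (@le_lt_trans _ _ (expR (- 2 * y0) / 2)); last by lra.
  by rewrite ge_min lexx orbT.
pose T e := t e (L e).
(* The equatorial angle is above this node at [e2] and will be below it at a smaller parameter [e3],
   because the limiting flow passes the node at a finite time [y1]. *)
have [j hj] : exists j : nat, 3 / 2 * pi - j%:R * pi < T e2.
  pose x := (3 / 2 * pi - T e2) / pi.
  exists (Num.bound `|x|).
  have h2 := archi_boundP (normr_ge0 x); have h1 := ler_norm x.
  have p0 := pi_gt0 R.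
  have : x < (Num.bound `|x|)%:R by exact: le_lt_trans h1 h2.
  rewrite /x ltr_pdivrMr //; lra.
have [y1 y01 hy1] := angle_limit al be n s0 g w u v y0 t j b1 ab disc FS dt uE (tlt 0 h0).
set c := 3 / 2 * pi - j%:R * pi in hj hy1.
have [C [r [C0 /andP[r0 r1] hC]]] := tc 0 y1 h0 y01.
(* In turn: stay left of [e2]; stay in the range of the continuity estimate; put the equator beyond
   [y1]; move the angle at [y1] by less than its distance from the node. *)
pose e3 := Num.min (Num.min e2 (r / 2)) (Num.min (expR (- 2 * y1) / 2) ((c - t 0 y1) / (2 * (C + 1)))).
have Ey1 := expR_gt0 (- 2 * y1).
have e30 : 0 < e3.
  rewrite /e3 lt_min; apply/andP; split; rewrite lt_min; apply/andP; split => //.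
  - by rewrite divr_gt0.
  - by rewrite divr_gt0.
  - by rewrite divr_gt0; (clear -b1 hy1 C0; lra).
have e32 : e3 <= e2 by rewrite /e3 2!ge_min lexx.
have e3r : e3 <= r / 2 by rewrite /e3 2!ge_min lexx orbT.
have e3y : e3 <= expR (- 2 * y1) / 2 by rewrite /e3 ge_min (ge_min _ (expR _ / 2)) lexx orbT.
have e3c : e3 <= (c - t 0 y1) / (2 * (C + 1)) by rewrite /e3 ge_min (ge_min _ (expR _ / 2)) lexx !orbT.
have he3 : 0 <= e3 <= 1 by (clear -e11 e21 e30 e32; lra).
have T3 : T e3 < c.
  apply: (angle_barrier al be n s0 g w u v t e3 c y1 (L e3) b1 ab FS dt uE he3 (cos_node j)).
    by apply/ltW/L_gt => //; (clear -Ey1 e3y; lra).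
  have := hC e3 y1 he3; rewrite subr0 (gtr0_norm e30) y01 lexx => /(_ ltac:(lra) isT).
  rewrite ler_norml; move: e3c; rewrite ler_pdivlMr; last by (clear -C0; lra).
  have : C * e3 <= (C + 1) * e3 by rewrite ler_pM2r //; (clear -R; lra).
  (clear -hy1; nra).
(* Both the solution and the point of evaluation move with [e]. The estimate uniform in [y] up to
   [L e + 1] controls the first change, continuity in [y] the second. *)
have cT e : 0 < e < 1 -> y0 < L e -> {for e, continuous T}.
  clear -dt tc; move=> he yL; apply/cont_ed => eta eta0.
  have he' : 0 <= e <= 1 by lra.
  have [C' [r' [C'0 /andP[r'0 r'1] hC']]] := tc e (L e + 1) he' ltac:(lra).
  have /cont_ed cl : {for e, continuous L}.
    have e00 : 0 < e by lra.
    exact: (der_cont _ _ _ (derM _ _ _ _ _ _ (derN (@ln R) e 1 _ (is_derive1_ln e00)) (der_cst (2^-1) e 1))).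
  have /cont_ed ct : {for L e, continuous (t e)} by exact: der_cont (dt e (L e) he').
  have [d1 d10 h1] := ct (eta / 2) ltac:(lra).
  have [d2 d20 h2] := cl (Num.min d1 (Num.min 1 (L e - y0))) ltac:(rewrite !lt_min d10 ltr01 subr_gt0 yL //).
  exists (Num.min (Num.min d2 r') (Num.min (Num.min e (1 - e)) (eta / (2 * (C' + 1))))).
    by rewrite !lt_min d20 r'0 divr_gt0 //=; (clear -he C'0; lra).
  move=> z; rewrite !lt_min => /andP[/andP[z1 z2] /andP[/andP[z3 z4] z5]].
  have hz : 0 <= z <= 1 by move: z3 z4; rewrite !ltr_norml; (clear -R; lra).
  have := h2 z z1; rewrite !lt_min => /andP[l1 /andP[l2 l3]].
  have k1 := h1 _ l1.
  have yy : y0 <= L z <= L e + 1 by move: l2 l3; rewrite !ltr_norml; (clear -R; lra).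
  have k2 := hC' z (L z) hz z2 yy.
  have k3 : C' * `|z - e| < eta / 2.
    move: z5; rewrite ltr_pdivlMr; last by (clear -C'0; lra).
    by have := normr_ge0 (z - e); (clear -R; nra).
  rewrite /T (_ : _ - _ = (t z (L z) - t e (L z)) + (t e (L z) - t e (L e))); last by ring.
  by apply: le_lt_trans (ler_normD _ _) _; (clear -k1 k2 k3; lra).
have cw : {within `[e3, e2], continuous T}.
  by apply: der_withincont => e he; apply: cT; [(clear -e11 e21 e30 he; lra)|apply: Ly0; (clear -e30 he; lra)].
have hmm : Num.min (T e3) (T e2) <= c <= Num.max (T e3) (T e2).
  by rewrite ge_min le_max (ltW T3) (ltW hj) orbT.
have [e /[!in_itv]/= he Te] := IVT e32 cw hmm.
exists e; split; first by (clear -e21 e30 he; lra).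
have he' : 0 <= e <= 1 by (clear -e11 e21 e30 he; lra).
by rewrite -/(L e) uE // -/(T e) Te cos_node mulr0.
Qed.

End Zeros.

(** * Smooth functions of one variable *)

Section SmoothFunctions.
Context {R : realType}.
Implicit Types (f g h : R -> R) (x y : R) (I J : set R) (l : nat).

Fixpoint Cn I l f : Prop :=
  (forall x, I x -> {for x, continuous f}) /\
  (if l is l'.+1 then (forall x, I x -> derivable f x 1) /\ Cn I l' (derive1 f) else True).

Lemma Cn_cont I l f x : Cn I l f -> I x -> {for x, continuous f}.
Proof. by case: l => [|l] [h _]; exact: h. Qed.

Lemma open_near I x : open I -> I x -> \near x, I x.
Proof. by move=> oI Ix; exact: open_nbhs_nbhs. Qed.

Lemma Cn_eq I l f g : open I -> (forall x, I x -> f x = g x) -> Cn I l f -> Cn I l g.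
Proof.
move=> oI; elim: l f g => [|l IH] f g fg.
  move=> [h _]; split=> // x Ix; apply/cont_ed => e e0.
  have /cont_ed /(_ e e0)[d d0 hd] := h x Ix.
  have /near_ed[r r0 hr] := open_near I x oI Ix.
  exists (Num.min d r); first by rewrite lt_min d0.
  by move=> y; rewrite lt_min => /andP[y1 y2]; rewrite -!fg //; [exact: hd|exact: hr].
move=> [h [df Cf]].
have near_fg x : I x -> \near x, f x = g x.
  by move=> Ix; apply: filterS (open_near I x oI Ix) => y Iy; exact: fg.
have dg x : I x -> derivable g x 1 by move=> Ix; apply: near_eq_derivable (near_fg x Ix) (df x Ix).
split.
  by move=> x Ix; apply/differentiable_continuous/derivable1_diffP/dg.
split=> //; apply: IH Cf => x Ix.
by rewrite !derive1E; apply: near_eq_derive; exact: near_fg.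
Qed.

Lemma der_derive1 f x d : is_derive x 1 f d -> derive1 f x = d.
Proof. by move=> [_ <-]; rewrite derive1E. Qed.

Lemma derivable_der f x : derivable f x 1 -> is_derive x 1 f (derive1 f x).
Proof. by move=> h; apply: DeriveDef => //; rewrite derive1E. Qed.

Lemma CnS I l f f' : open I -> (forall x, I x -> is_derive x 1 f (f' x)) ->
  Cn I l f' -> Cn I l.+1 f.
Proof.
move=> oI df Cf'; split; first by move=> x Ix; apply: der_cont (df x Ix).
split; first by move=> x /df[].
by apply: Cn_eq Cf' => // x Ix; rewrite (der_derive1 _ _ _ (df x Ix)).
Qed.

Lemma Cn_der I l f : Cn I l.+1 f ->
  (forall x, I x -> is_derive x 1 f (derive1 f x)) /\ Cn I l (derive1 f).
Proof. by move=> [_ [df Cf]]; split=> // x Ix; apply/derivable_der/df. Qed.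

Lemma Cn_pred I l f : Cn I l.+1 f -> Cn I l f.
Proof.
elim: l f => [|l IH] f [cf [df Cf]]; first by split.
by split=> //; split=> //; exact: IH.
Qed.

Lemma Cn_sub I J l f : J `<=` I -> Cn I l f -> Cn J l f.
Proof.
move=> JI; elim: l f => [|l IH] f; first by move=> [h _]; split=> // x /JI /h.
by move=> [h [df Cf]]; split; [move=> x /JI /h|split; [move=> x /JI /df|exact: IH]].
Qed.

Lemma Cn_cover I l f : (forall x, I x -> exists2 J, J x & Cn J l f) -> Cn I l f.
Proof.
elim: l f => [|l IH] f H.
  by split=> // x Ix; have [J Jx [h _]] := H x Ix; exact: h.
split; first by move=> x Ix; have [J Jx [h _]] := H x Ix; exact: h.
split; first by move=> x Ix; have [J Jx [_ [df _]]] := H x Ix; exact: df.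
by apply: IH => x Ix; have [J Jx [_ [_ Cf]]] := H x Ix; exists J.
Qed.

Lemma Cn_cst I l (c : R) : open I -> Cn I l (fun _ => c).
Proof.
move=> oI; elim: l c => [|l IH] c; first by split=> // x _; exact: cvg_cst.
exact: (CnS I l _ (fun _ => 0) oI (fun x _ => der_cst c x 1) (IH 0)).
Qed.

Lemma Cn_id I l : open I -> Cn I l (fun x => x).
Proof.
move=> oI; case: l => [|l]; first by split=> // x _; exact: cvg_id.
exact: (CnS I l _ (fun _ => 1) oI (fun x _ => der_id x) (Cn_cst I l 1 oI)).
Qed.

Lemma CnD I l f g : open I -> Cn I l f -> Cn I l g -> Cn I l (fun x => f x + g x).
Proof.
move=> oI; elim: l f g => [|l IH] f g Cf Cg.
  by split=> // x Ix; apply: cvgD; [exact: Cn_cont Cf Ix|exact: Cn_cont Cg Ix].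
have [df Cf'] := Cn_der _ _ _ Cf; have [dg Cg'] := Cn_der _ _ _ Cg.
apply: (CnS I l _ (fun x => derive1 f x + derive1 g x) oI); last exact: IH.
by move=> x Ix; apply: derD; [exact: df|exact: dg].
Qed.

Lemma CnM I l f g : open I -> Cn I l f -> Cn I l g -> Cn I l (fun x => f x * g x).
Proof.
move=> oI; elim: l f g => [|l IH] f g Cf Cg.
  by split=> // x Ix; apply: cvgM; [exact: Cn_cont Cf Ix|exact: Cn_cont Cg Ix].
have [df Cf'] := Cn_der _ _ _ Cf; have [dg Cg'] := Cn_der _ _ _ Cg.
move: (derive1 f : R -> R) (derive1 g : R -> R) df dg Cf' Cg' => f' g' df dg Cf' Cg'.
apply: (CnS I l (fun x => f x * g x) (fun x => f' x * g x + f x * g' x) oI).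
  by move=> x Ix; apply: derM; [exact: df|exact: dg].
apply: (CnD I l _ _ oI); first exact: (IH _ _ Cf' (Cn_pred _ _ _ Cg)).
exact: (IH _ _ (Cn_pred _ _ _ Cf) Cg').
Qed.

Lemma CnN I l f : open I -> Cn I l f -> Cn I l (fun x => - f x).
Proof.
move=> oI Cf; apply: (Cn_eq I l (fun x => -1 * f x) _ oI); first by move=> x _; rewrite mulN1r.
exact: (CnM I l _ _ oI (Cn_cst I l (-1) oI) Cf).
Qed.

Lemma CnB I l f g : open I -> Cn I l f -> Cn I l g -> Cn I l (fun x => f x - g x).
Proof. by move=> oI Cf Cg; exact: (CnD I l _ _ oI Cf (CnN I l _ oI Cg)). Qed.

Lemma CnV I l f : open I -> (forall x, I x -> f x != 0) -> Cn I l f -> Cn I l (fun x => (f x)^-1).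
Proof.
move=> oI f0; elim: l => [|l IH] Cf.
  by split=> // x Ix; apply: cvgV; [exact: f0|exact: Cn_cont Cf Ix].
have [df Cf'] := Cn_der _ _ _ Cf.
move: (derive1 f : R -> R) df Cf' => f' df Cf'.
apply: (CnS I l (fun x => (f x)^-1) (fun x => - f' x * ((f x)^-1 * (f x)^-1)) oI) => [x Ix|].
  apply: der_eq (derV f _ _ _ (f0 x Ix) (df x Ix)) _.
  by field; exact: f0.
have CV := IH (Cn_pred _ _ _ Cf).
exact: (CnM I l _ _ oI (CnN I l _ oI Cf') (CnM I l _ _ oI CV CV)).
Qed.

Lemma Cn_comp I J l f h : open I -> open J -> (forall x, I x -> J (f x)) ->
  Cn I l f -> Cn J l h -> Cn I l (fun x => h (f x)).
Proof.
move=> oI oJ fIJ; elim: l f h fIJ => [|l IH] f h fIJ Cf Ch.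
  split=> // x Ix; apply: (@continuous_comp _ _ _ f h); first exact: Cn_cont Cf Ix.
  by apply: (Cn_cont _ _ _ _ Ch); exact: fIJ.
have [df Cf'] := Cn_der _ _ _ Cf; have [dh Ch'] := Cn_der _ _ _ Ch.
move: (derive1 f : R -> R) (derive1 h : R -> R) df dh Cf' Ch' => f' h' df dh Cf' Ch'.
apply: (CnS I l (fun x => h (f x)) (fun x => h' (f x) * f' x) oI).
  by move=> x Ix; apply: der_chain; [exact: df|apply: dh; exact: fIJ].
exact: (CnM I l _ _ oI (IH _ _ fIJ (Cn_pred _ _ _ Cf) Ch') Cf').
Qed.

Definition smooth1 I f := forall l, Cn I l f.

End SmoothFunctions.

(** * Smoothness at the pole *)

Section SingularRegularity.
Context {R : realType}.
Implicit Types (f g h k w : R -> R) (x y s r : R) (l n : nat).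

Definition symint r : set R := [set s | `|s| < r].

Lemma open_ed (I : set R) : (forall x, I x -> exists2 d, 0 < d & forall y, `|y - x| < d -> I y) -> open I.
Proof. by move=> H; rewrite openE => x Ix; apply/near_ed; exact: H. Qed.

Lemma open_symint r : open (symint r).
Proof.
apply: open_ed => x xr; exists (r - `|x|); first by rewrite subr_gt0.
move=> y hy; rewrite /symint /= (_ : y = (y - x) + x); last by ring.
by apply: le_lt_trans (ler_normD _ _) _; lra.
Qed.

Lemma clip_comp_cont f r : 0 <= r -> (forall s, `|s| <= r -> {for s, continuous f}) ->
  continuous (fun s => f (clip r s)).
Proof.
move=> r0 cf s; apply: (@continuous_comp _ _ _ (clip r) f); first exact: clip_cont.
by apply: cf; exact: clip_bound.
Qed.

Lemma sing_unique nu f k1 k2 r : 1 <= nu -> 0 <= r ->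
  (forall s, `|s| <= r -> {for s, continuous k1}) ->
  (forall s, `|s| <= r -> {for s, continuous k2}) ->
  (forall s, `|s| <= r -> s != 0 -> is_derive s 1 k1 ((f s - nu * k1 s) / s)) ->
  (forall s, `|s| <= r -> s != 0 -> is_derive s 1 k2 ((f s - nu * k2 s) / s)) ->
  nu * k1 0 = f 0 -> nu * k2 0 = f 0 -> forall s, `|s| <= r -> k1 s = k2 s.
Proof.
move=> nu1 r0 c1 c2 d1 d2 e1 e2 s hs; apply/eqP; rewrite -subr_eq0 -normr_le0.
apply: (sing_close nu k1 k2 f f r 0) hs => // z _.
by rewrite subrr normr0.
Qed.

Lemma half_succ n : n.+3%:R / 2 = n.+1%:R / 2 + 1 :> R.
Proof. by rewrite -(addn2 n.+1) natrD; field. Qed.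

Lemma half_ge1 n : (0 < n)%N -> 1 <= n.+1%:R / 2 :> R.
Proof. by move=> n0; have : (2 : R) <= n.+1%:R; [rewrite ler_nat|lra]. Qed.

(** Away from 0 this is the product rule for the equation with $\nu+1$. At 0 the derivative of $sk$
    is $k(0)$, for which continuity of [k] suffices. *)
Lemma sing_gain n r h k : 0 < r ->
  (forall s, `|s| < r -> {for s, continuous k}) ->
  (forall s, `|s| < r -> s != 0 -> is_derive s 1 k ((h s - n.+3%:R / 2 * k s) / s)) ->
  n.+3%:R / 2 * k 0 = h 0 ->
  forall s, `|s| < r -> is_derive s 1 (fun s => s * k s) (h s - n.+1%:R / 2 * k s).
Proof.
move=> r0 ck dk k0 s hs; have [->|s0] := eqVneq s 0.
  rewrite -k0 half_succ mulrDl mul1r addrAC subrr add0r.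
  apply: der_of_ed => e e0; have /cont_ed /(_ e e0)[d d0 hd] := ck 0 ltac:(by rewrite normr0).
  exists d => // z hz; rewrite add0r mul0r subr0 mulrC -mulrBl normrM.
  by apply: ler_wpM2r => //; apply/ltW/hd; rewrite subr0.
apply: der_eq (derM _ _ _ _ _ _ (der_id s) (dk s hs s0)) _.
by rewrite half_succ; field.
Qed.

Lemma sing_solve n r f : (0 < n)%N -> 0 <= r -> (forall s, `|s| <= r -> {for s, continuous f}) ->
  exists k, [/\ forall s, {for s, continuous k},
   (forall s, `|s| <= r -> s != 0 -> is_derive s 1 k ((f s - n.+1%:R / 2 * k s) / s)) &
   n.+1%:R / 2 * k 0 = f 0].
Proof.
move=> n0 r0 cf; have cF := clip_comp_cont f r r0 cf.
have [c1 d1 k0] := singpP n _ cF; exists (singp n (fun s => f (clip r s))); split.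
- by move=> s; exact: c1.
- by move=> s hs s0; have := d1 s s0; rewrite clip_id.
- by rewrite k0 clip_id ?normr0.
Qed.

Lemma symint_cover r l f : (forall r', 0 < r' < r -> Cn (symint r') l f) -> Cn (symint r) l f.
Proof.
move=> H; apply: Cn_cover => x; rewrite /symint /= => xr.
exists (symint ((`|x| + r) / 2)); first by rewrite /symint /=; lra.
by apply: H; have := normr_ge0 x; lra.
Qed.

(* Differentiating [s k' + nu k = f] shows that [k'] solves the same equation
   with [nu + 1] and [f'] in place of [nu] and [f]. *)
Lemma sing_regular l : forall n r f k, (0 < n)%N ->
  Cn (symint r) l f -> (forall s, `|s| < r -> {for s, continuous k}) ->
  (forall s, `|s| < r -> s != 0 -> is_derive s 1 k ((f s - n.+1%:R / 2 * k s) / s)) ->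
  n.+1%:R / 2 * k 0 = f 0 -> Cn (symint r) l k.
Proof.
elim: l => [|l IH] n r f k n0 Cf ck dk k0; first by split=> // s; exact: ck.
have [df Cf'] := Cn_der _ _ _ Cf.
move: (derive1 f : R -> R) df Cf' => f' df Cf'.
apply: symint_cover => r' /andP[r'0 r'r].
have lr s : `|s| <= r' -> `|s| < r by move=> h; exact: le_lt_trans h r'r.
have cf' s : `|s| <= r' -> {for s, continuous f'}.
  by move=> hs; apply: (Cn_cont _ _ _ _ Cf'); exact: lr.
have [k' [ck' dk' k'0]] := sing_solve n.+2 r' f' isT (ltW r'0) cf'.
have nu1 := half_ge1 n n0.
have Ck' : Cn (symint r') l k'.
  apply: (IH n.+2 r' f') => //.
    by apply: Cn_sub Cf' => s; rewrite /symint /= => h; apply: lt_trans h r'r.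
  by move=> s hs; apply: dk'; exact: ltW.
set nu := n.+1%:R / 2 : R in nu1 *.
have gain s : `|s| < r' -> is_derive s 1 (fun s => s * k' s) (f' s - nu * k' s).
  apply: (sing_gain n r' f' k' r'0) => //.
  by move=> z hz; apply: dk'; exact: ltW.
pose kt s := (f s - s * k' s) / nu.
have nun : nu != 0 by rewrite gt_eqF //; lra.
have dkt s : `|s| < r' -> is_derive s 1 kt (k' s).
  move=> hs; have d1 := df s (lr s (ltW hs)).
  apply: der_eq (derM _ _ _ _ _ _ (derB _ _ _ _ _ _ d1 (gain s hs)) (der_cst nu^-1 _ _)) _.
  by field.
have ekt s : `|s| < r' -> k s = kt s.
  move=> hs; pose r2 := (`|s| + r') / 2.
  have s2 : `|s| <= r2 by rewrite /r2; lra.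
  have l2 z : `|z| <= r2 -> `|z| < r' by move=> hz; rewrite /r2 in hz; lra.
  have r20 : 0 <= r2 by apply: le_trans s2.
  apply: (sing_unique nu f k kt r2) s2 => //.
  - by move=> z /l2 hz; apply: ck; apply/lr/ltW.
  - by move=> z /l2 hz; apply: der_cont (dkt z hz).
  - by move=> z /l2 hz; apply: dk; apply/lr/ltW.
  - move=> z /l2 hz z0; apply: der_eq (dkt z hz) _.
    by rewrite /kt; field; rewrite ?nun ?z0.
  - by rewrite /kt mul0r subr0; field.
apply: (Cn_eq _ _ kt); [exact: open_symint|by move=> s hs; rewrite ekt|].
exact: (CnS _ l kt k' (open_symint r') dkt Ck').
Qed.

(** If $k_1$ solves the equation with $\nu+1$ and right-hand side $f_1$, then $sk_1$ solves it with
    $\nu$ and $sf_1$. By [sing_gain] $(sk_1)'=f_1-\nu k_1$, which is as smooth as $f_1$, so $sk_1$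
    is one order smoother. This gain breaks the circle when $f_1$ involves the unknown [w]
    itself. *)
Lemma sing_bootstrap n l r f0 f1 w : (0 < n)%N ->
  Cn (symint r) l.+1 f0 -> Cn (symint r) l f1 ->
  (forall s, `|s| < r -> {for s, continuous w}) ->
  (forall s, `|s| < r -> s != 0 -> is_derive s 1 w ((f0 s + s * f1 s - n.+1%:R / 2 * w s) / s)) ->
  n.+1%:R / 2 * w 0 = f0 0 -> Cn (symint r) l.+1 w.
Proof.
move=> n0 C0 C1 cw dw w0; apply: symint_cover => r' /andP[r'0 r'r].
have lr s : `|s| <= r' -> `|s| < r by move=> h; exact: le_lt_trans h r'r.
have sub : symint r' `<=` symint r by move=> s; rewrite /symint /= => h; apply: lt_trans h r'r.
have [k0 [ck0 dk0 k00]] := sing_solve n r' f0 n0 (ltW r'0) (fun s hs => Cn_cont _ _ _ _ C0 (lr s hs)).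
have [k1 [ck1 dk1 k10]] := sing_solve n.+2 r' f1 isT (ltW r'0) (fun s hs => Cn_cont _ _ _ _ C1 (lr s hs)).
have nu1 := half_ge1 n n0.
have Ck0 : Cn (symint r') l.+1 k0.
  apply: (sing_regular l.+1 n r' f0) => //; first exact: Cn_sub C0.
  by move=> s hs; apply: dk0; exact: ltW.
have Ck1 : Cn (symint r') l k1.
  apply: (sing_regular l n.+2 r' f1) => //; first exact: Cn_sub C1.
  by move=> s hs; apply: dk1; exact: ltW.
have gain s : `|s| < r' -> is_derive s 1 (fun s => s * k1 s) (f1 s - n.+1%:R / 2 * k1 s).
  apply: (sing_gain n r' f1 k1 r'0) => //.
  by move=> z hz; apply: dk1; exact: ltW.
have oI := open_symint r'.
have Cg : Cn (symint r') l (fun s => f1 s - n.+1%:R / 2 * k1 s).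
  by apply: CnB => //; [exact: Cn_sub C1|exact: (CnM _ l _ _ oI (Cn_cst _ l _ oI) Ck1)].
have Csk := CnS _ l _ _ oI gain Cg.
apply: (Cn_eq _ _ (fun s => k0 s + s * k1 s)) => //; last exact: (CnD _ _ _ _ oI Ck0 Csk).
move=> s hs; pose r2 := (`|s| + r') / 2.
have s2 : `|s| <= r2 by move: hs; rewrite /r2 /symint /=; lra.
have l2 z : `|z| <= r2 -> `|z| < r' by move=> hz; move: hs; rewrite /symint /= /r2 in hz *; lra.
have r20 : 0 <= r2 by apply: le_trans s2.
apply: (sing_unique (n.+1%:R / 2) (fun s => f0 s + s * f1 s) (fun s => k0 s + s * k1 s) w r2) s2 => //.
- by move=> z /l2 hz; exact: (cvgD (ck0 z) (der_cont _ _ _ (gain z hz))).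
- by move=> z /l2 hz; apply: cw; apply/lr/ltW.
- move=> z /l2 hz z0; apply: der_eq (derD _ _ _ _ _ _ (dk0 z (ltW hz) z0) (gain z hz)) _.
  by field.
- by move=> z /l2 hz; apply: dw; apply/lr/ltW.
- by rewrite !mul0r !addr0.
- by rewrite mul0r addr0.
Qed.

End SingularRegularity.

(** * Reflection in the equator and extension across the pole *)

Section Extension.
Context {R : realType}.
Implicit Types (e s x y z al be : R) (l : nat).

Lemma force_reflect al be T a (x : R) : force al be (- T) (- a) x = - force al be T a x.
Proof. by rewrite /force thN; ring. Qed.

Lemma friction_reflect e y : 0 < e -> friction e (- ln e - y) = - friction e y.
Proof.
move=> e0; rewrite /friction mulrBr expRD.
have -> : expR (2 * - ln e) = (e ^+ 2)^-1.
  by rewrite (_ : 2 * - ln e = - (ln e + ln e)); [rewrite expRN expRD lnK ?posrE // expr2|ring].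
rewrite expRN; have E := expR_gt0 (2 * y).
have p : 0 < e * expR (2 * y) by exact: mulr_gt0.
by field; rewrite !gt_eqF //; lra.
Qed.

(** The map $y\mapsto-\ln e-y$ fixes the equator and changes the sign of the friction, so the
    reflected pair $(-u,v)$ is again a solution. Vanishing of $u$ at the equator makes the data of
    the two solutions agree there. *)
Lemma flow_reflect al be e (u v : R -> R) y : 1 <= be -> be < al -> 0 < e -> flow al be e u v ->
  u (- ln e / 2) = 0 -> u (- ln e - y) = - u y /\ v (- ln e - y) = v y.
Proof.
move=> b1 ab e0 h uL; have [du dv] := h.
have dr z : is_derive z 1 (fun z : R => - ln e - z) (-1).
  by apply: der_eq (derB _ _ _ _ _ _ (der_cst (- ln e) _ _) (der_id z)) _; rewrite sub0r.
have h' : flow al be e (fun z => - u (- ln e - z)) (fun z => v (- ln e - z)).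
  split=> z.
    by apply: der_eq (derN _ _ _ _ (der_chain u _ _ _ _ _ (dr z) (du _))) _; ring.
  apply: der_eq (der_chain v _ _ _ _ _ (dr z) (dv _)) _.
  by rewrite -[u (- ln e - z)]opprK friction_reflect // force_reflect opprK; ring.
have eL : - ln e - - ln e / 2 = - ln e / 2 by field.
have [] := flow_uniq al be e _ _ _ _ (- ln e / 2) b1 ab (ltW e0) h' h _ _ y.
- by rewrite eL uL oppr0.
- by rewrite eL.
by move=> h1 ->; rewrite -h1 opprK.
Qed.

(** The value of [singular_rhs] at $s=0$, which no longer involves $w$; [rhs1] is the difference
    quotient in closed form. This is the splitting that [sing_bootstrap] needs. *)
Definition rhs0 al be e (g : R) := (al + 1) / (al + be) * ((al - be) * (e - g * g)).

Definition rhs1 al be e (s g w : R) :=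
  let v := 1 + s * w in
  - (1 / 2) * (w * w) * ((be * (v * v) - al * (be - 1) * v + al) * (al + be * (v * v))^-1) +
  (al + v * v) * (al + be * (v * v))^-1 *
    (g * g * ((al - be) * (g * g) + be * w * (1 + v)) * (1 + s * (g * g))^-1 +
     (al - be) * e * (w - e) * (1 + e * s)^-1) -
  w * (al * (be - 1) * (1 + v)) * (al + be * (v * v))^-1 * ((al - be) * (e - g * g) / (al + be)).

Lemma singular_rhs_split al be e s (g w : R) : al + be != 0 ->
  al + be * ((1 + s * w) * (1 + s * w)) != 0 -> 1 + s * (g * g) != 0 -> 1 + e * s != 0 ->
  singular_rhs al be e s g w = rhs0 al be e g + s * rhs1 al be e s g w.
Proof.
move=> h1 h2 h3 h4; rewrite /singular_rhs /rhs0 /rhs1; field.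
by rewrite h1 h2 h3 h4.
Qed.

(** The half-line $s>-r$ runs from slightly beyond the pole $s=0$ up to the opposite pole, which is
    $s=+\infty$. *)
Record extension (al be e r : R) (n : nat) (G W : R -> R) : Prop := Extension {
  ex_G : forall s, - r < s -> is_derive s 1 G (1 / 2 * (G s * W s));
  ex_W : forall s, - r < s -> s != 0 ->
    is_derive s 1 W ((singular_rhs al be e s (G s) (W s) - n.+1%:R / 2 * W s) / s);
  ex_W0 : n.+1%:R / 2 * W 0 = singular_rhs al be e 0 (G 0) (W 0);
  ex_cont : forall s, - r < s -> {for s, continuous W};
  ex_pos : forall s, - r < s -> 0 < G s;
  ex_G0 : G 0 = 1;
  ex_den1 : forall s, - r < s -> 0 < 1 + s * (G s * G s);
  ex_den2 : forall s, - r < s -> 0 < 1 + e * s }.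

Theorem extension_exists al be n s0 g w u v e : 1 <= be -> be < al -> n.+1%:R = al + 3 ->
  family_spec al be n s0 g w u v -> 0 < e < 1 -> u e (- ln e / 2) = 0 ->
  exists G W, [/\ extension al be e s0 n G W,
    forall s, 0 < s -> G s = expR (u e (ln s / 2) - ln s / 2) &
    forall s, 0 < s -> v e (ln s / 2) = 1 + s * W s].
Proof.
move=> b1 ab nE FS he uL; have he' : 0 <= e <= 1 by lra.
have /andP[s00 s08] := fs_s0 _ _ _ _ _ _ _ _ FS.
have [cw g0 dg dw w0] := fs_sing _ _ _ _ _ _ _ _ FS e he'.
have fl := fs_flow _ _ _ _ _ _ _ _ FS e he'; have [du dv] := fl.
have e0 : 0 < e by lra.
(* Before the equator this is [v_bound], after it the reflection. So the clipping is inactive for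
   all [y], and the unclipped equation holds for every $s>0$. *)
have vb y : `|v e y| <= vmax al be.
  case: (leP y (- ln e / 2)) => hy.
    apply: (v_bound al be n s0 g w u v) => //.
    rewrite -{1}(@lnK _ e) ?posrE // -expRD -[leRHS]expR0 ler_expR; lra.
  have [_ <-] := flow_reflect al be e _ _ y b1 ab e0 fl uL.
  apply: (v_bound al be n s0 g w u v) => //.
  rewrite -{1}(@lnK _ e) ?posrE // -expRD -[leRHS]expR0 ler_expR; lra.
pose G s := if s <= 0 then g e s else expR (u e (ln s / 2) - ln s / 2).
pose W s := if s <= 0 then w e s else (v e (ln s / 2) - 1) / s.
have Gp s : 0 < s -> G s = expR (u e (ln s / 2) - ln s / 2) by rewrite /G leNgt => ->.
have Wp s : 0 < s -> W s = (v e (ln s / 2) - 1) / s by rewrite /W leNgt => ->.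
have loc s : `|s| <= s0 -> G s = g e s /\ W s = w e s.
  move=> hs; case: (leP s 0) => hs0; first by rewrite /G /W hs0.
  have es : expR (2 * (ln s / 2)) = s.
    by rewrite (_ : 2 * (ln s / 2) = ln s); [rewrite lnK ?posrE|field].
  have [|hu hv] := fs_local _ _ _ _ _ _ _ _ FS e (ln s / 2) he'.
    by rewrite es; move: hs; rewrite ler_norml; (clear -R; lra).
  rewrite /local_u es in hu; rewrite /local_v es in hv.
  have gp : 0 < g e s by have := fs_g _ _ _ _ _ _ _ _ FS e s he' hs; rewrite ler_norml; (clear -R; lra).
  rewrite Gp // Wp // hu hv; split; last by field; rewrite gt_eqF.
  by rewrite addrAC subrr add0r lnK ?posrE.
have near_loc s : `|s| < s0 -> (\near s, g e s = G s) /\ (\near s, w e s = W s).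
  move=> hs; have near_s y : `|y - s| < s0 - `|s| -> `|y| <= s0.
    move=> hy; rewrite (_ : y = s + (y - s)); last by ring.
    by apply: le_trans (ler_normD _ _) _; (clear -hy; lra).
  by split; apply/near_ed; exists (s0 - `|s|); rewrite ?subr_gt0 // => y /near_s /loc[h1 h2]; rewrite ?h1 ?h2.
have dy s : 0 < s -> is_derive s 1 (fun s : R => ln s / 2) (1 / (2 * s)).
  move=> sp; apply: der_eq (derM _ _ _ _ _ _ (is_derive1_ln sp) (der_cst 2^-1 _ _)) _.
  by field; rewrite gt_eqF.
have small s : - s0 < s -> s <= 0 -> `|s| < s0 by move=> h1 h2; rewrite ler0_norm; (clear -h1 h2; lra).
have uy s : 0 < s -> is_derive s 1 (fun s => u e (ln s / 2)) (v e (ln s / 2) * (1 / (2 * s))).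
  by move=> sp; apply: der_eq (der_chain (u e) _ _ _ _ _ (dy s sp) (du _)) _; rewrite clip_id.
have nearp s (f : R -> R) h : 0 < s -> (forall y, 0 < y -> f y = h y) -> \near s, f s = h s.
  by move=> sp H; apply: filterS (near_gt _ _ sp) => y /H.
have dG s : 0 < s -> is_derive s 1 G (1 / 2 * (G s * W s)).
  move=> sp; apply: (der_near (fun s => expR (u e (ln s / 2) - ln s / 2))).
    by apply: nearp => // y yp; rewrite Gp.
  apply: der_eq (der_exp _ _ _ _ (derB _ _ _ _ _ _ (uy s sp) (dy s sp))) _.
  by rewrite Gp // Wp //; field; rewrite gt_eqF.
have dW s : 0 < s -> is_derive s 1 W ((singular_rhs al be e s (G s) (W s) - n.+1%:R / 2 * W s) / s).
  move=> sp; have sn : s != 0 by rewrite gt_eqF.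
  apply: (der_near (fun s => (v e (ln s / 2) - 1) / s)).
    by apply: nearp => // y yp; rewrite Wp.
  have dvs := der_chain (v e) _ _ _ _ _ (dy s sp) (dv _).
  apply: der_eq (derM _ _ _ _ _ _ (derB _ _ _ _ _ _ dvs (der_cst (1 : R) _ _)) (derV (fun y : R => y) _ _ _ sn (der_id s))) _.
  have vE : v e (ln s / 2) = 1 + s * W s by rewrite Wp //; field.
  have es : expR (2 * (ln s / 2)) = s.
    by rewrite (_ : 2 * (ln s / 2) = ln s); [rewrite lnK ?posrE|field].
  have thE : th (u e (ln s / 2)) = 1 - 2 / (s * G s ^+ 2 + 1).
    rewrite /th Gp // (_ : 2 * u e (ln s / 2) = 2 * (ln s / 2) + (u e (ln s / 2) - ln s / 2) + (u e (ln s / 2) - ln s / 2)); last by field.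
    by rewrite !expRD es -mulrA expr2.
  have Gs : 0 < G s by rewrite Gp // expR_gt0.
  rewrite clip_id // /friction es vE (force_local _ _ _ _ _ _ _ b1 ab sp (ltW e0) Gs thE) nE.
  by field.
have gb s : `|s| <= s0 -> 1 / 2 <= G s <= 3 / 2.
  move=> hs; have [-> _] := loc s hs.
  by have := fs_g _ _ _ _ _ _ _ _ FS e s he' hs; rewrite ler_norml; (clear -R; lra).
exists G, W; split=> //; last by move=> s sp; rewrite Wp //; field; rewrite gt_eqF.
have z0 : `|0 : R| < s0 by rewrite normr0.
split.
- move=> s sr; case: (leP s 0) => hs; last exact: dG.
  have hs' := small s sr hs; have [n1 n2] := near_loc s hs'; have [-> ->] := loc s (ltW hs').
  by apply: der_near n1 _; apply: dg; exact: ltW.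
- move=> s sr sn; case: (leP s 0) => hs; last exact: dW.
  have hs' := small s sr hs; have [n1 n2] := near_loc s hs'; have [-> ->] := loc s (ltW hs').
  by apply: der_near n2 _; apply: dw => //; exact: ltW.
- by have [-> ->] := loc 0 (ltW z0).
- move=> s sr; case: (leP s 0) => hs; last exact: der_cont (dW s hs).
  have hs' := small s sr hs; have [n1 n2] := near_loc s hs'.
  rewrite /prop_for /continuous_at; have [_ ->] := loc s (ltW hs'); have := cw s (ltW hs').
  by apply: cvg_trans; apply: near_eq_cvg.
- move=> s sr; case: (leP s 0) => hs; last by rewrite Gp // expR_gt0.
  by have := gb s (ltW (small s sr hs)); (clear -G; lra).
- by have [-> _] := loc 0 (ltW z0).
- move=> s sr; case: (leP s 0) => hs.
    have := gb s (ltW (small s sr hs)) => hg.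
    have : G s * G s <= 9 / 4 by (clear -G hg; nra).
    have : 0 <= G s * G s by exact: sqr_ge0.
    by (clear -s08 G sr; nra).
  have : 0 <= s * (G s * G s) by rewrite mulr_ge0 ?sqr_ge0 // ltW.
  (clear -G; lra).
- by move=> s sr; (clear -he s08 sr; nra).
Qed.

Lemma extension_smooth al be e r n G W : 1 <= be -> be < al -> (0 < n)%N -> 0 < r ->
  extension al be e r n G W ->
  let J := [set s | - r < s] in smooth1 J G /\ smooth1 J W.
Proof.
move=> b1 ab n0 r0 [dG dW W0 cW Gp G0 den1 den2] J.
have oJ : open J.
  by apply: open_ed => x xJ; exists (x + r); [move: xJ; rewrite /J /=; lra|move=> y; rewrite ltr_norml /J /=; lra].
have denD s : 0 < al + be * ((1 + s * W s) * (1 + s * W s)).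
  have vv : 0 <= (1 + s * W s) * (1 + s * W s) by exact: sqr_ge0.
  by have : 0 <= be * ((1 + s * W s) * (1 + s * W s)) by [apply: mulr_ge0 => //; lra]; lra.
have abn : al + be != 0 by rewrite gt_eqF //; lra.
suff H l : Cn J l G /\ Cn J l W by split=> l; case: (H l).
elim: l => [|l [CG CW]].
  split; first by split=> // s sJ; exact: der_cont (dG s sJ).
  by split=> // s sJ; exact: cW.
have cst (I : set R) c : open I -> Cn I l (fun _ => c) by exact: Cn_cst.
have CG1 : Cn J l.+1 G.
  by apply: (CnS J l _ _ oJ dG); exact: (CnM J l _ _ oJ (cst J _ oJ) (CnM J l _ _ oJ CG CW)).
have Cs : Cn J l (fun s => s) by exact: Cn_id.
have CsW := CnM J l _ _ oJ Cs CW.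
have Cv := CnD J l _ _ oJ (cst J 1 oJ) CsW.
have Cvv := CnM J l _ _ oJ Cv Cv; have Cgg := CnM J l _ _ oJ CG CG; have Cww := CnM J l _ _ oJ CW CW.
have CD := CnV J l _ oJ (fun s _ => lt0r_neq0 (denD s)) (CnD J l _ _ oJ (cst J al oJ) (CnM J l _ _ oJ (cst J be oJ) Cvv)).
have C1 := CnV J l _ oJ (fun s sJ => lt0r_neq0 (den1 s sJ)) (CnD J l _ _ oJ (cst J 1 oJ) (CnM J l _ _ oJ Cs Cgg)).
have C2 := CnV J l _ oJ (fun s sJ => lt0r_neq0 (den2 s sJ)) (CnD J l _ _ oJ (cst J 1 oJ) (CnM J l _ _ oJ (cst J e oJ) Cs)).
have Cq := CnM J l _ _ oJ (CnD J l _ _ oJ (cst J al oJ) Cvv) CD.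
have Ceg : Cn J l (fun s => (al - be) * (e - G s * G s)).
  exact: (CnM J l _ _ oJ (cst J _ oJ) (CnB J l _ _ oJ (cst J e oJ) Cgg)).
have Ct1 := CnM J l _ _ oJ (CnM J l _ _ oJ (cst J (- (1 / 2)) oJ) Cww)
  (CnM J l _ _ oJ (CnD J l _ _ oJ (CnB J l _ _ oJ (CnM J l _ _ oJ (cst J be oJ) Cvv)
    (CnM J l _ _ oJ (cst J (al * (be - 1)) oJ) Cv)) (cst J al oJ)) CD).
have C1v := CnD J l _ _ oJ (cst J 1 oJ) Cv.
have Cb1 := CnM J l _ _ oJ (CnM J l _ _ oJ Cgg (CnD J l _ _ oJ (CnM J l _ _ oJ (cst J (al - be) oJ) Cgg)
   (CnM J l _ _ oJ (CnM J l _ _ oJ (cst J be oJ) CW) C1v))) C1.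
have Cb2 := CnM J l _ _ oJ (CnM J l _ _ oJ (cst J ((al - be) * e) oJ) (CnB J l _ _ oJ CW (cst J e oJ))) C2.
have Ct2 := CnM J l _ _ oJ Cq (CnD J l _ _ oJ Cb1 Cb2).
have Ct3 := CnM J l _ _ oJ (CnM J l _ _ oJ (CnM J l _ _ oJ CW (CnM J l _ _ oJ (cst J (al * (be - 1)) oJ) C1v)) CD)
  (CnM J l _ _ oJ Ceg (cst J (al + be)^-1 oJ)).
have Crhs1 : Cn J l (fun s => rhs1 al be e s (G s) (W s)).
  exact: (CnB J l _ _ oJ (CnD J l _ _ oJ Ct1 Ct2) Ct3).
have Crhs0 : Cn J l.+1 (fun s => rhs0 al be e (G s)).
  exact: (CnM J l.+1 _ _ oJ (Cn_cst J l.+1 _ oJ) (CnM J l.+1 _ _ oJ (Cn_cst J l.+1 _ oJ)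
    (CnB J l.+1 _ _ oJ (Cn_cst J l.+1 e oJ) (CnM J l.+1 _ _ oJ CG1 CG1)))).
have split_rhs s : J s -> singular_rhs al be e s (G s) (W s) =
    rhs0 al be e (G s) + s * rhs1 al be e s (G s) (W s).
  by move=> sJ; apply: singular_rhs_split => //; apply: lt0r_neq0; [exact: denD|exact: den1|exact: den2].
have subJ : symint r `<=` J by move=> s; rewrite /symint /J /= ltr_norml => /andP[].
split=> //; apply: Cn_cover => x xJ.
have [->|x0] := eqVneq x 0.
  exists (symint r); first by rewrite /symint /= normr0.
  apply: (sing_bootstrap n l r (fun s => rhs0 al be e (G s)) (fun s => rhs1 al be e s (G s) (W s)) W n0).
  - exact: Cn_sub Crhs0.
  - exact: Cn_sub Crhs1.
  - by move=> s hs; apply: cW; exact: subJ.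
  - by move=> s hs s0; rewrite -split_rhs; [apply: dW => //; exact: subJ|exact: subJ].
  - have J0 : J 0 by apply: subJ; rewrite /symint /= normr0.
    by rewrite W0 split_rhs // mul0r addr0.
pose I := [set s | - r < s /\ s != 0].
have oI : open I.
  apply: open_ed => z [z1 z2]; exists (Num.min (z + r) `|z|); first by rewrite lt_min normr_gt0 z2 andbT; lra.
  move=> y; rewrite lt_min => /andP[y1 y2]; split; first by move: y1; rewrite ltr_norml; (clear -R; lra).
  by apply/eqP => y0; move: y2; rewrite y0 sub0r normrN ltxx.
have sIJ : I `<=` J by move=> s [].
exists I; first by split.
apply: (CnS I l W (fun s => (rhs0 al be e (G s) + s * rhs1 al be e s (G s) (W s) - n.+1%:R / 2 * W s) / s) oI).
  by move=> s sI; have [s1 s2] := sI; rewrite -split_rhs //; exact: dW.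
apply: (CnM I l _ _ oI); last by apply: (CnV I l _ oI) => [s []//|]; exact: Cn_id.
apply: (CnB I l _ _ oI); last by apply: (CnM I l _ _ oI (cst I _ oI)); exact: Cn_sub CW.
apply: (CnD I l _ _ oI); first exact: Cn_sub (Cn_pred _ _ _ Crhs0).
by apply: (CnM I l _ _ oI); [exact: Cn_id|exact: Cn_sub Crhs1].
Qed.

End Extension.

(** * The profile as a function of [cos t] *)

Section HalfProfile.
Context {R : realType}.
Implicit Types (e r s c al be : R) (l : nat).

(* The variable [s = e^(2 y)] as a function of [c = cos t = - tanh x].  With [P = e^(2 u)],
   the map is [(c, w) |-> (C c, S c w)] in terms of the profile [C = - tanh u]. *)
Definition sgm e c := (1 - c) / (e * (1 + c)).

Definition pP e (G : R -> R) c := sgm e c * (G (sgm e c) * G (sgm e c)).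
Definition pC e (G : R -> R) c := (1 - pP e G c) / (1 + pP e G c).
(** The quotient $\sin r/\sin t$ with the common factor $\sqrt{1-c}$ cancelled, so that it extends
    across $c=1$. *)
Definition pS e (G : R -> R) c := 2 * G (sgm e c) / ((1 + c) * (Num.sqrt e * (1 + pP e G c))).
Definition pv e (W : R -> R) c := 1 + sgm e c * W (sgm e c).

Definition halfdom d : set R := [set c | -1 < c /\ c < 1 + d].

Lemma open_halfdom d : open (halfdom d).
Proof.
apply: open_ed => x [x1 x2]; exists (Num.min (x + 1) (1 + d - x)); first by rewrite lt_min; lra.
by move=> y; rewrite lt_min !ltr_norml => /andP[h1 h2]; split; lra.
Qed.

Lemma sgm_dom e r c : 0 < e < 1 -> 0 < r <= 1 / 8 -> halfdom (r * e) c -> - r < sgm e c.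
Proof.
move=> he hr [c1 c2]; rewrite /sgm ltr_pdivlMr; last by apply: mulr_gt0; lra.
have k0 : 0 < r * e by apply: mulr_gt0; lra.
rewrite mulrA mulNr; move: (r * e) k0 c2 => k k0 c2; case: (leP c 1) => h.
  by have : 0 < k * (1 + c) by [apply: mulr_gt0; lra]; lra.
by have : 0 < k * (c - 1) by [apply: mulr_gt0; lra]; lra.
Qed.

Lemma sgm_den e c : 0 < e -> -1 < c -> 1 + e * sgm e c = 2 / (1 + c).
Proof. by move=> e0 c1; rewrite /sgm; field; rewrite !gt_eqF //; lra. Qed.

Lemma der_sgm e c : 0 < e -> -1 < c -> is_derive c 1 (sgm e) (- 2 / (e * ((1 + c) * (1 + c)))).
Proof.
move=> e0 c1; have n0 : e * (1 + c) != 0 by apply: lt0r_neq0; apply: mulr_gt0; lra.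
have d1 := derB _ _ _ _ _ _ (der_cst (1 : R) c 1) (der_id c).
have d2 := derM _ _ _ _ _ _ (der_cst e c 1) (derD _ _ _ _ _ _ (der_cst (1 : R) c 1) (der_id c)).
have d3 := derM _ _ _ _ _ _ d1 (derV (fun y : R => e * (1 + y)) _ _ _ n0 d2).
change (is_derive c 1 (fun c => (1 - c) / (e * (1 + c))) (- 2 / (e * ((1 + c) * (1 + c))))).
apply: der_eq d3 _.
by field; rewrite !gt_eqF //; lra.
Qed.

Lemma Cn_sgm e d l : 0 < e -> Cn (halfdom d) l (sgm e).
Proof.
move=> e0; have oJ := open_halfdom d; set J := halfdom d in oJ *.
have c1 k := Cn_cst J l k oJ; have ci := Cn_id J l oJ.
apply: (CnM J l _ _ oJ (CnB J l _ _ oJ (c1 1) ci)).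
apply: (CnV J l _ oJ _ (CnM J l _ _ oJ (c1 e) (CnD J l _ _ oJ (c1 1) ci))) => c [h1 h2].
by apply: lt0r_neq0; apply: mulr_gt0; lra.
Qed.

Lemma half_smooth al be e r n G W : 1 <= be -> be < al -> (0 < n)%N -> 0 < e < 1 -> 0 < r <= 1 / 8 ->
  extension al be e r n G W -> forall l,
  [/\ Cn (halfdom (r * e)) l (pC e G), Cn (halfdom (r * e)) l (pS e G) & Cn (halfdom (r * e)) l (pv e W)].
Proof.
move=> b1 ab n0 he hr E l; have r0 : 0 < r by lra. have e0 : 0 < e by lra.
have [CG0 CW0] := extension_smooth al be e r n G W b1 ab n0 r0 E.
have oJ := open_halfdom (r * e); set J := halfdom (r * e) in oJ *.
have dom c : J c -> - r < sgm e c by exact: sgm_dom.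
have oI : open [set s : R | - r < s].
  by apply: open_ed => x xJ; exists (x + r); [move: xJ => /=; lra|move=> y; rewrite ltr_norml /=; lra].
have cs : Cn J l (sgm e) := Cn_sgm e (r * e) l e0.
have cG : Cn J l (fun c => G (sgm e c)) := Cn_comp J [set s : R | - r < s] l (sgm e) G oJ oI dom cs (CG0 l).
have cW : Cn J l (fun c => W (sgm e c)) := Cn_comp J [set s : R | - r < s] l (sgm e) W oJ oI dom cs (CW0 l).
have c1 k := Cn_cst J l k oJ; have ci := Cn_id J l oJ.
have cP : Cn J l (pP e G) := CnM J l _ _ oJ cs (CnM J l _ _ oJ cG cG).
have P1 c : J c -> 0 < 1 + pP e G c by move=> /dom; exact: (ex_den1 _ _ _ _ _ _ _ E).
have cP1 := CnD J l _ _ oJ (c1 1) cP.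
split.
- exact: (CnM J l _ _ oJ (CnB J l _ _ oJ (c1 1) cP) (CnV J l _ oJ (fun c Jc => lt0r_neq0 (P1 c Jc)) cP1)).
- apply: (CnM J l _ _ oJ (CnM J l _ _ oJ (c1 2) cG)).
  apply: (CnV J l _ oJ _ (CnM J l _ _ oJ (CnD J l _ _ oJ (c1 1) ci) (CnM J l _ _ oJ (c1 (Num.sqrt e)) cP1))).
  move=> c Jc; apply: lt0r_neq0; apply: mulr_gt0; first by case: Jc; lra.
  by apply: mulr_gt0; [rewrite sqrtr_gt0|exact: P1].
- exact: (CnD J l _ _ oJ (c1 1) (CnM J l _ _ oJ cs cW)).
Qed.

(** The last clause is the Euler-Lagrange equation rewritten with $dc/dx=-(1-c^2)$; it leaves out
    $c=1$ because the equation of [W] is divided by $s$. *)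
Lemma half_facts al be e r n G W : 1 <= be -> be < al -> n.+1%:R = al + 3 -> 0 < e < 1 -> 0 < r <= 1 / 8 ->
  extension al be e r n G W -> forall c, halfdom (r * e) c ->
  let C := pC e G in let S := pS e G in let v := pv e W in
  [/\ C c ^+ 2 + (1 - c ^+ 2) * S c ^+ 2 = 1, is_derive c 1 C (v c * S c ^+ 2), 0 < S c,
      (1 - c ^+ 2) * derive1 S c = S c * (c - C c * v c) &
      c != 1 -> (1 - c ^+ 2) * derive1 v c =
        - (qf al be (v c) * ((al - be * (v c * v c)) * C c - (al - be) * c * v c))].
Proof.
move=> b1 ab nE he hr E c Jc C S v; have e0 : 0 < e by lra.
have c1 : -1 < c by case: Jc. have c1' : 1 + c != 0 by apply: lt0r_neq0; lra.
have en : e != 0 by rewrite gt_eqF.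
have sd := sgm_dom e r c he hr Jc.
have q0 : 0 < Num.sqrt e by rewrite sqrtr_gt0. have qn : Num.sqrt e != 0 by rewrite gt_eqF.
have qq : Num.sqrt e * Num.sqrt e = e by rewrite -expr2 sqr_sqrtr // ltW.
have Gp := ex_pos _ _ _ _ _ _ _ E _ sd; have P1 := ex_den1 _ _ _ _ _ _ _ E _ sd.
have ds := der_sgm e c e0 c1.
have dGs := der_chain G _ _ _ _ _ ds (ex_G _ _ _ _ _ _ _ E _ sd).
have dP := derM _ _ _ _ _ _ ds (derM _ _ _ _ _ _ dGs dGs).
have P1n : 1 + sgm e c * (G (sgm e c) * G (sgm e c)) != 0 by exact: lt0r_neq0.
have dC := derM _ _ _ _ _ _ (derB _ _ _ _ _ _ (der_cst (1 : R) c 1) dP)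
  (derV (fun c : R => 1 + pP e G c) _ _ _ P1n (derD _ _ _ _ _ _ (der_cst (1 : R) c 1) dP)).
have den : (1 + c) * (Num.sqrt e * (1 + sgm e c * (G (sgm e c) * G (sgm e c)))) != 0.
  by rewrite !mulf_neq0.
have dS := derM _ _ _ _ _ _ (derM _ _ _ _ _ _ (der_cst (2 : R) c 1) dGs)
  (derV (fun c : R => (1 + c) * (Num.sqrt e * (1 + pP e G c))) _ _ _ den
    (derM _ _ _ _ _ _ (derD _ _ _ _ _ _ (der_cst (1 : R) c 1) (der_id c))
      (derM _ _ _ _ _ _ (der_cst (Num.sqrt e) c 1) (derD _ _ _ _ _ _ (der_cst (1 : R) c 1) dP)))).
have sE : sgm e c = (1 - c) / (e * (1 + c)) by [].
have S2 : S c ^+ 2 = 4 * (G (sgm e c) * G (sgm e c)) / ((1 + c) * (1 + c) * (e * ((1 + pP e G c) * (1 + pP e G c)))).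
  rewrite /S /pS; move: (pP e G c) (G (sgm e c)) (P1n : 1 + pP e G c != 0) => P g Pn.
  by rewrite -[in RHS]qq; move: (Num.sqrt e) qn => q qn; field; rewrite Pn c1' qn.
have c2 : 1 - c ^+ 2 = (1 - c) * (1 + c) by ring.
have sE1 : 1 - c = sgm e c * (e * (1 + c)) by rewrite sE; field; rewrite c1' en.
have esn : 1 + e * sgm e c != 0 by rewrite sgm_den // mulf_neq0 // invr_eq0.
(* With $c$ expressed by $s$, the remaining clauses are rational identities in $s$, [G] and [W]. *)
have cE : c = (1 - e * sgm e c) / (1 + e * sgm e c).
  by rewrite sgm_den // sE; field; rewrite en c1'.
split.
- rewrite S2 c2 sE1 /C /pC /pP; move: (sgm e c) (G (sgm e c)) P1n => s g P1n.
  by field; rewrite P1n en.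
- apply: der_eq dC _; rewrite S2 /v /pv /pP.
  move: (sgm e c) (G (sgm e c)) (W (sgm e c)) P1n => s g w P1n.
  by field; rewrite P1n c1' en.
- rewrite /S /pS; apply: divr_gt0; first by rewrite mulr_gt0.
  by apply: mulr_gt0; [(clear -c1; lra)|exact: mulr_gt0].
- rewrite (der_derive1 _ _ _ dS) /S /C /v /pS /pC /pv /pP.
  move: (G (sgm e c)) (W (sgm e c)) (Num.sqrt e) qn P1n => g w q qn P1n.
  move: (sgm e c) P1n cE esn => s P1n -> esn.
  by field; rewrite P1n qn en esn; (clear -b1; lra).
move=> cn; have sn : sgm e c != 0.
  by rewrite sE; apply: mulf_neq0; [rewrite subr_eq0 eq_sym|rewrite invr_eq0 mulf_neq0].
have dv := derD _ _ _ _ _ _ (der_cst (1 : R) c 1) (derM _ _ _ _ _ _ ds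
  (der_chain W _ _ _ _ _ ds (ex_W _ _ _ _ _ _ _ E _ sd sn))).
rewrite (der_derive1 _ _ _ dv) /C /v /pC /pv /pP /qf /singular_rhs nE.
have D0 : al + be * ((1 + sgm e c * W (sgm e c)) * (1 + sgm e c * W (sgm e c))) != 0.
  have vv : 0 <= (1 + sgm e c * W (sgm e c)) * (1 + sgm e c * W (sgm e c)) by exact: sqr_ge0.
  by apply: lt0r_neq0; have := mulr_ge0 (le_trans ler01 b1) vv; (clear -W b1 ab; lra).
move: (G (sgm e c)) (W (sgm e c)) P1n D0 => g w P1n D0.
move: (sgm e c) P1n cE esn sn D0 => s P1n -> esn sn D0.
by field; rewrite P1n D0 en esn sn; (clear -b1; lra).
Qed.

End HalfProfile.

(** * The profile on a neighbourhood of both poles *)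

Section Profile.
Context {R : realType}.
Implicit Types (e r s c d al be : R) (l : nat) (f : R -> R).

(** As functions of $c=\cos t$: [C] is $\cos r$, [S] is $\sin r/\sin t$, and [v] is $\dot r/S$, the
    derivative of $\ln\tan(r/2)$ with respect to $\ln\tan(t/2)$. The first-order relations among
    them suffice to compute the tension. *)
Record profile (al be d : R) (C S v : R -> R) : Prop := Profile {
  pr_smooth : forall l, [/\ Cn (symint (1 + d)) l C, Cn (symint (1 + d)) l S & Cn (symint (1 + d)) l v];
  pr_norm : forall c, `|c| < 1 + d -> C c ^+ 2 + (1 - c ^+ 2) * S c ^+ 2 = 1;
  pr_C : forall c, `|c| < 1 + d -> is_derive c 1 C (v c * S c ^+ 2);
  pr_pos : forall c, `|c| < 1 + d -> 0 < S c;
  pr_S : forall c, `|c| < 1 + d -> (1 - c ^+ 2) * derive1 S c = S c * (c - C c * v c);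
  pr_v : forall c, `|c| < 1 -> (1 - c ^+ 2) * derive1 v c =
    - (qf al be (v c) * ((al - be * (v c * v c)) * C c - (al - be) * c * v c));
  pr_C1 : C 1 = 1;
  pr_CN1 : C (- 1) = - 1 }.

(** [f] is smooth across $c=1$ only, so its reflected copy takes over near $c=-1$. For [f] of parity
    [a] both agree on $(-1,1)$, and the position of the cut there is immaterial. *)
Definition parity_ext (a : R) f c := if - (1 / 2) < c then f c else a * f (- c).

Lemma parity_extP a d f c : a * a = 1 -> (forall c, -1 < c < 1 -> f (- c) = a * f c) -> 
  (-1 < c -> parity_ext a f c = f c) /\ (c < 1 -> parity_ext a f c = a * f (- c)).
Proof.
move=> aa h; rewrite /parity_ext; case: ifPn => hc; split=> // c1.
  by rewrite h ?mulrA ?aa ?mul1r //; lra.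
by rewrite -leNgt in hc; rewrite h ?mulrA ?aa ?mul1r //; lra.
Qed.

Lemma parity_ext_near a d f : a * a = 1 -> (forall c, -1 < c < 1 -> f (- c) = a * f c) -> 
  (forall c, -1 < c -> \near c, f c = parity_ext a f c) /\
  (forall c, c < 1 -> \near c, a * f (- c) = parity_ext a f c).
Proof.
move=> aa h; split=> c hc.
  by apply: filterS (near_gt _ _ hc) => y hy; have [-> //] := parity_extP a d f y aa h.
by apply: filterS (near_lt _ _ hc) => y hy; have [_ ->] := parity_extP a d f y aa h.
Qed.

Lemma der_opp_arg f c D : is_derive (- c) 1 f D -> is_derive c 1 (fun c : R => f (- c)) (- D).
Proof.
move=> h; apply: der_eq (der_chain f (fun c : R => - c) c 1 _ _ (derN _ _ _ _ (der_id c)) h) _.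
by rewrite mulrN1.
Qed.

Lemma parity_smooth a d f l : a * a = 1 -> 0 < d -> (forall c, -1 < c < 1 -> f (- c) = a * f c) ->
  Cn (halfdom d) l f -> Cn (symint (1 + d)) l (parity_ext a f).
Proof.
move=> aa d0 h Cf; have oJ := open_halfdom d.
apply: Cn_cover => x; rewrite /symint /= ltr_norml => hx.
have [x1|x1] := ltP (-1) x.
  exists (halfdom d); first by split=> //; lra.
  by apply: Cn_eq Cf => // c [c1 _]; have [-> //] := parity_extP a d f c aa h.
pose J : set R := [set c | -(1 + d) < c /\ c < 1].
have oJ' : open J.
  apply: open_ed => y [y1 y2]; exists (Num.min (y + 1 + d) (1 - y)); first by rewrite lt_min; lra.
  by move=> z; rewrite lt_min !ltr_norml => /andP[h1 h2]; split; lra.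
exists J; first by split; lra.
apply: (Cn_eq J l (fun c => a * f (- c)) _ oJ').
  by move=> c [_ c1]; have [_ ->] := parity_extP a d f c aa h.
apply: (CnM J l _ _ oJ' (Cn_cst J l a oJ')).
apply: (Cn_comp J (halfdom d) l (fun c => - c) f oJ' oJ _ (CnN J l _ oJ' (Cn_id J l oJ')) Cf).
by move=> c [c1 c2]; split; lra.
Qed.

Lemma parity_flow al be e n r G W (u v : R -> R) : 1 <= be -> be < al -> 0 < e < 1 -> flow al be e u v ->
  u (- ln e / 2) = 0 ->
  (forall s, 0 < s -> G s = expR (u (ln s / 2) - ln s / 2)) ->
  (forall s, 0 < s -> v (ln s / 2) = 1 + s * W s) ->
  0 < r <= 1 / 8 -> extension al be e r n G W -> n.+1%:R = al + 3 ->
  forall c, -1 < c < 1 ->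
  [/\ pC e G (- c) = -1 * pC e G c, pS e G (- c) = 1 * pS e G c & pv e W (- c) = 1 * pv e W c].
Proof.
move=> b1 ab he fl uL hG hW hr E nE c hc; have e0 : 0 < e by lra.
have s0 x : -1 < x < 1 -> 0 < sgm e x.
  by move=> hx; apply: divr_gt0; [(clear -hx; lra)|apply: mulr_gt0; (clear -he hx; lra)].
have hN : -1 < - c < 1 by lra.
have sN : ln (sgm e (- c)) / 2 = - ln e - ln (sgm e c) / 2.
  (* In the variable $s$, the change $c\mapsto-c$ is $s\mapsto1/(e^2s)$, that is, reflection in the
     equator. *)
  rewrite (_ : sgm e (- c) = (e * (e * sgm e c))^-1); last by rewrite /sgm; field; rewrite !gt_eqF //; (clear -hc; lra).
  have es : 0 < e * sgm e c by apply: mulr_gt0 => //; exact: s0.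
  have ees := mulr_gt0 e0 es; have sc := s0 c hc.
  rewrite lnV ?posrE // lnM ?posrE // lnM ?posrE //.
  by field.
have [uN vN] := flow_reflect al be e u v (ln (sgm e c) / 2) b1 ab e0 fl uL.
have PE x : -1 < x < 1 -> pP e G x = expR (u (ln (sgm e x) / 2)) * expR (u (ln (sgm e x) / 2)).
  move=> hx; have sp := s0 x hx; rewrite /pP hG // -!expRD -{1}(@lnK _ (sgm e x)) ?posrE // -expRD.
  by congr (expR _); field.
have P0 x : -1 < x < 1 -> 0 < pP e G x by move=> hx; rewrite PE // mulr_gt0 ?expR_gt0.
have PN : pP e G (- c) = (pP e G c)^-1.
  by rewrite !PE // sN uN -!expRD -expRN; congr (expR _); ring.
have CN : pC e G (- c) = -1 * pC e G c.
  rewrite /pC PN; have := P0 c hc; move: (pP e G c) => P Pp.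
  by field; rewrite !gt_eqF //; (clear -P Pp; lra).
have hJ x : -1 < x < 1 -> halfdom (r * e) x.
  by move=> hx; have h0 : 0 < r * e by [apply: mulr_gt0; (clear -hr he; lra)]; split; (clear -hx h0; lra).
have [n1 _ S1 _ _] := half_facts al be e r n G W b1 ab nE he hr E c (hJ c hc).
have [n2 _ S2 _ _] := half_facts al be e r n G W b1 ab nE he hr E (- c) (hJ _ hN).
split=> //.
  (* Evenness of $S$ follows from that of $S^2=(1-C^2)/(1-c^2)$, since $S>0$. *)
  rewrite mul1r; apply/eqP; rewrite -(@eqrXn2 _ 2) ?ltW //; apply/eqP.
  have c2 : 1 - c ^+ 2 != 0 by rewrite (_ : 1 - c ^+ 2 = (1 - c) * (1 + c)); [rewrite mulf_neq0 // gt_eqF //; (clear -hc; lra)|ring].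
  apply: (mulfI c2); move: n2; rewrite CN sqrrN; (clear -G n1; lra).
by rewrite mul1r /pv -!hW ?s0 // sN vN.
Qed.

(** The value of [S] at 1 is the slope $\dot r(0)$; it is recorded because it recovers [e] from the
    map. *)
Theorem profile_exists al be n s0 g w u v e : 1 <= be -> be < al -> (0 < n)%N -> n.+1%:R = al + 3 ->
  family_spec al be n s0 g w u v -> 0 < e < 1 -> u e (- ln e / 2) = 0 ->
  exists d C S v, [/\ 0 < d, profile al be d C S v & S 1 = (Num.sqrt e)^-1].
Proof.
move=> b1 ab n0 nE FS he uL; have e0 : 0 < e by lra.
have [G [W [E hG hW]]] := extension_exists al be n s0 g w u v e b1 ab nE FS he uL.
have hs0 := fs_s0 _ _ _ _ _ _ _ _ FS.
have he' : 0 <= e <= 1 by lra.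
have fl := fs_flow _ _ _ _ _ _ _ _ FS e he'.
have par := parity_flow al be e n s0 G W (u e) (v e) b1 ab he fl uL hG hW hs0 E nE.
pose d := s0 * e; have d0 : 0 < d by apply: mulr_gt0; lra.
have hf := half_facts al be e s0 n G W b1 ab nE he hs0 E.
have pN : (-1) * (-1) = 1 :> R by rewrite mulrNN mulr1.
have p1 : 1 * 1 = 1 :> R by rewrite mulr1.
have eC c : -1 < c < 1 -> pC e G (- c) = -1 * pC e G c by move=> /par[].
have eS c : -1 < c < 1 -> pS e G (- c) = 1 * pS e G c by move=> /par[].
have ev c : -1 < c < 1 -> pv e W (- c) = 1 * pv e W c by move=> /par[].
set f1 := pC e G in eC hf; set f2 := pS e G in eS hf; set f3 := pv e W in ev hf.
exists d, (parity_ext (-1) f1), (parity_ext 1 f2), (parity_ext 1 f3).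
have C1 c : -1 < c -> parity_ext (-1) f1 c = f1 c by have [h _] := parity_extP (-1) d f1 c pN eC.
have S1 c : -1 < c -> parity_ext 1 f2 c = f2 c by have [h _] := parity_extP 1 d f2 c p1 eS.
have v1 c : -1 < c -> parity_ext 1 f3 c = f3 c by have [h _] := parity_extP 1 d f3 c p1 ev.
have C2 c : c < 1 -> parity_ext (-1) f1 c = - f1 (- c).
  by move=> hc; have [_ ->] := parity_extP (-1) d f1 c pN eC; rewrite ?mulN1r.
have S2 c : c < 1 -> parity_ext 1 f2 c = f2 (- c).
  by move=> hc; have [_ ->] := parity_extP 1 d f2 c p1 eS; rewrite ?mul1r.
have v2 c : c < 1 -> parity_ext 1 f3 c = f3 (- c).
  by move=> hc; have [_ ->] := parity_extP 1 d f3 c p1 ev; rewrite ?mul1r.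
have [nC1 nC2] := parity_ext_near (-1) d f1 pN eC.
have [nS1 nS2] := parity_ext_near 1 d f2 p1 eS.
have [nv1 nv2] := parity_ext_near 1 d f3 p1 ev.
have dom c : `|c| < 1 + d -> (-1 < c /\ halfdom d c) \/ (c < 1 /\ halfdom d (- c)).
  by clear -d0; rewrite ltr_norml => hc; case: (ltP (-1) c) => h; [left|right]; (split; last split); lra.
have smf := half_smooth al be e s0 n G W b1 ab n0 he hs0 E.
have d1 f (k : R) c : (forall l, Cn (halfdom d) l f) -> halfdom d c -> is_derive c 1 f (derive1 f c).
  by move=> Cf Jc; have [h _] := Cn_der _ _ _ (Cf 1%N); exact: h.
split=> //; last first.
  rewrite S1; last by (clear -R; lra).
  rewrite /f2 /pS /sgm subrr mul0r (ex_G0 _ _ _ _ _ _ _ E) /pP /sgm subrr !mul0r addr0.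
  by field; rewrite gt_eqF ?sqrtr_gt0.
split.
- move=> l; have [h1 h2 h3] := smf l.
  by split; apply: parity_smooth.
- move=> c /dom[] [c1 Jc]; have [h _ _ _ _] := hf _ Jc; first by rewrite C1 // S1.
  by move: h; rewrite C2 // S2 // !sqrrN.
- move=> c /dom[] [c1 Jc]; have [_ h _ _ _] := hf _ Jc.
    by rewrite S1 // v1 //; apply: der_near h; exact: nC1.
  rewrite S2 // v2 //; apply: der_near (nC2 _ c1) _.
  by apply: der_eq (derM _ _ _ _ _ _ (der_cst (-1 : R) c 1) (der_opp_arg _ _ _ h)) _; ring.
- by move=> c /dom[] [c1 Jc]; have [_ _ h _ _] := hf _ Jc; [rewrite S1|rewrite S2].
- move=> c /dom[] [c1 Jc]; have [_ _ _ h _] := hf _ Jc.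
    rewrite C1 // S1 // v1 // -h; congr (_ * _); apply: der_derive1.
    by apply: der_near (nS1 _ c1) _; apply: d1 => // l; have [] := smf l.
  have dS : is_derive c 1 (parity_ext 1 f2) (- derive1 f2 (- c)).
    apply: der_near (nS2 _ c1) _.
    have h' : is_derive (- c) 1 f2 (derive1 f2 (- c)) by apply: d1 => // l; have [] := smf l.
    by apply: der_eq (derM _ _ _ _ _ _ (der_cst (1 : R) c 1) (der_opp_arg _ _ _ h')) _; ring.
  rewrite (der_derive1 _ _ _ dS) C2 // S2 // v2 // mulrN -[in LHS](sqrrN c) h.
  by ring.
- move=> c; rewrite ltr_norml => /andP[c1 c2].
  have Jc : halfdom d c by split=> //; (clear -d d0 c2; lra).
  have [_ _ _ _ h] := hf _ Jc; rewrite C1 // v1 // -h; last by rewrite lt_eqF.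
  congr (_ * _); apply: der_derive1.
  by apply: der_near (nv1 _ c1) _; apply: d1 => // l; have [] := smf l.
- rewrite C1; last by (clear -R; lra).
  by rewrite /f1 /pC /pP /sgm subrr !mul0r subr0 addr0 divr1.
- rewrite C2 ?opprK; last by (clear -R; lra).
  by rewrite /f1 /pC /pP /sgm subrr !mul0r subr0 addr0 divr1.
Qed.

End Profile.

(** * Smooth functions on punctured space *)

Section SmoothScalars.
Context {R : realType} {n : nat}.
Local Notation T := 'rV[R]_n.+1.
Implicit Types (U : set T) (f g : T -> R) (x y : T) (i j : 'I_n.+1) (l : nat).

Definition vdir i : T := delta_mx 0 i.

(** The scalar counterpart of [Ck_on], for which sums, products and compositions are available;
    [Ck_on_coord] returns to vector-valued maps. *)
Fixpoint Sk U l f : Prop :=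
  (forall x, U x -> {for x, continuous f}) /\
  (if l is l'.+1 then forall i, (forall x, U x -> derivable f x (vdir i)) /\
     Sk U l' (fun x => 'D_(vdir i) f x) else True).

Lemma der_near_rV f g x v d : (\near x, f x = g x) -> is_derive x v f d -> is_derive x v g d.
Proof. exact: near_eq_is_derive. Qed.

Lemma open_near_rV U x : open U -> U x -> \near x, U x.
Proof. by move=> oU Ux; exact: open_nbhs_nbhs. Qed.

Lemma cont_near f g x : (\near x, f x = g x) -> {for x, continuous f} -> {for x, continuous g}.
Proof.
move=> h; rewrite /prop_for /continuous_at -(nbhs_singleton h); apply: cvg_trans.
exact: (near_eq_cvg h).
Qed.

Lemma Sk_cont U l f x : Sk U l f -> U x -> {for x, continuous f}.
Proof. by case: l => [|l] [h _]; exact: h. Qed.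

Lemma Sk_eq U l f g : open U -> (forall x, U x -> f x = g x) -> Sk U l f -> Sk U l g.
Proof.
move=> oU; elim: l f g => [|l IH] f g fg.
  move=> [h _]; split=> // x Ux; apply: cont_near (h x Ux).
  by apply: filterS (open_near_rV U x oU Ux).
move=> [h df].
have near_fg x : U x -> \near x, f x = g x.
  by move=> Ux; apply: filterS (open_near_rV U x oU Ux).
split; first by move=> x Ux; apply: cont_near (near_fg x Ux) (h x Ux).
move=> i; have [d1 d2] := df i; split.
  by move=> x Ux; apply: near_eq_derivable (near_fg x Ux) (d1 x Ux).
by apply: IH d2 => x Ux; apply: near_eq_derive; exact: near_fg.
Qed.

Lemma SkS U l f (f' : 'I_n.+1 -> T -> R) : open U -> (forall x, U x -> {for x, continuous f}) ->
  (forall i x, U x -> is_derive x (vdir i) f (f' i x)) -> (forall i, Sk U l (f' i)) -> Sk U l.+1 f.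
Proof.
move=> oU cf df Cf'; split=> // i; split; first by move=> x /(df i)[].
by apply: Sk_eq (Cf' i) => // x Ux; have [_ <-] := df i x Ux.
Qed.

Lemma Sk_der U l f i : Sk U l.+1 f ->
  (forall x, U x -> is_derive x (vdir i) f ('D_(vdir i) f x)) /\ Sk U l (fun x => 'D_(vdir i) f x).
Proof. by move=> [_ /(_ i)[df Cf]]; split=> // x Ux; apply: DeriveDef => //; exact: df. Qed.

Lemma Sk_pred U l f : Sk U l.+1 f -> Sk U l f.
Proof.
elim: l f => [|l IH] f [cf df]; first by split.
by split=> // i; have [d1 d2] := df i; split=> //; exact: IH.
Qed.

Lemma Sk_cst U l (c : R) : open U -> Sk U l (fun _ => c).
Proof.
move=> oU; elim: l c => [|l IH] c; first by split=> // x _; apply: cst_continuous.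
apply: (SkS U l (fun _ => c) (fun _ _ => 0) oU).
- by move=> x _; apply: cst_continuous.
- by move=> i; exact: IH.
Qed.

Lemma der_coord x i j : is_derive x (vdir i) (fun y : T => y 0 j) (i == j)%:R.
Proof.
have d : derivable (id : T -> T) x (vdir i) by exact: derivable_id.
apply: DeriveDef; first exact: (derivable_mxP _ _ _).1.
have := derive_id x (vdir i); rewrite derive_mx // => /matrixP/(_ 0 j).
by rewrite !mxE eqxx /= eq_sym => ->.
Qed.

Lemma Sk_coord U l j : open U -> Sk U l (fun x => x 0 j).
Proof.
move=> oU; have c0 x : {for x, continuous (fun x : T => x 0 j)} by exact: (@coord_continuous R 1 n.+1 0 j x).
case: l => [|l]; first by split=> // x _.
apply: (SkS U l _ (fun i _ => (i == j)%:R) oU) => [x _ //|i x _|i]; first exact: der_coord.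
exact: Sk_cst.
Qed.

Lemma SkD U l f g : open U -> Sk U l f -> Sk U l g -> Sk U l (fun x => f x + g x).
Proof.
move=> oU; elim: l f g => [|l IH] f g Cf Cg.
  by split=> // x Ux; exact: (continuousD (Sk_cont _ _ _ _ Cf Ux) (Sk_cont _ _ _ _ Cg Ux)).
apply: (SkS U l _ (fun i x => 'D_(vdir i) f x + 'D_(vdir i) g x) oU) => [x Ux|i x Ux|i].
- by exact: (continuousD (Sk_cont _ _ _ _ Cf Ux) (Sk_cont _ _ _ _ Cg Ux)).
- have [df _] := Sk_der _ _ _ i Cf; have [dg _] := Sk_der _ _ _ i Cg.
  by apply: derD; [exact: df|exact: dg].
have [_ df] := Sk_der _ _ _ i Cf; have [_ dg] := Sk_der _ _ _ i Cg.
exact: IH.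
Qed.

Lemma SkM U l f g : open U -> Sk U l f -> Sk U l g -> Sk U l (fun x => f x * g x).
Proof.
move=> oU; elim: l f g => [|l IH] f g Cf Cg.
  by split=> // x Ux; exact: (continuousM (Sk_cont _ _ _ _ Cf Ux) (Sk_cont _ _ _ _ Cg Ux)).
apply: (SkS U l _ (fun i x => 'D_(vdir i) f x * g x + f x * 'D_(vdir i) g x) oU) => [x Ux|i x Ux|i].
- by exact: (continuousM (Sk_cont _ _ _ _ Cf Ux) (Sk_cont _ _ _ _ Cg Ux)).
- have [df _] := Sk_der _ _ _ i Cf; have [dg _] := Sk_der _ _ _ i Cg.
  by apply: derM; [exact: df|exact: dg].
have [_ df] := Sk_der _ _ _ i Cf; have [_ dg] := Sk_der _ _ _ i Cg.
apply: (SkD U l _ _ oU); first exact: (IH _ _ df (Sk_pred _ _ _ Cg)).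
exact: (IH _ _ (Sk_pred _ _ _ Cf) dg).
Qed.

Lemma Sk_comp U (J : set R) l f (h : R -> R) : open U -> open J -> (forall x, U x -> J (f x)) ->
  Sk U l f -> Cn J l h -> Sk U l (fun x => h (f x)).
Proof.
move=> oU oJ fUJ; elim: l h => [|l IH] h Cf Ch.
  split=> // x Ux; apply: (@continuous_comp _ _ _ f h); first exact: Sk_cont Cf Ux.
  by apply: (Cn_cont _ _ _ _ Ch); exact: fUJ.
have [dh Ch'] := Cn_der _ _ _ Ch; move: (derive1 h : R -> R) dh Ch' => h' dh Ch'.
apply: (SkS U l (fun x => h (f x)) (fun i x => h' (f x) * 'D_(vdir i) f x) oU) => [x Ux|i x Ux|i].
- apply: (@continuous_comp _ _ _ f h); first exact: Sk_cont Cf Ux.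
  by apply: (Cn_cont _ _ _ _ Ch); exact: fUJ.
- have [df _] := Sk_der _ _ _ i Cf.
  by apply: der_chain; [exact: df|apply: dh; exact: fUJ].
have [_ df] := Sk_der _ _ _ i Cf.
exact: (SkM U l _ _ oU (IH _ (Sk_pred _ _ _ Cf) Ch') df).
Qed.

Lemma der_sum (I : Type) (r : seq I) (f : I -> T -> R) (d : I -> R) x v :
  (forall k, is_derive x v (f k) (d k)) -> is_derive x v (fun y => \sum_(k <- r) f k y) (\sum_(k <- r) d k).
Proof.
move=> h; elim: r => [|k r IH].
  rewrite big_nil (_ : (fun y => _) = (fun _ => 0)); first exact: der_cst.
  by apply/funext => y; rewrite big_nil.
rewrite big_cons (_ : (fun y => _) = (fun y => f k y + \sum_(k <- r) f k y)).
  exact: derD (h k) IH.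
by apply/funext => y; rewrite big_cons.
Qed.

Lemma Sk_sum U l (I : Type) (r : seq I) (f : I -> T -> R) : open U ->
  (forall k, Sk U l (f k)) -> Sk U l (fun y => \sum_(k <- r) f k y).
Proof.
move=> oU h; elim: r => [|k r IH].
  by apply: (Sk_eq U l (fun _ => 0) _ oU) => [x _|]; [rewrite big_nil|exact: Sk_cst].
apply: (Sk_eq U l (fun y => f k y + \sum_(k <- r) f k y) _ oU); first by move=> x _; rewrite big_cons.
exact: SkD.
Qed.

Lemma cvg_row (X : Type) (Fi : set_system X) {FF : Filter Fi} k (G : X -> 'rV[R]_k.+1) (a : 'rV[R]_k.+1) :
  (forall j : 'I_k.+1, G x 0 j @[x --> Fi] --> a 0 j) -> G x @[x --> Fi] --> a.
Proof.
move=> h; apply/cvgrPdist_le => e e0; near=> y.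
rewrite /Num.Def.normr /= mx_normrE (bigmax_le _ (ltW e0)) //= => -[i j] _.
rewrite !mxE /= (ord1 i); move: j; near: y; apply: filter_forall => j.
by have /cvgrPdist_le /(_ e e0) := h j.
Unshelve. all: by end_near.
Qed.

Lemma Ck_on_coord U l k (F : T -> 'rV[R]_k.+1) : open U ->
  (forall j : 'I_k.+1, Sk U l (fun x => F x 0 j)) -> Ck_on U l F.
Proof.
move=> oU.
have cF (G : T -> 'rV[R]_k.+1) x : (forall j : 'I_k.+1, {for x, continuous (fun x => G x 0 j)}) -> {for x, continuous G}.
  by move=> h; exact: (@cvg_row _ _ (nbhs_filter x) _ _ _ h).
elim: l F => [|l IH] F h; first by split=> // x Ux; apply: cF => j; exact: (Sk_cont _ _ _ _ (h j) Ux).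
split; first by move=> x Ux; apply: cF => j; exact: (Sk_cont _ _ _ _ (h j) Ux).
have dF x i : U x -> derivable F x (vdir i).
  move=> Ux; apply/derivable_mxP => a j; rewrite (ord1 a).
  by have [d _] := Sk_der _ _ _ i (h j); have [] := d x Ux.
move=> i; split; first by move=> x; exact: dF.
apply: IH => j; have [_ d] := Sk_der _ _ _ i (h j).
apply: Sk_eq d => // x Ux; rewrite /partial (derive_mx (dF x i Ux)) mxE //.
Unshelve. all: by end_near.
Qed.

End SmoothScalars.

(** * Direction coordinates and sums over directions *)

Section RadialCoordinates.
Context {R : realType} {n : nat}.
Local Notation T := 'rV[R]_n.+1.
Implicit Types (x : T) (i j : 'I_n.+1) (l : nat).

Definition punctured : set T := [set x | x != 0].

Lemma open_punctured : open punctured.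
Proof.
rewrite (_ : punctured = ~` [set 0]).
  by apply: closed_openC; exact: (accessible_closed_set1 (hausdorff_accessible (@norm_hausdorff _ _))).
by apply/seteqP; split=> x /= /eqP.
Qed.

Lemma dot_gt0 x : x != 0 -> 0 < dot x x.
Proof.
move=> x0; rewrite lt0r; apply/andP; split; last by apply: sumr_ge0 => i _; exact: sqr_ge0.
apply: contra x0 => /eqP h; apply/eqP/rowP => i; rewrite mxE; apply/eqP.
have /eqP := h; rewrite /dot psumr_eq0; last by move=> k _; exact: sqr_ge0.
by move=> /allP /(_ i (mem_index_enum _)) /=; rewrite mulf_eq0 orbb.
Qed.

(** Inverse radius; [om] below gives the coordinates of $x/|x|$. *)
Definition ir x := (enorm x)^-1.
Definition om j x := x 0 j * ir x.

Lemma enorm_gt0 x : x != 0 -> 0 < enorm x.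
Proof. by move=> /dot_gt0 h; rewrite /enorm sqrtr_gt0. Qed.

Lemma ir_gt0 x : x != 0 -> 0 < ir x.
Proof. by move=> /enorm_gt0 h; rewrite invr_gt0. Qed.

Lemma om_sum x : x != 0 -> \sum_(j < n.+1) om j x * om j x = 1.
Proof.
move=> x0; have h := dot_gt0 x x0.
have -> : \sum_(j < n.+1) om j x * om j x = dot x x * (ir x * ir x).
  by rewrite /dot mulr_suml; apply: eq_bigr => j _; rewrite /om; ring.
rewrite /ir -invfM /enorm -expr2 sqr_sqrtr ?ltW // divff //; exact: lt0r_neq0.
Qed.

Lemma om_le1 x j : x != 0 -> `|om j x| <= 1.
Proof.
move=> x0; rewrite -(@ler_pXn2r _ 2) // ?nnegrE // expr1n real_normK ?num_real // -(om_sum x x0).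
by rewrite (bigD1 j) //= -expr2 lerDl; apply: sumr_ge0 => k _; exact: sqr_ge0.
Qed.

Lemma der_dot x i : is_derive x (vdir i) (fun y : T => dot y y) (2 * x 0 i).
Proof.
have h k : is_derive x (vdir i) (fun y : T => y 0 k * y 0 k) ((i == k)%:R * x 0 k + x 0 k * (i == k)%:R).
  exact: derM (der_coord x i k) (der_coord x i k).
apply: der_eq (der_sum _ (index_enum _) _ _ _ _ h) _.
rewrite (bigD1 i) //= eqxx mulr1n big1 ?addr0; first by rewrite mul1r mulr1 mulr2n mulrDl mul1r.
by move=> k /negPf; rewrite eq_sym => ->; rewrite mul0r mulr0 addr0.
Qed.

Lemma der_ir x i : x != 0 -> is_derive x (vdir i) ir (- (x 0 i * (ir x * (ir x * ir x)))).
Proof.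
move=> x0; have h := dot_gt0 x x0; have e0 := enorm_gt0 x x0.
have de : is_derive x (vdir i) (@enorm R n.+1) ((2 * Num.sqrt (dot x x))^-1 * (2 * x 0 i)).
  exact: (der_chain (@Num.sqrt R) (fun y : T => dot y y) x _ _ _ (der_dot x i) (der_sqrt _ h)).
apply: der_eq (derV (@enorm R n.+1) _ _ _ (lt0r_neq0 e0) de) _.
rewrite /ir -/(enorm x); move: (enorm x) e0 => e e0.
by field; rewrite gt_eqF.
Qed.

Lemma der_om x i j : x != 0 ->
  is_derive x (vdir i) (om j) (ir x * ((i == j)%:R - om i x * om j x)).
Proof.
move=> x0; apply: der_eq (derM _ _ _ _ _ _ (der_coord x i j) (der_ir x i x0)) _.
by rewrite /om; ring.
Qed.

Lemma Sk_ir l : Sk punctured l ir.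
Proof.
have oU := open_punctured.
have dc : continuous (fun y : T => dot y y).
  have h : Sk setT 0 (fun y : T => dot y y).
    have oT := @openT T.
    apply: (Sk_sum setT 0 _ (index_enum _) (fun k (y : T) => y 0 k * y 0 k) oT) => k.
    exact: (SkM _ _ _ _ oT (Sk_coord _ _ k oT) (Sk_coord _ _ k oT)).
  by move=> x; exact: (Sk_cont _ _ _ x h).
have ci x : punctured x -> {for x, continuous ir}.
  move=> x0; have ce : {for x, continuous (@enorm R n.+1)}.
    exact: (@continuous_comp _ _ _ (fun y : T => dot y y) (@Num.sqrt R) x (dc x) (@sqrt_continuous R _)).
  exact: (continuousV (lt0r_neq0 (enorm_gt0 x x0)) ce).
elim: l => [|l IH]; first by split.
apply: (SkS punctured l ir (fun i x => - 1 * (x 0 i * (ir x * (ir x * ir x)))) oU ci) => [i x x0|i].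
  by apply: der_eq (der_ir x i x0) _; rewrite mulN1r.
apply: (SkM _ _ _ _ oU (Sk_cst _ _ _ oU)); apply: (SkM _ _ _ _ oU (Sk_coord _ _ i oU)).
exact: (SkM _ _ _ _ oU IH (SkM _ _ _ _ oU IH IH)).
Qed.

Lemma Sk_om l j : Sk punctured l (om j).
Proof. have oU := open_punctured; exact: (SkM _ _ _ _ oU (Sk_coord _ _ j oU) (Sk_ir l)). Qed.

(* The gradient of [om 0], up to the factor [ir x]. *)
Definition tang i x : R := (i == 0)%:R - om i x * om 0 x.

Lemma sum_delta (f : 'I_n.+1 -> R) i : \sum_(j < n.+1) (i == j)%:R * f j = f i.
Proof.
rewrite (bigD1 i) //= eqxx mul1r big1 ?addr0 // => k /negPf.
by rewrite eq_sym => ->; rewrite mul0r.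
Qed.

(** Each row of the differential, and the map itself, is a combination of the unit vector [w], $e_i$
    and $e_0$, so this one expansion yields all the norms. *)
Lemma sum_row (w : 'I_n.+1 -> R) (p q t : R) i : \sum_(j < n.+1) w j * w j = 1 ->
  \sum_(j < n.+1) (p * w j + q * (i == j)%:R + t * (j == 0)%:R) ^+ 2 =
  p ^+ 2 + q ^+ 2 + t ^+ 2 + 2 * p * q * w i + 2 * p * t * w 0 + 2 * q * t * (i == 0)%:R.
Proof.
move=> w1.
have -> : \sum_(j < n.+1) (p * w j + q * (i == j)%:R + t * (j == 0)%:R) ^+ 2 =
    \sum_(j < n.+1) (p ^+ 2 * (w j * w j) + (i == j)%:R * (q ^+ 2 + 2 * p * q * w j + 2 * q * t * (j == 0)%:R) +
      (0 == j)%:R * (t ^+ 2 + 2 * p * t * w j)).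
  apply: eq_bigr => j _; rewrite [j == 0]eq_sym.
  by case: (i == j); case: (0 == j); rewrite /= ?mulr1n ?mulr0n; ring.
rewrite !big_split /= -mulr_sumr w1 !sum_delta.
by ring.
Qed.

(** The vector [a] is the part of $e_0$ tangent to the sphere at [w]: it is orthogonal to [w] and
    has squared length $1-w_0^2$. The six coefficients cover the traces for both the energy density
    and the divergence. *)
Lemma sum_div (w : 'I_n.+1 -> R) (k1 k2 k3 k4 k5 k6 : R) j : \sum_(j < n.+1) w j * w j = 1 ->
  let a i := (i == 0)%:R - w i * w 0 in
  \sum_(i < n.+1) (k1 * a i ^+ 2 + k2 * (a i * w i) + k3 * w i ^+ 2 + k4 * (a i * (i == j)%:R) +
     k5 * (w i * (i == j)%:R) + k6) =
  k1 * (1 - w 0 ^+ 2) + k3 + k4 * a j + k5 * w j + n.+1%:R * k6.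
Proof.
move=> w1 a.
have sq : \sum_(i < n.+1) a i ^+ 2 = 1 - w 0 ^+ 2.
  have -> : \sum_(i < n.+1) a i ^+ 2 = \sum_(i < n.+1) ((0 == i)%:R * (1 - 2 * w i * w 0) + w 0 ^+ 2 * (w i * w i)).
    by apply: eq_bigr => i _; rewrite /a [i == 0]eq_sym; case: (0 == i); rewrite /= ?mulr1n ?mulr0n; ring.
  by rewrite big_split /= -mulr_sumr w1 sum_delta; ring.
have aw : \sum_(i < n.+1) a i * w i = 0.
  have -> : \sum_(i < n.+1) a i * w i = \sum_(i < n.+1) ((0 == i)%:R * w i + (- w 0) * (w i * w i)).
    by apply: eq_bigr => i _; rewrite /a [i == 0]eq_sym; ring.
  by rewrite big_split /= -mulr_sumr w1 sum_delta; ring.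
rewrite !big_split /= -!mulr_sumr sq aw sumr_const card_ord -[k6 *+ _]mulr_natl.
have -> : \sum_(i < n.+1) w i ^+ 2 = 1 by rewrite -[RHS]w1; apply: eq_bigr => i _; rewrite expr2.
have pick (f : 'I_n.+1 -> R) : \sum_(i < n.+1) f i * (i == j)%:R = f j.
  by rewrite -[RHS]sum_delta; apply: eq_bigr => i _; rewrite mulrC eq_sym.
by rewrite !pick; ring.
Qed.

End RadialCoordinates.

(** * The rotationally symmetric map *)

Section RadialMap.
Context {R : realType} {n : nat}.
Local Notation T := 'rV[R]_n.+1.
Implicit Types (x : T) (y : usphere R n.+1) (i j : 'I_n.+1) (l : nat) (C S v : R -> R) (al be d c : R).

(* Writing [phi u] as [S u + (C - c S) e_0] treats the polar coordinate [u_0] and the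
   equatorial ones uniformly. *)
Definition axial C S c : R := C c - c * S c.

(** The default [y] of [insubd] is never taken for a profile: [norm_row] shows that the vector is a
    unit vector. *)
Definition rmap C S y : usphere R n.+1 :=
  insubd y (\row_j (S (val y 0 0) * val y 0 j + (j == 0)%:R * axial C S (val y 0 0))).

Lemma unit_neq0 x : dot x x = 1 -> x != 0.
Proof.
move=> h; apply/eqP => x0; move: h; rewrite x0 /dot big1 => [/eqP|i _]; last by rewrite mxE mul0r.
by rewrite eq_sym oner_eq0.
Qed.

Lemma ir_unit x : dot x x = 1 -> ir x = 1.
Proof. by move=> h; rewrite /ir /enorm h sqrtr1 invr1. Qed.

Lemma om_unit x j : dot x x = 1 -> om j x = x 0 j.
Proof. by move=> h; rewrite /om ir_unit // mulr1. Qed.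

Lemma val_dot y : dot (val y) (val y) = 1.
Proof. by apply/eqP; exact: (valP y). Qed.

Variables (al be d : R) (C S v : R -> R).
Hypothesis d0 : 0 < d.
Hypothesis pr : profile al be d C S v.

Let le1 c : `|c| <= 1 -> `|c| < 1 + d.
Proof. by move=> h; have := d0; lra. Qed.

Lemma norm_row (w : 'I_n.+1 -> R) : \sum_(j < n.+1) w j * w j = 1 -> `|w 0| <= 1 ->
  \sum_(j < n.+1) (S (w 0) * w j + (j == 0)%:R * axial C S (w 0)) ^+ 2 = 1.
Proof.
move=> w1 hw; rewrite -[RHS](pr_norm _ _ _ _ _ _ pr (w 0) (le1 _ hw)).
rewrite (eq_bigr (fun j => (S (w 0) * w j + 0 * (0 == j)%:R + axial C S (w 0) * (j == 0)%:R) ^+ 2)).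
  by rewrite sum_row // /axial; ring.
by move=> j _; ring.
Qed.

Lemma rmap_val y j : val (rmap C S y) 0 j =
  S (val y 0 0) * val y 0 j + (j == 0)%:R * axial C S (val y 0 0).
Proof.
rewrite /rmap insubdK ?mxE //; rewrite -topredE /= /dot.
have hy := val_dot y.
under eq_bigr do rewrite !mxE -expr2.
apply/eqP; apply: (norm_row (fun j => val y 0 j)); first exact: hy.
by rewrite -om_unit //; apply: om_le1; exact: unit_neq0.
Qed.

Lemma radial_rmap x j : x != 0 -> radial_ext (rmap C S) x 0 j =
  S (om 0 x) * om j x + (j == 0)%:R * axial C S (om 0 x).
Proof.
move=> x0; have h : dot (ir x *: x) (ir x *: x) = 1.
  rewrite -[RHS](om_sum x x0); apply: eq_bigr => k _; rewrite !mxE /om; ring.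
have e k : (ir x *: x) 0 k = om k x by rewrite mxE /om mulrC.
rewrite /radial_ext; case: insubP => [u _ uE|]; last by rewrite h eqxx.
by rewrite /= rmap_val uE -!e.
Qed.

Let I := symint (1 + d).
Let oI : open I. Proof. exact: open_symint. Qed.

Lemma axial_smooth l : Cn I l (axial C S).
Proof.
have [CC CS _] := pr_smooth _ _ _ _ _ _ pr l.
exact: (CnB I l _ _ oI CC (CnM I l _ _ oI (Cn_id I l oI) CS)).
Qed.

Lemma rmap_coord_smooth l j :
  Sk punctured l (fun x => S (om 0 x) * om j x + (j == 0)%:R * axial C S (om 0 x)).
Proof.
have oU := @open_punctured R n; have [_ CS _] := pr_smooth _ _ _ _ _ _ pr l.
have h x : punctured x -> I (om 0 x) by move=> x0; apply: le1; exact: om_le1.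
have o (k : 'I_n.+1) : @Sk R n punctured l (om k) := Sk_om l k.
have h1 := SkM punctured l _ _ oU (Sk_comp punctured I l (om 0) S oU oI h (o 0) CS) (o j).
have h2 := SkM punctured l _ _ oU (Sk_cst punctured l (j == 0)%:R oU)
  (Sk_comp punctured I l (om 0) _ oU oI h (o 0) (axial_smooth l)).
exact: (SkD _ _ _ _ oU h1 h2).
Qed.

Lemma rmap_smooth : smooth_map (rmap C S).
Proof.
move=> l; apply: (Ck_on_coord _ _ _ _ open_punctured) => j.
apply: (Sk_eq _ _ _ _ open_punctured) (rmap_coord_smooth l j) => x x0.
by rewrite radial_rmap.
Qed.

Let S1 := derive1 S.
Let B1 := derive1 (axial C S).

Lemma der_S c : I c -> is_derive c 1 S (S1 c).
Proof. by move=> Ic; have [_ CS _] := pr_smooth _ _ _ _ _ _ pr 1%N; have [h _] := Cn_der _ _ _ CS; exact: h. Qed.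

Lemma der_S1 c : I c -> is_derive c 1 S1 (derive1 S1 c).
Proof.
by move=> Ic; have [_ CS _] := pr_smooth _ _ _ _ _ _ pr 2%N; have [_ h] := Cn_der _ _ _ CS;
  have [h' _] := Cn_der _ _ _ h; exact: h'.
Qed.

Lemma der_axial c : I c -> is_derive c 1 (axial C S) (B1 c).
Proof. by move=> Ic; have [h _] := Cn_der _ _ _ (axial_smooth 1); exact: h. Qed.

Lemma der_axial1 c : I c -> is_derive c 1 B1 (derive1 B1 c).
Proof. by move=> Ic; have [_ h] := Cn_der _ _ _ (axial_smooth 2); have [h' _] := Cn_der _ _ _ h; exact: h'. Qed.

Lemma axial1E c : I c -> B1 c = v c * S c ^+ 2 - S c - c * S1 c.
Proof.
move=> Ic; apply: der_derive1.
apply: der_eq (derB _ _ _ _ _ _ (pr_C _ _ _ _ _ _ pr c Ic) (derM _ _ _ _ _ _ (der_id c) (der_S c Ic))) _.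
by ring.
Qed.

(** The partial derivative in direction [i] of coordinate [j] without its factor $1/|x|$, hence a
    function of $x/|x|$ only. *)
Definition grad i j x : R := S1 (om 0 x) * (tang i x * om j x) +
  S (om 0 x) * ((i == j)%:R - om i x * om j x) + (j == 0)%:R * (B1 (om 0 x) * tang i x).

Lemma om0_dom x : x != 0 -> I (om 0 x).
Proof. by move=> x0; apply: le1; exact: om_le1. Qed.

Lemma der_rmap x i j : x != 0 ->
  is_derive x (vdir i) (fun x => radial_ext (rmap C S) x 0 j) (ir x * grad i j x).
Proof.
move=> x0; apply: (der_near_rV (fun x => S (om 0 x) * om j x + (j == 0)%:R * axial C S (om 0 x))).
  by apply: filterS (open_near_rV _ x open_punctured x0) => z z0; rewrite radial_rmap.
have dw := der_om x i; have Ic := om0_dom x x0.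
have dS := der_chain S (om 0) x _ _ _ (dw 0 x0) (der_S _ Ic).
have dB := der_chain (axial C S) (om 0) x _ _ _ (dw 0 x0) (der_axial _ Ic).
apply: der_eq (derD _ _ _ _ _ _ (derM _ _ _ _ _ _ dS (dw j x0)) (derM _ _ _ _ _ _ (der_cst ((j == 0)%:R : R) x (vdir i)) dB)) _.
by rewrite /grad /tang; ring.
Qed.

Lemma partial_rmap x i j : x != 0 -> partial i (radial_ext (rmap C S)) x 0 j = ir x * grad i j x.
Proof.
move=> x0; have dF : derivable (radial_ext (rmap C S)) x (vdir i).
  by have [_ h] := rmap_smooth 1%N; have [h1 _] := h i; exact: h1.
by rewrite /partial (derive_mx dF) mxE; have [_ ->] := der_rmap x i j x0.
Qed.

(** The norm of the differential at colatitude $t$ with $c=\cos t$: one stretching factor is $\dot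
    r=vS$, the other $al=m-1$ equal $\sin r/\sin t=S$. It is positive, so its powers are
    differentiable. *)
Definition energy c : R := S c * Num.sqrt (v c ^+ 2 + al).

Lemma grad_sum x : n%:R = al + 1 -> 0 < al -> x != 0 ->
  \sum_(i < n.+1) \sum_(j < n.+1) grad i j x ^+ 2 = energy (om 0 x) ^+ 2.
Proof.
move=> nE al0 x0; have w1 := om_sum x x0; have Ic := om0_dom x x0.
set c := om 0 x in Ic *.
have e i : \sum_(j < n.+1) grad i j x ^+ 2 =
  (S1 c ^+ 2 + B1 c ^+ 2 + 2 * c * S1 c * B1 c + 2 * S c * B1 c) * tang i x ^+ 2 + 0 * (tang i x * om i x) +
  (- S c ^+ 2) * om i x ^+ 2 + 0 * (tang i x * (i == 0)%:R) + 0 * (om i x * (i == 0)%:R) + S c ^+ 2.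
  have := sum_row (fun j => om j x) (S1 c * tang i x - S c * om i x) (S c) (B1 c * tang i x) i w1.
  rewrite (eq_bigr (fun j => grad i j x ^+ 2)); last first.
    by move=> j _; rewrite /grad -/c; congr (_ ^+ 2); ring.
  by move=> ->; rewrite -/c /tang -/c; ring.
rewrite (eq_bigr _ (fun i _ => e i)).
have := sum_div (fun j => om j x) (S1 c ^+ 2 + B1 c ^+ 2 + 2 * c * S1 c * B1 c + 2 * S c * B1 c) 0 (- S c ^+ 2) 0 0 (S c ^+ 2) 0 w1.
move=> /= ->; rewrite -/c !mul0r !addr0 -[n.+1]addn1 natrD nE.
have -> : energy c ^+ 2 = S c ^+ 2 * (v c ^+ 2 + al).
  by rewrite [LHS]exprMn sqr_sqrtr //; have := sqr_ge0 (v c); lra.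
rewrite (axial1E c Ic); have hS := pr_S _ _ _ _ _ _ pr c Ic; have hC := pr_norm _ _ _ _ _ _ pr c Ic.
have D1 : (1 - c ^+ 2) * S1 c = S c * (c - C c * v c) by [].
move: (S1 c) (S c) (C c) (v c) hC D1 => s1 s C0 v0 hC D1.
have -> : (s1 ^+ 2 + (v0 * s ^+ 2 - s - c * s1) ^+ 2 + 2 * c * s1 * (v0 * s ^+ 2 - s - c * s1) +
   2 * s * (v0 * s ^+ 2 - s - c * s1)) * (1 - c ^+ 2) - s ^+ 2 + (al + 1 + 1) * s ^+ 2 =
   (v0 ^+ 2 * s ^+ 2 - 1) * s ^+ 2 * (1 - c ^+ 2) + ((1 - c ^+ 2) * s1) ^+ 2 - 2 * c * s * ((1 - c ^+ 2) * s1) + (al + 1) * s ^+ 2.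
  ring.
rewrite D1.
(* A factor 1 is replaced by the norm relation, after which the two sides agree as polynomials. *)
have -> : s ^+ 2 * (v0 ^+ 2 + al) = s ^+ 2 * v0 ^+ 2 * (C0 ^+ 2 + (1 - c ^+ 2) * s ^+ 2) + al * s ^+ 2 by rewrite hC; ring.
ring.
Qed.

Lemma energy_gt0 c : 0 < al -> I c -> 0 < energy c.
Proof.
move=> al0 Ic; rewrite /energy; apply: mulr_gt0; first exact: (pr_pos _ _ _ _ _ _ pr).
by rewrite sqrtr_gt0; have := sqr_ge0 (v c); lra.
Qed.

Lemma hs_rmap x : n%:R = al + 1 -> 0 < al -> x != 0 ->
  hs_norm_diff (radial_ext (rmap C S)) x = ir x * energy (om 0 x).
Proof.
move=> nE al0 x0; rewrite /hs_norm_diff.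
have -> : \sum_(i < n.+1) dot (partial i (radial_ext (rmap C S)) x) (partial i (radial_ext (rmap C S)) x) =
    (ir x * energy (om 0 x)) ^+ 2.
  rewrite exprMn -grad_sum // mulr_sumr; apply: eq_bigr => i _.
  rewrite mulr_sumr; apply: eq_bigr => j _; rewrite partial_rmap //; ring.
rewrite sqrtr_sqr ger0_norm //; apply: mulr_ge0; first exact: ltW (ir_gt0 _ x0).
by apply/ltW/energy_gt0 => //; exact: om0_dom.
Qed.

End RadialMap.

(** * The tension field of the map *)

Section Tension.
Context {R : realType} {n : nat}.
Local Notation T := 'rV[R]_n.+1.
Implicit Types (x : T) (y : usphere R n.+1) (i j : 'I_n.+1) (l : nat) (al be c : R).

(** The relations express [s1], [s2], [v1] and [Om1] by $c$, $C$, $v$, and $s^2=(1-C^2)/(1-c^2)$.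
    The coefficient of $u$ becomes $\Omega sA$ and the polar component of the divergence $\Omega
    s^2B$, so parallelism with the map is $AC=s^2B$, a rational identity in $c$, $C$, $v$. *)
Lemma tension_identity al be (c C s v s1 s2 v1 Om Om1 a : R) :
  let q := be - 1 in let N := al + 1 in
  let b1 := v * s ^+ 2 - s - c * s1 in
  let b2 := v1 * s ^+ 2 + 2 * v * s * s1 - 2 * s1 - c * s2 in
  0 < al -> 1 <= be -> 0 < s -> 1 - c ^+ 2 != 0 ->
  C ^+ 2 + (1 - c ^+ 2) * s ^+ 2 = 1 ->
  (1 - c ^+ 2) * s1 = s * (c - C * v) ->
  (1 - c ^+ 2) * s2 - 2 * c * s1 = s1 * (c - C * v) + s * (1 - v * s ^+ 2 * v - C * v1) ->
  (1 - c ^+ 2) * v1 = a ->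
  a = - (qf al be v * ((al - be * (v * v)) * C - (al - be) * c * v)) ->
  (1 - c ^+ 2) * Om1 = Om * (q * (c - C * v + v * a / (v ^+ 2 + al))) ->
  ((Om1 * s1 + Om * s2) * (1 - c ^+ 2) - N * (Om * c * s1 + Om * s) - c * (Om1 * s + 2 * Om * s1)) * (C - c * s) =
  ((Om1 * b1 + Om * b2) * (1 - c ^+ 2) - N * (Om * c * b1) + (Om1 * s + 2 * Om * s1)) * s.
Proof.
move=> q N b1 b2 al0 be1 s0 D0 hC hs1 hs2 hv1 ha hO.
have v2 : 0 <= v * v by exact: sqr_ge0.
have Q0 : v ^+ 2 + al != 0 by rewrite expr2 gt_eqF //; lra.
have Q1 : al + be * (v * v) != 0.
  by have : 0 <= be * (v * v) by [apply: mulr_ge0 => //; lra]; move=> h; rewrite gt_eqF //; lra.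
set D := 1 - c ^+ 2 in D0 hC hs1 hs2 hv1 hO *.
pose Q := q * (c - C * v + v * a / (v ^+ 2 + al)).
pose k1 := (c - C * v) / D.
pose sg := (1 - C ^+ 2) / D.
have sgE : s ^+ 2 = sg by rewrite /sg -hC addrAC subrr add0r; field.
have e1 : s1 = s * k1 by rewrite /k1 mulrA -hs1; field.
have ev : v1 = a / D by rewrite -hv1; field.
pose k2 := ((3 * c - C * v) * k1 + 1 - v ^+ 2 * sg - C * (a / D)) / D.
have e2 : s2 = s * k2.
  have h : D * s2 = 2 * c * s1 + (s1 * (c - C * v) + s * (1 - v * s ^+ 2 * v - C * v1)) by rewrite -hs2; ring.
  apply: (mulfI D0); rewrite h e1 ev sgE /k2; field; exact: D0.
have eO : Om1 = Om * Q / D by rewrite /Q -hO; field.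
pose A := (Q / D * k1 + k2) * D - N * (c * k1 + 1) - c * (Q / D + 2 * k1).
pose B := D * (a / D + 2 * v * k1) - N * c * v + Q * v.
(* The Euler-Lagrange equation [ha] enters here and nowhere else. *)
have key : A * C = sg * B.
  rewrite /A /B /k2 /sg /k1 /Q ha /qf /q /N /D.
  by field; rewrite Q1 Q0 D0.
have T0 : c * ((Om1 * s1 + Om * s2) * D - N * (Om * c * s1 + Om * s) - c * (Om1 * s + 2 * Om * s1)) +
   ((Om1 * b1 + Om * b2) * D - N * (Om * c * b1) + (Om1 * s + 2 * Om * s1)) =
   Om * (D * (v1 * s ^+ 2 + 2 * v * s * s1) - N * c * (v * s ^+ 2)) + Om1 * D * (v * s ^+ 2).
  by rewrite /b1 /b2 /D; ring.
have al_E : (Om1 * s1 + Om * s2) * D - N * (Om * c * s1 + Om * s) - c * (Om1 * s + 2 * Om * s1) = Om * s * A.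
  by rewrite e2 e1 eO /A; field; exact: D0.
have T0E : Om * (D * (v1 * s ^+ 2 + 2 * v * s * s1) - N * c * (v * s ^+ 2)) + Om1 * D * (v * s ^+ 2) = Om * s ^+ 2 * B.
  by rewrite e1 ev eO /B; field; exact: D0.
move: T0; rewrite T0E al_E => T0.
have -> : (Om1 * b1 + Om * b2) * D - N * (Om * c * b1) + (Om1 * s + 2 * Om * s1) = Om * s ^+ 2 * B - c * (Om * s * A).
  by rewrite -T0; ring.
have -> : Om * s * A * (C - c * s) = Om * s * (A * C) - Om * s * A * c * s by ring.
by rewrite key -sgE; ring.
Qed.

Lemma tproj_parallel y k : tproj y (k *: val y) = 0.
Proof.
rewrite /tproj; have -> : dot (k *: val y) (val y) = k.
  transitivity (k * dot (val y) (val y)); last by rewrite val_dot mulr1.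
  by rewrite /dot mulr_sumr; apply: eq_bigr => i _; rewrite mxE mulrA.
by rewrite subrr.
Qed.

Variables (al be d : R) (C S v : R -> R).
Hypothesis d0 : 0 < d.
Hypothesis pr : profile al be d C S v.
Hypothesis al0 : 0 < al.
Hypothesis be1 : 1 <= be.
Hypothesis nE : n%:R = al + 1.
Variable q : nat.
Hypothesis qE : q%:R = be - 1.

Let I := symint (1 + d).
Let S1 := derive1 S.
Let S2 := derive1 S1.
Let B := axial C S.
Let B1 := derive1 B.
Let B2 := derive1 B1.
Let v1 := derive1 v.
Let E := energy al S v.
Let E1 c := S1 c * Num.sqrt (v c ^+ 2 + al) + S c * ((2 * Num.sqrt (v c ^+ 2 + al))^-1 * (2 * v c * v1 c)).

Lemma der_v c : I c -> is_derive c 1 v (v1 c).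
Proof. by move=> Ic; have [_ _ Cv] := pr_smooth _ _ _ _ _ _ pr 1%N; have [h _] := Cn_der _ _ _ Cv; exact: h. Qed.

Let va0 c : 0 < v c ^+ 2 + al.
Proof. by have := al0; have := sqr_ge0 (v c); lra. Qed.

Lemma der_energy c : I c -> is_derive c 1 E (E1 c).
Proof.
move=> Ic; have dv := der_v c Ic.
have d2 : is_derive c 1 (fun c => v c ^+ 2 + al) (2 * v c * v1 c).
  apply: der_eq (derD _ _ _ _ _ _ (derX 2 _ _ _ _ dv) (der_cst al c 1)) _.
  by rewrite /= expr1 addr0.
have ds := der_chain (@Num.sqrt R) _ _ _ _ _ d2 (der_sqrt _ (va0 c)).
exact: derM (der_S _ _ _ _ _ _ pr c Ic) ds.
Qed.

Let gradij := @grad R n C S.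

Let wij i j x : R := (i == j)%:R - om i x * om j x.

Lemma der_grad x i j : dot x x = 1 -> is_derive x (vdir i) (gradij i j)
  (S2 (om 0 x) * tang i x * (tang i x * om j x) +
   S1 (om 0 x) * (- (wij i i x * om 0 x + om i x * tang i x) * om j x + tang i x * wij i j x) +
   S1 (om 0 x) * tang i x * wij i j x - S (om 0 x) * (wij i i x * om j x + om i x * wij i j x) +
   (j == 0)%:R * (B2 (om 0 x) * tang i x * tang i x - B1 (om 0 x) * (wij i i x * om 0 x + om i x * tang i x))).
Proof.
move=> xu; have x0 := unit_neq0 _ xu; have irE := ir_unit _ xu.
have Ic : I (om 0 x) by exact: (om0_dom d d0).
have dw k : is_derive x (vdir i) (om k) (wij i k x).
  by apply: der_eq (der_om x i k x0) _; rewrite irE mul1r.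
have dt : is_derive x (vdir i) (tang i) (0 - (wij i i x * om 0 x + om i x * wij i 0 x)).
  exact: (derB _ _ _ _ _ _ (der_cst ((i == 0)%:R : R) x (vdir i)) (derM _ _ _ _ _ _ (dw i) (dw 0))).
have dS := der_chain S (om 0) x _ _ _ (dw 0) (der_S _ _ _ _ _ _ pr _ Ic).
have dS1 := der_chain S1 (om 0) x _ _ _ (dw 0) (der_S1 _ _ _ _ _ _ pr _ Ic).
have dB1 := der_chain B1 (om 0) x _ _ _ (dw 0) (der_axial1 _ _ _ _ _ _ pr _ Ic).
have h1 := derM _ _ _ _ _ _ dS1 (derM _ _ _ _ _ _ dt (dw j)).
have h2 := derM _ _ _ _ _ _ dS (derB _ _ _ _ _ _ (der_cst ((i == j)%:R : R) x (vdir i)) (derM _ _ _ _ _ _ (dw i) (dw j))).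
have h3 := derM _ _ _ _ _ _ (der_cst ((j == 0)%:R : R) x (vdir i)) (derM _ _ _ _ _ _ dB1 dt).
apply: der_eq (derD _ _ _ _ _ _ (derD _ _ _ _ _ _ h1 h2) h3) _.
rewrite -/S1 -/S2 -/B1 -/B2 /wij -!/(tang i x).
by ring.
Qed.

Let F := @radial_ext R n n (rmap C S).

Definition flux i x : T := hs_norm_diff F x ^+ q *: partial i F x.

Lemma der_flux x i j : dot x x = 1 -> let c := om 0 x in
  is_derive x (vdir i) (fun x => flux i x 0 j)
  (q%:R * E c ^+ q.-1 * (- om i x * E c + E1 c * tang i x) * gradij i j x +
   E c ^+ q * (- om i x * gradij i j x + 'D_(vdir i) (gradij i j) x)).
Proof.
move=> xu c; have x0 := unit_neq0 _ xu; have irE := ir_unit _ xu.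
have Ic : I (om 0 x) by exact: (om0_dom d d0).
apply: (der_near_rV (fun x => (ir x * E (om 0 x)) ^+ q * (ir x * gradij i j x))).
  apply: filterS (open_near_rV _ x open_punctured x0) => z z0.
  rewrite /flux mxE (hs_rmap al be d C S v d0 pr) //; congr (_ * _).
  by rewrite (partial_rmap al be d C S v d0 pr).
have dw k : is_derive x (vdir i) (om k) (wij i k x).
  by apply: der_eq (der_om x i k x0) _; rewrite irE mul1r.
have dir : is_derive x (vdir i) (@ir R n) (- om i x).
  by apply: der_eq (der_ir x i x0) _; rewrite /om irE !mulr1.
have dE := der_chain E (om 0) x _ _ _ (dw 0) (der_energy _ Ic).
have dg : is_derive x (vdir i) (gradij i j) ('D_(vdir i) (gradij i j) x).
  by have [h _] := der_grad x i j xu; apply: DeriveDef.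
apply: der_eq (derM _ _ _ _ _ _ (derX q _ _ _ _ (derM _ _ _ _ _ _ dir dE)) (derM _ _ _ _ _ _ dir dg)) _.
by rewrite irE !mul1r /c /tang /wij.
Qed.

Let Om c := E c ^+ q.
Let Om1 c := q%:R * E c ^+ q.-1 * E1 c.
Let alpha c := (Om1 c * S1 c + Om c * S2 c) * (1 - c ^+ 2) - n%:R * (Om c * c * S1 c + Om c * S c) -
  c * (Om1 c * S c + 2 * Om c * S1 c).
Let beta c := (Om1 c * B1 c + Om c * B2 c) * (1 - c ^+ 2) - n%:R * (Om c * c * B1 c) +
  (Om1 c * S c + 2 * Om c * S1 c).

Lemma flux_div x j : dot x x = 1 ->
  (\sum_(i < n.+1) partial i (flux i) x) 0 j = alpha (om 0 x) * om j x + (j == 0)%:R * beta (om 0 x).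
Proof.
move=> xu; have x0 := unit_neq0 _ xu; have w1 := om_sum x x0.
set c := om 0 x.
(* Also true for [q = 0], where [q.-1] is again 0 but the factor [q] vanishes. *)
have qE1 : q%:R * E c ^+ q.-1 * E c = q%:R * Om c.
  by rewrite /Om -mulrA; case: q => [|q'] /=; rewrite ?mul0r // -exprSr.
have pE i : partial i (flux i) x 0 j =
    q%:R * E c ^+ q.-1 * (- om i x * E c + E1 c * tang i x) * gradij i j x +
    E c ^+ q * (- om i x * gradij i j x + 'D_(vdir i) (gradij i j) x).
  have dF : derivable (flux i) x (vdir i).
    by apply/derivable_mxP => a k; rewrite (ord1 a); have [] := der_flux x i k xu.
  by rewrite /partial (derive_mx dF) mxE; have [_ ->] := der_flux x i j xu.
rewrite summxE.
(* The six-coefficient form of [sum_div], with the powers of [E] collected into [Om] and [Om1]. *)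
have e i : partial i (flux i) x 0 j =
  (Om1 c * (S1 c * om j x + (j == 0)%:R * B1 c) + Om c * (S2 c * om j x + (j == 0)%:R * B2 c)) * tang i x ^+ 2 +
  (- (q%:R + 1) * Om c * (S1 c * om j x + (j == 0)%:R * B1 c) - Om1 c * S c * om j x -
    Om c * (S1 c * om j x + (j == 0)%:R * B1 c) - 2 * Om c * S1 c * om j x) * (tang i x * om i x) +
  ((q%:R + 1) * Om c * S c * om j x + Om c * c * (S1 c * om j x + (j == 0)%:R * B1 c) + 2 * Om c * S c * om j x) * om i x ^+ 2 +
  (Om1 c * S c + 2 * Om c * S1 c) * (tang i x * (i == j)%:R) +
  (- (q%:R + 1) * Om c * S c - Om c * S c) * (om i x * (i == j)%:R) +
  (- Om c * c * (S1 c * om j x + (j == 0)%:R * B1 c) - Om c * S c * om j x).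
  rewrite pE; have [_ ->] := der_grad x i j xu.
  have -> : q%:R * E c ^+ q.-1 * (- om i x * E c + E1 c * tang i x) = - om i x * (q%:R * Om c) + Om1 c * tang i x.
    by rewrite -qE1 /Om1; ring.
  rewrite -/(Om c) /gradij /grad -/S1 -/B -/B1 -/c /wij eqxx.
  by rewrite mulr1n; ring.
rewrite (eq_bigr _ (fun i _ => e i)).
have := sum_div (fun j => om j x) _ _ _ _ _ _ j w1.
move=> /= ->; have -> : n.+1%:R = n%:R + 1 :> R by rewrite -natr1.
rewrite -/c /alpha /beta -/(tang j x) /tang -/c.
by ring.
Qed.

(** Second derivatives are found by differentiating the first-order relations of the profile, which
    hold on an open set, and using uniqueness of derivatives. *)
Lemma tension_parallel c : `|c| < 1 -> alpha c * (C c - c * S c) = beta c * S c.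
Proof.
move=> hc; have Ic : I c by rewrite /I /symint /=; have := d0; lra.
have D0 : 1 - c ^+ 2 != 0.
  move: hc; rewrite ltr_norml => hc.
  by rewrite (_ : 1 - c ^+ 2 = (1 - c) * (1 + c)); [rewrite mulf_neq0 // gt_eqF //; lra|ring].
have dS := der_S _ _ _ _ _ _ pr c Ic; have dS1 := der_S1 _ _ _ _ _ _ pr c Ic.
have dC := pr_C _ _ _ _ _ _ pr c Ic; have dv := der_v c Ic.
have near_I : \near c, I c by apply: open_near => //; exact: open_symint.
have B1E : B1 c = v c * S c ^+ 2 - S c - c * S1 c := axial1E _ _ _ _ _ _ pr c Ic.
have B2E : B2 c = v1 c * S c ^+ 2 + 2 * v c * S c * S1 c - 2 * S1 c - c * S2 c.
  have h : is_derive c 1 B1 (v1 c * S c ^+ 2 + 2 * v c * S c * S1 c - 2 * S1 c - c * S2 c).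
    apply: (der_near (fun c => v c * S c ^+ 2 - S c - c * S1 c)).
      by apply: filterS near_I => z Iz; rewrite /B1 /B (axial1E _ _ _ _ _ _ pr z Iz).
    apply: der_eq (derB _ _ _ _ _ _ (derB _ _ _ _ _ _ (derM _ _ _ _ _ _ dv (derX 2 _ _ _ _ dS)) dS) (derM _ _ _ _ _ _ (der_id c) dS1)) _.
    by rewrite /= expr1 -/S1 -/S2; ring.
  exact: der_unique (der_axial1 _ _ _ _ _ _ pr c Ic) h.
have s2E : (1 - c ^+ 2) * S2 c - 2 * c * S1 c = S1 c * (c - C c * v c) + S c * (1 - v c * S c ^+ 2 * v c - C c * v1 c).
  have h1 : is_derive c 1 (fun c => (1 - c ^+ 2) * S1 c) ((1 - c ^+ 2) * S2 c - 2 * c * S1 c).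
    apply: der_eq (derM _ _ _ _ _ _ (derB _ _ _ _ _ _ (der_cst (1 : R) c 1) (derX 2 _ _ _ _ (der_id c))) dS1) _.
    by rewrite /= expr1 -/S1 -/S2; ring.
  have h2 : is_derive c 1 (fun c => (1 - c ^+ 2) * S1 c)
      (S1 c * (c - C c * v c) + S c * (1 - v c * S c ^+ 2 * v c - C c * v1 c)).
    apply: (der_near (fun c => S c * (c - C c * v c))).
      by apply: filterS near_I => z Iz; rewrite -(pr_S _ _ _ _ _ _ pr z Iz).
    apply: der_eq (derM _ _ _ _ _ _ dS (derB _ _ _ _ _ _ (der_id c) (derM _ _ _ _ _ _ dC dv))) _.
    by rewrite -/S1; ring.
  exact: der_unique h1 h2.
have hE1 : (1 - c ^+ 2) * E1 c = E c * (c - C c * v c + v c * ((1 - c ^+ 2) * v1 c) / (v c ^+ 2 + al)).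
  have r0 : Num.sqrt (v c ^+ 2 + al) != 0 by rewrite gt_eqF // sqrtr_gt0.
  rewrite /E1 mulrDr mulrA (pr_S _ _ _ _ _ _ pr c Ic : (1 - c ^+ 2) * S1 c = _) /E /energy.
  have := @sqr_sqrtr _ _ (ltW (va0 c)); move: (Num.sqrt _) r0 => r r0 <-.
  by field.
have hO : (1 - c ^+ 2) * Om1 c = Om c * ((be - 1) * (c - C c * v c + v c * ((1 - c ^+ 2) * v1 c) / (v c ^+ 2 + al))).
  rewrite /Om1 mulrCA hE1 -qE.
  have -> : q%:R * E c ^+ q.-1 * (E c * (c - C c * v c + v c * ((1 - c ^+ 2) * v1 c) / (v c ^+ 2 + al))) =
    (q%:R * E c ^+ q.-1 * E c) * (c - C c * v c + v c * ((1 - c ^+ 2) * v1 c) / (v c ^+ 2 + al)) by ring.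
  have -> : q%:R * E c ^+ q.-1 * E c = q%:R * Om c.
    by rewrite /Om -mulrA; case: q => [|q'] /=; rewrite ?mul0r // -exprSr.
  by ring.
rewrite /alpha /beta B1E B2E nE.
exact: (tension_identity al be c (C c) (S c) (v c) (S1 c) (S2 c) (v1 c) (Om c) (Om1 c) _ al0 be1
  (pr_pos _ _ _ _ _ _ pr c Ic) D0 (pr_norm _ _ _ _ _ _ pr c Ic) (pr_S _ _ _ _ _ _ pr c Ic) s2E erefl
  (pr_v _ _ _ _ _ _ pr c hc) hO).
Qed.

(* The divergence is [alpha u + beta e_0], and [phi u = S u + (C - c S) e_0], so it is
   normal to the sphere when these are proportional; at the poles [u] is itself a multiple
   of [e_0]. *)
Theorem rmap_tension y : p_tension q.+2 (rmap C S) y = 0.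
Proof.
have yu := val_dot y; have y0 := unit_neq0 _ yu.
rewrite /p_tension; set X := \sum_(i < n.+1) _.
have XE j : X 0 j = alpha (om 0 (val y)) * om j (val y) + (j == 0)%:R * beta (om 0 (val y)).
  rewrite -(flux_div _ _ yu) /X !subSS subn0.
  by congr (fun_of_matrix _ 0 j).
have fE j := rmap_val al be d C S v d0 pr y j.
have h1 := om_le1 (val y) 0 y0; have c0 : om 0 (val y) = val y 0 0 by exact: om_unit.
set c := val y 0 0 in c0 fE; rewrite c0 in XE h1.
suff [k kE] : exists k, X = k *: val (rmap C S y) by rewrite kE tproj_parallel.
have Ic : I c by rewrite /I /symint /=; have := d0; lra.
have Sn : S c != 0 by rewrite gt_eqF //; exact: (pr_pos _ _ _ _ _ _ pr).
have [hc|hc] := ltP `|c| 1.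
  exists (alpha c / S c); apply/rowP => j; rewrite mxE XE fE om_unit //.
  have hp := tension_parallel c hc.
  have -> : beta c = alpha c * (C c - c * S c) / S c by rewrite hp; field.
  by rewrite /axial; field.
have cc : c * c = 1.
  have : `|c| = 1 by apply/eqP; rewrite eq_le h1 hc.
  by move=> h; rewrite -expr2 -real_normK ?num_real // h expr1n.
have yj j : j != 0 -> val y 0 j = 0.
  move=> jn; have := yu; rewrite /dot (bigD1 0) //= -/c cc => /eqP.
  rewrite -subr_eq0 addrAC subrr add0r psumr_eq0; last by move=> k _; exact: sqr_ge0.
  by move=> /allP /(_ j (mem_index_enum _)); rewrite jn /= mulf_eq0 orbb => /eqP.
have CC : C c * C c = 1.
  have := pr_norm _ _ _ _ _ _ pr c Ic; rewrite !expr2 cc subrr mul0r addr0 //.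
exists ((alpha c * c + beta c) * C c); apply/rowP => j; rewrite mxE XE fE om_unit //.
have [->|jn] := eqVneq j 0.
  rewrite -/c /axial /= mulr1n.
  have -> : S c * c + 1 * (C c - c * S c) = C c by ring.
  by rewrite -mulrA CC; ring.
by rewrite yj // !(mulr0, mul0r, addr0).
Qed.

End Tension.

(** * Rotational symmetry and distinctness *)

Section RotationalSymmetry.
Context {R : realType}.
Implicit Types (t c : R).

(** Continuity at $\pm1$, where [acos] is not differentiable, is needed because the profile takes
    these values at the poles. Strict monotonicity of [cos] on $[0,\pi]$ gives it. *)
Lemma acos_clip_cont : continuous (fun x : R => acos (clip 1 x)).
Proof.
have hc (x : R) : -1 <= clip 1 x <= 1 by rewrite -ler_norml clip_bound // ler01.
have ab (x : R) : 0 <= acos (clip 1 x) <= pi by have [] := acos_def (hc x).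
have ck (x : R) : cos (acos (clip 1 x)) = clip 1 x by have [] := acos_def (hc x).
move=> x; apply/cont_ed => e e0; set a := acos (clip 1 x).
have ha : 0 <= a <= pi by exact: ab.
(* If $a-e$ or $a+e$ leaves $[0,\pi]$, that side of the estimate is automatic and any positive value
   serves. *)
pose d1 := if 0 <= a - e then cos (a - e) - cos a else 1.
pose d2 := if a + e <= pi then cos a - cos (a + e) else 1.
have d10 : 0 < d1.
  by rewrite /d1; case: ifP => // h; rewrite subr_gt0 ltr_cos ?in_itv /=; lra.
have d20 : 0 < d2.
  by rewrite /d2; case: ifP => // h; rewrite subr_gt0 ltr_cos ?in_itv /=; lra.
exists (Num.min d1 d2); first by rewrite lt_min d10.
move=> y; rewrite lt_min => /andP[y1 y2]; set b := acos (clip 1 y).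
have hb : 0 <= b <= pi by exact: ab.
have := clip_lip 1 y x; rewrite -(ck x) -(ck y) -/a -/b => hl.
have hl1 := le_lt_trans hl y1; have hl2 := le_lt_trans hl y2.
move: hl1 hl2; rewrite !ltr_norml => /andP[_ hl1] /andP[hl2 _].
rewrite ltrBDl ltrBlDl; apply/andP; split; rewrite ltNge; apply/negP => hba.
  have a0 : 0 <= a - e by lra.
  have : cos (a - e) <= cos b by rewrite leNgt ltr_cos ?in_itv /= -?leNgt; (clear -x e a y b hba e0 ha hb; lra).
  by move: hl1; rewrite /d1 a0; lra.
have a0 : a + e <= pi by lra.
have : cos b <= cos (a + e) by rewrite leNgt ltr_cos ?in_itv /= -?leNgt; (clear -x e a y b hba hb e0 ha; lra).
by move: hl2; rewrite /d2 a0; lra.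
Qed.

Variables (m : nat) (al be d : R) (C S v : R -> R).
Hypothesis d0 : 0 < d.
Hypothesis pr : profile al be d C S v.

Lemma polar_head t (w : usphere R m) : val (polar t w) 0 0 = cos t.
Proof.
have -> : val (polar t w) 0 0 = row_mx (cos t)%:M (sin t *: val w) 0 (lshift m 0).
  by congr (row_mx _ _ _ _); exact: val_inj.
by rewrite row_mxEl mxE eqxx mulr1n.
Qed.

Lemma polar_tail t (w : usphere R m) k : val (polar t w) 0 (rshift 1 k) = sin t * val w 0 k.
Proof.
have -> : val (polar t w) 0 (rshift 1 k) = row_mx (cos t)%:M (sin t *: val w) 0 (rshift 1 k) by [].
by rewrite row_mxEr mxE.
Qed.

Lemma rmap_polar_tail t (w : usphere R m) k :
  val (rmap C S (polar t w)) 0 (rshift 1 k) = S (cos t) * (sin t * val w 0 k).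
Proof.
rewrite (rmap_val al be d C S v d0 pr) polar_head polar_tail.
have -> : (rshift 1 k == 0 :> 'I_m.+1) = false by [].
by rewrite mul0r addr0.
Qed.

Lemma rmap_polar_head t (w : usphere R m) : val (rmap C S (polar t w)) 0 0 = C (cos t).
Proof. by rewrite (rmap_val al be d C S v d0 pr) polar_head eqxx mul1r /axial; ring. Qed.

Let cos_dom t : `|cos t| < 1 + d.
Proof. by have := d0; have := cos_max t; lra. Qed.

Lemma profile_le1 c : `|c| <= 1 -> `|C c| <= 1.
Proof.
move=> hc; have hd : `|c| < 1 + d by have := d0; lra.
rewrite -(@ler_pXn2r _ 2) // ?nnegrE // expr1n real_normK ?num_real //.
have := pr_norm _ _ _ _ _ _ pr c hd.
have : 0 <= (1 - c ^+ 2) * S c ^+ 2.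
  apply: mulr_ge0; last exact: sqr_ge0.
  by rewrite subr_ge0 -(@real_normK _ c) ?num_real // expr_le1.
lra.
Qed.

(** Because $S>0$, $\sin r=S\sin t$ is nonnegative, so $r=\arccos C(\cos t)$ is the right lift; it
    stays in $[0,\pi]$ and $k=1$. *)
Theorem rmap_rot_sym : rot_sym (rmap C S : usphere R m.+1 -> usphere R m.+1).
Proof.
have Cc t : {for t, continuous (fun t => C (cos t))}.
  apply: (@continuous_comp _ _ _ (@cos R) C); first exact: continuous_cos.
  exact: der_cont (pr_C _ _ _ _ _ _ pr _ (cos_dom t)).
exists (fun t => acos (clip 1 (C (cos t)))), 1; split.
- apply: continuous_subspaceT => t.
  by apply: (@continuous_comp _ _ _ (fun t => C (cos t)) (fun x => acos (clip 1 x))); [exact: Cc|exact: acos_clip_cont].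
- by rewrite cos0 (pr_C1 _ _ _ _ _ _ pr) clip_id ?normr1 // acos1.
- by rewrite cospi (pr_CN1 _ _ _ _ _ _ pr) clip_id ?normrN ?normr1 // acosN1 mul1r.
move=> t w ht; have hC := profile_le1 (cos t) (cos_max t).
rewrite clip_id //; apply: val_inj; apply/rowP => j.
have hC' : -1 <= C (cos t) <= 1 by rewrite -ler_norml.
case: (split_ordP (j : 'I_(1 + m))) => k ->.
  have -> : lshift m k = 0 :> 'I_m.+1 by apply: val_inj; rewrite /= (ord1 k).
  rewrite rmap_polar_head polar_head acosK //.
rewrite rmap_polar_tail polar_tail sin_acos // mulrA; congr (_ * _).
have -> : 1 - C (cos t) ^+ 2 = (S (cos t) * sin t) ^+ 2.
  have := pr_norm _ _ _ _ _ _ pr _ (cos_dom t); have := cos2Dsin2 t => h1 h2.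
  by rewrite exprMn (_ : sin t ^+ 2 = 1 - cos t ^+ 2); lra.
rewrite sqrtr_sqr ger0_norm //; apply: mulr_ge0; last exact: sin_ge0_pi.
exact/ltW/(pr_pos _ _ _ _ _ _ pr).
Qed.

End RotationalSymmetry.

(** * Distinctness of the maps *)

Section Distinct.
Context {R : realType}.

(** An equatorial coordinate of the image divided by that of the argument gives $S(\cos t)$ for
    $0<t<\pi$; the value at the pole follows by continuity. *)
Lemma rmap_slope m al be d (C S v : R -> R) al' be' d' (C' S' v' : R -> R) :
  0 < d -> profile al be d C S v -> 0 < d' -> profile al' be' d' C' S' v' ->
  (rmap C S : usphere R m.+2 -> _) = rmap C' S' -> S 1 = S' 1.
Proof.
move=> d0 pr d0' pr' E.
have w1 : dot (delta_mx 0 0 : 'rV[R]_m.+1) (delta_mx 0 0) == 1.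
  rewrite /dot (bigD1 0) //= big1 ?addr0 => [|i /negPf i0]; first by rewrite !mxE eqxx mulr1.
  by rewrite !mxE i0 mulr0.
pose w : usphere R m.+1 := exist _ (delta_mx 0 0 : 'rV[R]_m.+1) w1.
have SS c : -1 < c < 1 -> S c = S' c.
  move=> hc; have hc' : -1 <= c <= 1 by lra.
  have [_ cE] := acos_def hc'.
  have t0 : 0 < acos c < pi by rewrite acos_gt0 ?acos_ltpi //; lra.
  have s0 := sin_gt0_pi t0.
  have : val (rmap C S (polar (acos c) w)) 0 (rshift 1 0) = val (rmap C' S' (polar (acos c) w)) 0 (rshift 1 0) by rewrite E.
  rewrite (rmap_polar_tail _ _ _ _ _ _ _ d0 pr) (rmap_polar_tail _ _ _ _ _ _ _ d0' pr') cE /= mxE eqxx mulr1.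
  by apply: mulIf; rewrite gt_eqF.
have cS : {for 1, continuous S}.
  have [_ [h _] _] := pr_smooth _ _ _ _ _ _ pr 0%N; apply: h.
  by rewrite /symint /= normr1; lra.
have cS' : {for 1, continuous S'}.
  have [_ [h _] _] := pr_smooth _ _ _ _ _ _ pr' 0%N; apply: h.
  by rewrite /symint /= normr1; lra.
apply/eqP; rewrite -subr_eq0; apply/negP => /negP n0.
have e0 : 0 < `|S 1 - S' 1| / 2 by rewrite divr_gt0 // normr_gt0.
have /cont_ed /(_ _ e0)[r r0 hr] := cS; have /cont_ed /(_ _ e0)[r' r0' hr'] := cS'.
pose k := Num.min 1 (Num.min r r') / 2.
have m0 : 0 < Num.min 1 (Num.min r r') by rewrite !lt_min ltr01 r0 r0'.
have [m1 m2 m3] : [/\ Num.min 1 (Num.min r r') <= 1, Num.min 1 (Num.min r r') <= r & Num.min 1 (Num.min r r') <= r'].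
  by rewrite !ge_min !lexx /= ?orbT.
have kE : `|1 - k - 1| = k by rewrite addrAC subrr add0r normrN gtr0_norm // divr_gt0.
have k1 : k < Num.min 1 (Num.min r r') by rewrite /k; (clear -r r' m0; lra).
have k0 : 0 < k by rewrite divr_gt0.
have h1 := hr (1 - k); have h2 := hr' (1 - k); rewrite kE in h1 h2.
have {}h1 := h1 (lt_le_trans k1 m2); have {}h2 := h2 (lt_le_trans k1 m3).
have hk : -1 < 1 - k < 1 by (clear -r r' k m1 k1 k0; lra).
rewrite (SS _ hk) distrC in h1.
have := ler_normD (S 1 - S' (1 - k)) (S' (1 - k) - S' 1).
by rewrite addrA subrK; move: h1 h2; (clear -S S' r r' k; lra).
Qed.

Lemma pos_lower_bound (s : seq R) : exists2 b, 0 < b < 1 & forall x, x \in s -> 0 < x -> b <= x.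
Proof.
elim: s => [|a s [b b0 hb]]; first by exists (1 / 2) => //; lra.
have [a0|a0] := ltP 0 a.
  exists (Num.min a b); first by rewrite lt_min gt_min; move: b0; lra.
  by move=> x; rewrite inE ge_min => /predU1P[->|xs] x0; rewrite ?lexx // (hb x) ?orbT.
exists b => // x; rewrite inE => /predU1P[->|xs] x0; last exact: hb.
by move: x0; rewrite ltNge a0.
Qed.

End Distinct.

Theorem theorem1p1 (R : realType) (p : nat) (hp : (2 <= p)%N) (m : nat)
    (hpm : (p < m)%N) (hm : m%:R < 2 + p%:R + 2 * Num.sqrt (p%:R : R)) :
  infinite_set
    [set phi : usphere R m.+1 -> usphere R m.+1 |
      p_harmonic p phi /\ rot_sym phi].
Proof.
case: p hp hpm hm => [|[|q]] // _; case: m => [//|m] hpm hm.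
pose al : R := m.+1%:R - 1; pose be : R := q.+2%:R - 1.
have p2 : 2 <= q.+2%:R :> R by rewrite ler_nat.
have pm : q.+2%:R + 1 <= m.+1%:R :> R by rewrite natr1 ler_nat.
have be1 : 1 <= be by rewrite /be; lra.
have ab : be < al by rewrite /al /be; lra.
have disc : (al - be) ^+ 2 < 4 * al.
  have := @sqr_sqrtr R q.+2%:R (ler0n _ _); have := sqrtr_ge0 (q.+2%:R : R).
  move: hm p2 pm; rewrite /al /be; move: (Num.sqrt _) => s.
  move: (q.+2%:R : R) (m.+1%:R : R) => x y hy x2 xy s0 sE.
  (* For $m-p>2$ one squares $m-p-2<2\sqrt p$, which is $(m-p)^2<4(m-1)$ after rearrangement; for
     $m-p\le2$ the bound follows from $p\ge2$. *)
  have [h|h] := leP (y - x) 2; first by nra.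
  have : 0 <= (2 * s - (y - x - 2)) * (2 * s + (y - x - 2)) by apply: mulr_ge0; lra.
  rewrite -sE in hy xy x2 *; nra.
have nE : m.+2.+1%:R = al + 3 :> R by rewrite /al -!natr1; lra.
have [s0 [g [w [u [v FS]]]]] := family_exists al be m.+2 be1 ab isT nE.
pose good := [set e : R | 0 < e < 1 /\ u e (- ln e / 2) = 0].
(* Relates a map to its parameter, which is unique since $S(1)=e^{-1/2}$. Finitely many maps would
   have only finitely many parameters, with a positive lower bound [b], but [zeros_exist] yields one
   that is at most [b / 2]. *)
pose P (phi : usphere R m.+2 -> usphere R m.+2) : set R := [set e : R | 0 < e /\ exists d C S v,
  [/\ 0 < d, profile al be d C S v, S 1 = (Num.sqrt e)^-1 & phi = rmap C S]].
have Puniq phi e e' : P phi e -> P phi e' -> e = e'.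
  move=> [e0 [d [C [S [v1 [d0 pr S1 E]]]]]] [e0' [d' [C' [S' [v1' [d0' pr' S1' E']]]]]].
  have h : S 1 = S' 1 by apply: (rmap_slope m _ _ _ _ _ _ _ _ _ _ _ _ d0 pr d0' pr'); rewrite -E -E'.
  have {h} : Num.sqrt e = Num.sqrt e' by apply: invr_inj; rewrite -S1 -S1'.
  by move=> h; rewrite -(sqr_sqrtr (ltW e0)) h sqr_sqrtr // ltW.
move=> fin; pose inv phi := xget 0 (P phi).
have /finite_seqP[s sE] := finite_image inv fin.
have [b b01 hb] := pos_lower_bound s.
have hb2 : 0 < b / 2 < 1 by lra.
have [e [he ue]] := zeros_exist al be m.+2 s0 g w u v _ be1 ab disc FS hb2.
have e01 : 0 < e < 1 by lra.
have [d [C [S [v1 [d0 pr S1]]]]] := profile_exists al be m.+2 s0 g w u v e be1 ab isT nE FS e01 ue.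
have Pe : P (rmap C S) e by split; [(clear -b e he; lra)|exists d, C, S, v1].
have : e \in s.
  suff : [set` s] e by [].
  rewrite -sE; exists (rmap C S).
    split; last exact: (rmap_rot_sym _ _ _ _ _ _ _ d0 pr).
    split; first exact: (rmap_smooth _ _ _ _ _ _ d0 pr).
    move=> y; apply: (rmap_tension _ _ _ _ _ _ d0 pr); [(clear -q m al be be1 ab; lra)|exact: be1|by rewrite /al subrK|].
    by rewrite /be -!natr1; (clear -q; lra).
  exact: Puniq (xgetPex 0 (ex_intro _ e Pe)) Pe.
by move=> /hb; (clear -b e he; lra).
Qed.
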